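(* Let $a>c>b>0$ and consider the ellipsoid $\mathbb E_{a,c,c,b}\subset\mathbb R^4$ defined by $$\frac{x^2}{a^2}+\frac{y^2}{b^2}+\frac{z^2+w^2}{c^2}=1,$$ oriented by the inner unit normal. Let $E_0=\{(x,y,0,0):\frac{x^2}{a^2}+\frac{y^2}{b^2}=1\}$. Then: (i) The umbilic set is contained in the ellipse $E_0$ and consists of the four points $(a\cos u,b\sin u,0,0)$ with $\cos^2u=\frac{a^2-c^2}{a^2-b^2}$; the partially umbilic set consists of the four complementary arcs contained in $E_0$. (ii) The ellipsoid $\mathbb E_{a,c,c,b}$ is foliated by a pencil of two-dimensional ellipsoids, all passing through the ellipse $E_0$. Each of these surfaces is an integral leaf of the distribution of planes generated by $\mathcal L_1$ and $\mathcal L_3$, and the principal configuration restricted to it is principally equivalent to that of a two-dimensional ellipsoid with three different axes in $\mathbb R^3$. (iii) The principal foliation $\mathcal F_2$ is singular on $E_0$, and all its regular leaves are circles orthogonal to the pencil of surfaces, which has a book structure around $E_0$.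
   Context: For an ellipsoid in $\mathbb R^4$ with inner unit normal $N$, the principal curvatures $k_1\le k_2\le k_3$ at a point are the eigenvalues of $D(-N)$ on the tangent space. A point is umbilic if $k_1=k_2=k_3$, and partially umbilic if exactly two of the principal curvatures are equal (type $\mathcal P_{12}$ if $k_1=k_2<k_3$, type $\mathcal P_{23}$ if $k_1<k_2=k_3$). The eigenline field of $k_i$ is denoted $\mathcal L_i$: $\mathcal L_1$ is defined off umbilic points and points of type $\mathcal P_{12}$, $\mathcal L_3$ off umbilic points and points of type $\mathcal P_{23}$, and $\mathcal L_2$ off all umbilic and partially umbilic points. $\mathcal F_i$ is the foliation by integral curves of $\mathcal L_i$; it is singular where $\mathcal L_i$ is not defined. ''Foliated by a pencil of surfaces passing through $E_0$'' means that the surfaces cover the ellipsoid and any two of them meet exactly along $E_0$. ''Integral leaf'' means tangent to the plane distribution at all points where the latter is defined. A book structure around a closed curve $S$ in a $3$-manifold $M$ is a smooth fibration $p:M\setminus S\to\mathbb S^1$ such that the closure of each fibre $p^{-1}(\theta)$ contains $S$ and is a regular surface, and $S=\bigcap_\theta \mathrm{cl}[p^{-1}(\theta)]$; $S$ is the binding. Each two-dimensional ellipsoid of the pencil is the union of two such pages. The principal configuration restricted to a surface $S$ of the pencil consists of the two families of lines of curvature of the hypersurface contained in $S$ (extended by continuity across $E_0$ where possible), together with the points of $S$ where these families are singular. For a surface in $\mathbb R^3$ the principal configuration consists of the umbilic points and the two principal foliations. Two such configurations are principally equivalent if there is a homeomorphism between the surfaces preserving both foliations and mapping singular points to singular points.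 *)

(* Defs.v *)
From HB Require Import structures.
From mathcomp Require Import all_boot all_order all_algebra.
From mathcomp Require Import all_classical all_reals all_analysis.
Set Implicit Arguments.
Unset Strict Implicit.
Unset Printing Implicit Defensive.
Import Order.TTheory GRing.Theory Num.Theory.
Import numFieldNormedType.Exports.
Local Open Scope classical_set_scope.
Local Open Scope ring_scope.

(* The library norm on 'rV[R]_n is the sup norm; it is used only for the
   topology.  Lengths and angles are Euclidean. *)
Definition dot (R : realType) (n : nat) (u v : 'rV[R]_n) : R :=
  \sum_i u 0 i * v 0 i.

Definition enorm (R : realType) (n : nat) (u : 'rV[R]_n) : R :=
  Num.sqrt (dot u u).

Definition vec4 (R : realType) (x y z w : R) : 'rV[R]_4 :=
  \row_i nth 0 [:: x; y; z; w] i.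

(* X need not be a smooth submanifold for this definition to make sense, but
   when it is, these are the vectors of the usual tangent space. *)
Definition tangent (R : realType) (n : nat) (X : set 'rV[R]_n.+1)
    (p v : 'rV[R]_n.+1) : Prop :=
  exists g : R -> 'rV[R]_n.+1,
    [/\ g 0 = p, \forall t \near (0 : R), X (g t) & is_derive (0 : R) 1 g v].

Definition ellipsoid_form (R : realType) (n : nat) (s p : 'rV[R]_n.+1) : R :=
  \sum_i (p 0 i / s 0 i) ^+ 2.

Definition ellipsoid (R : realType) (n : nat) (s : 'rV[R]_n.+1) :
    set 'rV[R]_n.+1 :=
  [set p | ellipsoid_form s p = 1].

Definition gradient (R : realType) (n : nat) (f : 'rV[R]_n.+1 -> R)
    (p : 'rV[R]_n.+1) : 'rV[R]_n.+1 :=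
  \row_i 'D_(delta_mx 0 i) f p.

(* The interior is where the form is < 1, hence the sign.  The formula extends
   N smoothly to the complement of the origin. *)
Definition inner_normal (R : realType) (n : nat) (s p : 'rV[R]_n.+1) :
    'rV[R]_n.+1 :=
  - ((enorm (gradient (ellipsoid_form s) p))^-1
       *: gradient (ellipsoid_form s) p).

(* D(-N) at p, to be applied to vectors tangent to the ellipsoid at p: there it
   depends only on N along the ellipsoid. *)
Definition shape (R : realType) (n : nat) (s p v : 'rV[R]_n.+1) :
    'rV[R]_n.+1 :=
  'D_v (fun q => - inner_normal s q) p.

(* k lists, in nondecreasing order and with multiplicities, the eigenvalues of
   D(-N) on the tangent space at p (of dimension n): the rows of e form a basis
   of eigenvectors. *)
Definition principal_curvatures (R : realType) (n : nat) (s p : 'rV[R]_n.+1)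
    (k : 'I_n -> R) : Prop :=
  (forall i j : 'I_n, (i <= j)%N -> k i <= k j) /\
  exists e : 'M[R]_(n, n.+1),
    row_free e /\
    forall i, tangent (ellipsoid s) p (row i e) /\
              shape s p (row i e) = k i *: row i e.

Definition umbilics (R : realType) (n : nat) (s : 'rV[R]_n.+1) :
    set 'rV[R]_n.+1 :=
  [set p | ellipsoid s p /\
     exists k : 'I_n -> R,
       principal_curvatures s p k /\ forall i j, k i = k j].

Definition partial_umbilics (R : realType) (s : 'rV[R]_4) : set 'rV[R]_4 :=
  [set p | ellipsoid s p /\
     exists k : 'I_3 -> R,
       principal_curvatures s p k /\
       ((k ord0 = k (inord 1) /\ k (inord 1) < k ord_max) \/
        (k ord0 < k (inord 1) /\ k (inord 1) = k ord_max))].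

(* A line field in R^n.+1, singular at some points: L p is the set of the
   nonzero vectors of the line at p, and is empty where there is no line. *)
Definition line_field (R : realType) (n : nat) : Type :=
  'rV[R]_n.+1 -> set 'rV[R]_n.+1.

(* Eigenlines of the i-th principal curvature, defined where it is simple.
   For n = 3, besides the umbilics, i = 0 excludes the points with
   k 0 = k 1 < k 2, i = 2 those with k 0 < k 1 = k 2, and i = 1 both. *)
Definition principal_line (R : realType) (n : nat) (s : 'rV[R]_n.+1)
    (i : 'I_n) : line_field R n :=
  fun p => [set v | ellipsoid s p /\
    exists k : 'I_n -> R,
      [/\ principal_curvatures s p k, forall j, j != i -> k j <> k i,
          tangent (ellipsoid s) p v, v <> 0 & shape s p v = k i *: v]].

Definition singular_points (R : realType) (n : nat) (X : set 'rV[R]_n.+1)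
    (L : line_field R n) : set 'rV[R]_n.+1 :=
  [set p | X p /\ L p = set0].

Definition integral_curve (R : realType) (n : nat) (X : set 'rV[R]_n.+1)
    (L : line_field R n) (al be : R) (g : R -> 'rV[R]_n.+1) : Prop :=
  (forall t, al < t < be ->
     [/\ X (g t), derivable g t 1 & L (g t) (derive1 g t)]) /\
  (forall t, al < t < be -> {for t, continuous (derive1 g)}).

(* The leaf through p of the foliation of X by integral curves of L; it is
   empty when L has no line at p. *)
Definition leaf (R : realType) (n : nat) (X : set 'rV[R]_n.+1)
    (L : line_field R n) (p : 'rV[R]_n.+1) : set 'rV[R]_n.+1 :=
  [set q | exists (al be t0 t1 : R) (g : R -> 'rV[R]_n.+1),
     [/\ integral_curve X L al be g, al < t0 < be, al < t1 < be,
         g t0 = p & g t1 = q]].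

Definition is_circle (R : realType) (n : nat) (C : set 'rV[R]_n.+1) : Prop :=
  exists (o e f : 'rV[R]_n.+1) (r : R),
    [/\ 0 < r, dot e e = 1, dot f f = 1, dot e f = 0 &
        C = [set o + (r * cos t) *: e + (r * sin t) *: f | t in [set: R]]].

(* L restricted to X, extended by continuity to the points of X where L is
   undefined and the lines of L along X converge: the line of v is the limit of
   the lines L q iff v is a limit of vectors taken in the lines L q. *)
Definition restricted_line (R : realType) (n : nat) (X : set 'rV[R]_n.+1)
    (L : line_field R n) : line_field R n :=
  fun p => [set v | X p /\
    (L p v \/
     [/\ L p = set0, v <> 0,
         closure [set q | X q /\ L q !=set0] p &
         forall eps : R, 0 < eps ->
           \forall q \near p, X q -> L q !=set0 ->
             exists2 u, L q u & `|u - v| < eps])].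

(* A carrier surface, the line fields tangent to two families of curves on it,
   and the singular points of the configuration. *)
Record configuration (R : realType) (n : nat) := Configuration {
  carrier : set 'rV[R]_n.+1;
  first_lines : line_field R n;
  second_lines : line_field R n;
  singularities : set 'rV[R]_n.+1 }.

Definition restricted_configuration (R : realType) (s : 'rV[R]_4)
    (X : set 'rV[R]_4) : configuration R 3 :=
  let L1 := restricted_line X (principal_line s ord0) in
  let L3 := restricted_line X (principal_line s ord_max) in
  Configuration X L1 L3 (singular_points X L1 `|` singular_points X L3).

Definition ellipsoid_configuration (R : realType) (s : 'rV[R]_3) :
    configuration R 2 :=
  Configuration (ellipsoid s) (principal_line s ord0)
    (principal_line s ord_max) (umbilics s).

Definition homeomorphism (R : realType) (m n : nat) (X : set 'rV[R]_m.+1)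
    (Y : set 'rV[R]_n.+1) (f : 'rV[R]_m.+1 -> 'rV[R]_n.+1) : Prop :=
  exists g : 'rV[R]_n.+1 -> 'rV[R]_m.+1,
    [/\ forall x, X x -> Y (f x) /\ g (f x) = x,
        forall y, Y y -> X (g y) /\ f (g y) = y,
        {within X, continuous f} & {within Y, continuous g}].

Definition principally_equivalent (R : realType) (m n : nat)
    (A : configuration R m) (B : configuration R n) : Prop :=
  exists h : 'rV[R]_m.+1 -> 'rV[R]_n.+1,
    [/\ homeomorphism (carrier A) (carrier B) h,
        forall p, carrier A p ->
          h @` leaf (carrier A) (first_lines A) p =
            leaf (carrier B) (first_lines B) (h p),
        forall p, carrier A p ->
          h @` leaf (carrier A) (second_lines A) p =
            leaf (carrier B) (second_lines B) (h p) &
        h @` singularities A = singularities B].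

(* The image under an isometric affine embedding of R^3 in R^4 of an
   ellipsoid of R^3. *)
Definition two_dim_ellipsoid (R : realType) (X : set 'rV[R]_4) : Prop :=
  exists (s : 'rV[R]_3) (A : 'M[R]_(3, 4)) (o : 'rV[R]_4),
    [/\ forall i, 0 < s 0 i, A *m A^T = 1%:M &
        X = [set o + q *m A | q in ellipsoid s]].

Definition foliated_by_pencil (R : realType) (n : nat)
    (M S : set 'rV[R]_n.+1) (P : set (set 'rV[R]_n.+1)) : Prop :=
  [/\ \bigcup_(X in P) X = M,
      forall X, P X -> S `<=` X &
      forall X Y, P X -> P Y -> X <> Y -> X `&` Y = S].

Definition integral_leaf (R : realType) (n : nat) (X : set 'rV[R]_n.+1)
    (L L' : line_field R n) : Prop :=
  forall p, X p -> forall v v', L p v -> L' p v' ->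
    forall u, tangent X p u <-> exists c c' : R, u = c *: v + c' *: v'.

(* Class C^k on an open set U: all iterated partial derivatives of order at
   most k exist and are continuous. *)
Fixpoint Ck (R : realType) (m n : nat) (k : nat) (U : set 'rV[R]_m.+1)
    (f : 'rV[R]_m.+1 -> 'rV[R]_n.+1) : Prop :=
  (forall p, U p -> {for p, continuous f}) /\
  match k with
  | 0 => True
  | k'.+1 => forall i : 'I_m.+1,
      (forall p, U p -> derivable f p (delta_mx 0 i)) /\
      Ck k' U (fun p => 'D_(delta_mx 0 i) f p)
  end.

Definition smooth (R : realType) (m n : nat) (X : set 'rV[R]_m.+1)
    (f : 'rV[R]_m.+1 -> 'rV[R]_n.+1) : Prop :=
  forall p, X p -> exists (V : set 'rV[R]_m.+1)
      (g : 'rV[R]_m.+1 -> 'rV[R]_n.+1),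
    [/\ open V, V p, forall k, Ck k V g &
        forall q, X q -> V q -> f q = g q].

Definition diffeomorphism (R : realType) (m n : nat) (X : set 'rV[R]_m.+1)
    (Y : set 'rV[R]_n.+1) (f : 'rV[R]_m.+1 -> 'rV[R]_n.+1) : Prop :=
  exists g : 'rV[R]_n.+1 -> 'rV[R]_m.+1,
    [/\ forall x, X x -> Y (f x) /\ g (f x) = x,
        forall y, Y y -> X (g y) /\ f (g y) = y,
        smooth X f & smooth Y g].

(* Surjective and locally trivial; the products (W `&` Y) x fibre are realized
   by concatenation of row vectors. *)
Definition smooth_fibration (R : realType) (m n : nat) (X : set 'rV[R]_m.+1)
    (Y : set 'rV[R]_n.+1) (p : 'rV[R]_m.+1 -> 'rV[R]_n.+1) : Prop :=
  [/\ smooth X p, p @` X = Y &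
      forall y, Y y ->
        exists (W : set 'rV[R]_n.+1)
               (F : 'rV[R]_m.+1 -> 'rV[R]_(n.+1 + m.+1)),
          [/\ open W, W y,
              diffeomorphism (X `&` p @^-1` W)
                [set r | [/\ Y (lsubmx r), W (lsubmx r), X (rsubmx r) &
                             p (rsubmx r) = y]] F &
              forall q, X q -> W (p q) -> lsubmx (F q) = p q]].

(* X is an embedded smooth surface with boundary B.  The first alternative for
   (H, dH) gives interior charts, the second one charts at boundary points. *)
Definition regular_surface (R : realType) (n : nat)
    (X B : set 'rV[R]_n.+1) : Prop :=
  B `<=` X /\
  forall p, X p ->
    exists (U : set 'rV[R]_2) (V : set 'rV[R]_n.+1)
           (phi : 'rV[R]_2 -> 'rV[R]_n.+1) (psi : 'rV[R]_n.+1 -> 'rV[R]_2)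
           (H dH : set 'rV[R]_2),
      [/\ (H = setT /\ dH = set0) \/
            (H = [set u | 0 <= u 0 ord_max] /\ dH = [set u | u 0 ord_max = 0]),
          [/\ open U, open V & V p],
          smooth U phi /\
            (forall u v, U u -> 'D_v phi u = 0 -> v = 0),
          phi @` (U `&` H) = X `&` V /\ phi @` (U `&` dH) = B `&` V &
          {within X `&` V, continuous psi} /\
            forall u, U u -> H u -> psi (phi u) = u].

Definition unit_circle (R : realType) : set 'rV[R]_2 :=
  [set u | dot u u = 1].
Arguments unit_circle : clear implicits.

Definition page (R : realType) (n : nat) (M S : set 'rV[R]_n.+1)
    (p : 'rV[R]_n.+1 -> 'rV[R]_2) (th : 'rV[R]_2) : set 'rV[R]_n.+1 :=
  M `&` closure [set q | (M `\` S) q /\ p q = th].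

(* The pages are surfaces with boundary, the boundary being the binding S. *)
Definition book_structure (R : realType) (n : nat) (M S : set 'rV[R]_n.+1)
    (p : 'rV[R]_n.+1 -> 'rV[R]_2) : Prop :=
  [/\ smooth_fibration (M `\` S) (unit_circle R) p,
      forall th, unit_circle R th ->
        S `<=` page M S p th /\ regular_surface (page M S p th) S &
      S = \bigcap_(th in unit_circle R) page M S p th].

Definition ellipse_point (R : realType) (a b u : R) : 'rV[R]_4 :=
  vec4 (a * cos u) (b * sin u) 0 0.

Definition E0 (R : realType) (a b : R) : set 'rV[R]_4 :=
  [set p | exists x y : R,
     x ^+ 2 / a ^+ 2 + y ^+ 2 / b ^+ 2 = 1 /\ p = vec4 x y 0 0].

(* Main.v *)
Require Import Defs.
From HB Require Import structures.
From mathcomp Require Import all_boot all_order all_algebra.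
From mathcomp Require Import all_classical all_reals all_analysis.
From mathcomp Require Import fingroup perm ring lra.
Import Order.TTheory GRing.Theory Num.Theory.
Import numFieldNormedType.Exports.
Local Open Scope classical_set_scope.
Local Open Scope ring_scope.
Set Implicit Arguments.
Unset Strict Implicit.
Unset Printing Implicit Defensive.

(** Write D for the diagonal matrix of the inverse squared semi-axes, so that
    Dp is half the gradient of the quadratic form at p and -N = Dp / |Dp|.  A
    tangent vector v is an eigenvector of D(-N) exactly when Dv = m v + t Dp for
    some m and t, and its principal curvature is then m / |Dp|.  Umbilicity,
    the order of the curvatures and the eigenlines can all be read off from m.

    Rotations of the (z,w)-plane preserve the ellipsoid, and every point is
    embed h q for a unit vector h of that plane and a point q of the
    two-dimensional ellipsoid with axes a, b, c (the last coordinate r of q is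
    the signed distance to the plane z = w = 0).  Since D commutes with
    embed h, the principal directions at embed h q are the images of those of
    the surface at q, together with the direction of rotation, which always has
    m = 1/c^2 (frame3).  The two values m <= m' of the surface satisfy
    m <= 1/c^2 <= m', strictly when r is nonzero, by evaluating the
    characteristic polynomial at 1/c^2 (eigenpair_exists).  So the multiple
    curvatures occur on r = 0, that is on the ellipse E0, where one of m and m'
    is 1/c^2 and the other one is the value of the tangent to E0; the sign of
    umbilic_sign compares the two.  This yields the umbilic and the partially
    umbilic points (umbilics_part).

    The pencil consists of the images of the embed h.  They are tangent to L1
    and L3 because these are images of lines of the surface
    (sheet_integral_leaf), and L2 is tangent to the orbits of the rotations,
    whence circles (middle_leaf).  Restricted to a leaf of the pencil, L1
    and L3 coincide with the two line fields of the surface wherever they are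
    defined.  On one of the two kinds of arcs of E0 each of them is undefined,
    but an estimate of the eigenvectors near such an arc shows that it
    extends by the normal direction of E0 in the leaf (bad_side_limit); at an
    umbilic point no extension exists, because the directions have different
    limits along the two arcs which end there (good_limit, bad_limit).  Thus
    the restricted configuration is carried by embed h onto that of the surface
    (restricted_lineE, sheet_equivalent).

    The map p |-> (z,w) / |(z,w)| is a fibration of the complement of E0, and it
    is trivialized by rotating every page onto a fixed one (angle_fibration).
    Its pages are closed half ellipsoids.  Stereographic projection from a
    point of the boundary E0 maps a half ellipsoid onto a half plane, which
    gives the charts at interior and boundary points alike
    (half_sheet_regular). *)

(** * Derivatives and limits of row vectors *)

Lemma is_derive_rowP (R : realType) (V : normedModType R) (n : nat)
    (g : V -> 'rV[R]_n) (x v : V) (d : 'rV[R]_n) :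
  is_derive x v g d <-> forall i, is_derive x v (fun t => g t 0 i) (d 0 i).
Proof.
split=> [[dg <-] i|dg].
  apply: DeriveDef; last by rewrite derive_mx// mxE.
  exact: (derivable_mxP g x v).1 dg 0 i.
have dg' : derivable g x v.
  by apply/derivable_mxP => i j; rewrite ord1; case: (dg j).
apply: DeriveDef => //; rewrite derive_mx//; apply/rowP => i; rewrite mxE.
by case: (dg i).
Qed.

(** Reduces derivatives along v to functions of one real variable, for which
    the chain rule is available. *)
Lemma is_derive_line (R : realType) (V W : normedModType R) (f : V -> W)
    (x v : V) (d : W) :
  is_derive x v f d <-> is_derive (0 : R) 1 (fun h => f (h *: v + x)) d.
Proof.
have E : 'D_v f x = 'D_1 (fun h : R => f (h *: v + x)) 0.
  rewrite /derive; set g1 := fun h => h^-1 *: _; set g2 := fun h => h^-1 *: _.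
  suff -> : g1 = g2 by [].
  by rewrite funeqE /g1 /g2 => h /=; rewrite addr0 scale0r add0r [_%:A]mulr1.
split=> -[df <-].
  by apply: DeriveDef; [exact: (derivable1P f x v).1|].
by apply: DeriveDef; [exact: (derivable1P f x v).2|].
Qed.

Lemma is_derive_comp1 (R : realType) (V : normedModType R) (phi : R -> R)
    (f : V -> R) (x v : V) (d d' : R) :
  is_derive x v f d -> is_derive (f x) 1 phi d' ->
  is_derive x v (phi \o f) (d' * d).
Proof.
move=> /is_derive_line df dphi; apply/is_derive_line.
apply: (@is_derive1_comp _ phi (fun h : R => f (h *: v + x))) => //.
by rewrite scale0r add0r.
Qed.

Lemma is_derive_coord (R : realType) (n : nat) (p v : 'rV[R]_n) (i : 'I_n) :
  is_derive p v (fun q : 'rV[R]_n => q 0 i) (v 0 i).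
Proof. by move: i; apply/is_derive_rowP; exact: is_derive_id. Qed.

Lemma is_derive_ext (R : realType) (V W : normedModType R) (f g : V -> W)
    (x v : V) (d e : W) :
  f =1 g -> d = e -> is_derive x v f d -> is_derive x v g e.
Proof. by move=> /funext -> ->. Qed.

Lemma is_derive_inv (R : realType) (V : normedModType R) (f : V -> R)
    (x v : V) (d : R) :
  f x != 0 -> is_derive x v f d ->
  is_derive x v (fun t => (f t)^-1) (- (f x) ^- 2 * d).
Proof.
move=> f0 [df <-]; apply: DeriveDef; first exact: derivableV.
exact: deriveV.
Qed.

Lemma is_derive_mul (R : realType) (V : normedModType R) (f g : V -> R)
    (x v : V) (d e : R) :
  is_derive x v f d -> is_derive x v g e ->
  is_derive x v (fun t => f t * g t) (f x * e + d * g x).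
Proof.
move=> df dg; have := is_deriveM df dg; apply: is_derive_ext => //.
by rewrite /GRing.scale/= (mulrC d).
Qed.

Lemma is_derive_fsum (R : realType) (V : normedModType R) (n : nat)
    (f : 'I_n -> V -> R) (x v : V) (d : 'I_n -> R) :
  (forall i, is_derive x v (f i) (d i)) ->
  is_derive x v (fun t => \sum_i f i t) (\sum_i d i).
Proof.
by move=> fd; have := is_derive_sum fd; apply: is_derive_ext => // t; rewrite fct_sumE.
Qed.

Lemma cvg_rowP (R : realType) (T : Type) (F : set_system T) {FF : Filter F}
    (n : nat) (f : T -> 'rV[R]_n) (l : 'rV[R]_n) :
  (forall i, (fun t => f t 0 i) @ F --> l 0 i) -> f @ F --> l.
Proof.
move=> fl; apply/cvgrPdist_le => e e0; near=> x.
rewrite [leLHS]/Num.Def.normr/= mx_normrE (bigmax_le _ (ltW e0))//= => -[i j] _.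
rewrite !mxE/= ord1; move: j; near: x; apply: filter_forall => j.
exact: ((cvgrPdist_le _ _).1 (fl j)).
Unshelve. all: by end_near. Qed.

Lemma continuous_rowP (R : realType) (T : topologicalType) (n : nat)
    (f : T -> 'rV[R]_n) (q : T) :
  (forall i, {for q, continuous (fun t => f t 0 i)}) -> {for q, continuous f}.
Proof. by move=> fq; apply: (@cvg_rowP _ _ (nbhs q)). Qed.

Lemma row_coord_continuous (R : realType) (n : nat) (i : 'I_n) :
  continuous (fun q : 'rV[R]_n => q 0 i).
Proof. by move=> q; exact: coord_continuous. Qed.

Lemma coord_norm (R : realType) (n : nat) (v : 'rV[R]_n) (i : 'I_n) :
  `|v 0 i| <= `|v|.
Proof.
rewrite [leRHS]/Num.Def.normr/= mx_normrE.
exact: (le_bigmax _ (fun ij : 'I_1 * 'I_n => `|v ij.1 ij.2|) (0, i)).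
Qed.

(** * Euclidean products *)

Section Dot.
Variables (R : realType) (n : nat).
Implicit Types u v w : 'rV[R]_n.

Lemma dotC u v : dot u v = dot v u.
Proof. by apply: eq_bigr => i _; rewrite mulrC. Qed.

Lemma dotDl u v w : dot (u + v) w = dot u w + dot v w.
Proof. by rewrite /dot -big_split; apply: eq_bigr => i _; rewrite mxE mulrDl. Qed.

Lemma dotZl (k : R) u v : dot (k *: u) v = k * dot u v.
Proof. by rewrite /dot mulr_sumr; apply: eq_bigr => i _; rewrite mxE mulrA. Qed.

Lemma dotDr u v w : dot w (u + v) = dot w u + dot w v.
Proof. by rewrite dotC dotDl !(dotC w). Qed.

Lemma dotZr (k : R) u v : dot v (k *: u) = k * dot v u.
Proof. by rewrite dotC dotZl dotC. Qed.

Lemma dot0l u : dot 0 u = 0.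
Proof. by rewrite -(scale0r u) dotZl mul0r. Qed.

Lemma dotE u v : dot u v = (u *m v^T) 0 0.
Proof. by rewrite mxE; apply: eq_bigr => i _; rewrite mxE. Qed.

Lemma dot_ge0 u : 0 <= dot u u.
Proof. by apply: sumr_ge0 => i _; rewrite -expr2 sqr_ge0. Qed.

Lemma dot_eq0 u : (dot u u == 0) = (u == 0).
Proof.
apply/eqP/eqP => [/eqP|->]; last by rewrite dot0l.
rewrite psumr_eq0 => [/allP u0|i _]; last by rewrite -expr2 sqr_ge0.
apply/rowP => i; rewrite mxE; apply/eqP.
by have := u0 i (mem_index_enum _); rewrite /= mulf_eq0 orbb.
Qed.

Lemma dot_gt0 u : (0 < dot u u) = (u != 0).
Proof. by rewrite lt0r dot_ge0 andbT dot_eq0. Qed.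

Lemma enorm_gt0 u : u != 0 -> 0 < enorm u.
Proof. by move=> u0; rewrite sqrtr_gt0 dot_gt0. Qed.

Lemma sqr_enorm u : enorm u ^+ 2 = dot u u.
Proof. by rewrite sqr_sqrtr// dot_ge0. Qed.

Lemma enormZ (k : R) u : 0 <= k -> enorm (k *: u) = k * enorm u.
Proof.
move=> k0; rewrite /enorm dotZl dotZr mulrA -expr2.
by rewrite sqrtrM ?sqr_ge0// sqrtr_sqr ger0_norm.
Qed.

End Dot.

(** * The shape operator of an ellipsoid *)

(** The diagonal map v |-> Dv of the inverse squared semi-axes, which is half the
    gradient of the form at v. *)
Definition conormal (R : realType) (n : nat) (s v : 'rV[R]_n.+1) :
    'rV[R]_n.+1 :=
  \row_i (v 0 i / s 0 i ^+ 2).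

Section Ellipsoid.
Variables (R : realType) (n : nat) (s : 'rV[R]_n.+1).
Hypothesis s_gt0 : forall i, 0 < s 0 i.
Implicit Types p u v : 'rV[R]_n.+1.

Let s_neq0 i : s 0 i != 0. Proof. by rewrite gt_eqF. Qed.

Lemma conormalZ (k : R) v : conormal s (k *: v) = k *: conormal s v.
Proof. by apply/rowP => i; rewrite !mxE mulrA. Qed.

Lemma dot_conormalC u v : dot (conormal s u) v = dot u (conormal s v).
Proof. by apply: eq_bigr => i _; rewrite !mxE mulrAC mulrA. Qed.

Lemma conormal_eq0 v : (conormal s v == 0) = (v == 0).
Proof.
apply/eqP/eqP => [/rowP v0|->]; last by apply/rowP => i; rewrite !mxE mul0r.
apply/rowP => i; have /eqP := v0 i; rewrite !mxE mulf_eq0 invr_eq0 expf_eq0/=.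
by rewrite (negPf (s_neq0 i)) orbF => /eqP.
Qed.

Lemma ellipsoid_formE p : ellipsoid_form s p = dot (conormal s p) p.
Proof.
apply: eq_bigr => i _; rewrite mxE exprMn exprVn expr2.
by rewrite mulrAC.
Qed.

Lemma is_derive_form (V : normedModType R) (g : V -> 'rV[R]_n.+1) (x v : V)
    (d : 'rV[R]_n.+1) :
  is_derive x v g d ->
  is_derive x v (fun t => ellipsoid_form s (g t))
    (2 * dot (conormal s (g x)) d).
Proof.
move=> /is_derive_rowP dg.
rewrite mulr_sumr; apply: is_derive_fsum => i; rewrite !mxE.
have := is_deriveZ (s 0 i ^- 2) (is_deriveX 2 (dg i)).
apply: is_derive_ext => [t|]; rewrite /GRing.scale/= ?fctE.
  by rewrite exprMn exprVn mulrC.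
by rewrite expr1; ring.
Qed.

Lemma gradient_form p : gradient (ellipsoid_form s) p = 2 *: conormal s p.
Proof.
apply/rowP => i; rewrite !mxE.
have [_ ->] := is_derive_form (is_derive_id p (delta_mx 0 i)).
rewrite /dot (bigD1 i)//= big1 ?addr0 => [|j ji]; rewrite !mxE eqxx/=.
  by rewrite eqxx mulr1.
by rewrite (negPf ji) mulr0.
Qed.

Lemma inner_normalE p :
  inner_normal s p = - ((enorm (conormal s p))^-1 *: conormal s p).
Proof.
rewrite /inner_normal gradient_form enormZ// scalerA invfM mulrAC mulVf//.
by rewrite mul1r.
Qed.

Lemma is_derive_dot_conormal p v :
  is_derive p v (fun q => dot (conormal s q) (conormal s q))
    (2 * dot (conormal s p) (conormal s v)).
Proof.
rewrite mulr_sumr; apply: is_derive_fsum => i; rewrite !mxE.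
have := is_deriveZ (s 0 i ^- 4) (is_deriveX 2 (is_derive_coord p v i)).
apply: is_derive_ext => [t|]; rewrite ?fctE ?mxE ?expr1 /GRing.scale/=.
  have H (a b : R) : b ^- 4 * a ^+ 2 = a / b ^+ 2 * (a / b ^+ 2).
    by rewrite mulrACA -invfM -exprD -expr2 mulrC.
  exact: H.
have H (a b c : R) : c ^- 4 * (2 * a * b) = 2 * (a / c ^+ 2 * (b / c ^+ 2)).
  by rewrite [a / _ * _]mulrACA -invfM -exprD mulrC -!mulrA.
exact: H.
Qed.

(** The tangential part of Dv, divided by |Dp|: differentiating Dp / |Dp| along v
    removes the component of Dv along Dp. *)
Lemma shapeE p v : p != 0 ->
  Defs.shape s p v = (enorm (conormal s p))^-1 *: (conormal s v -
   (dot (conormal s p) (conormal s v) / dot (conormal s p) (conormal s p))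
     *: conormal s p).
Proof.
move=> p0; have c0 : conormal s p != 0 by rewrite conormal_eq0.
have nu0 : enorm (conormal s p) != 0 by rewrite gt_eqF// enorm_gt0.
rewrite /Defs.shape.
have -> : (fun q => - inner_normal s q) =
          (fun q => (enorm (conormal s q))^-1 *: conormal s q).
  by apply/funext => q; rewrite inner_normalE opprK.
apply: derive_val; apply/is_derive_rowP => i.
have dnu : is_derive p v (fun q => enorm (conormal s q))
    (dot (conormal s p) (conormal s v) / enorm (conormal s p)).
  have := is_derive_comp1 (is_derive_dot_conormal p v)
    (@is_derive1_sqrt R _ _).
  rewrite dot_gt0 => /(_ c0); apply: is_derive_ext => //.
  by rewrite -/(enorm _) invfM; field.
have dc : is_derive p v (fun q : 'rV[R]_n.+1 => q 0 i / s 0 i ^+ 2)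
    (v 0 i / s 0 i ^+ 2).
  have := is_deriveZ (s 0 i ^- 2) (is_derive_coord p v i).
  by apply: is_derive_ext => [q|]; rewrite /GRing.scale/= mulrC.
have := is_derive_mul (@is_derive_inv _ _ (fun q => enorm (conormal s q)) _ _ _ nu0 dnu) dc; apply: is_derive_ext => [q|].
  by rewrite !mxE.
rewrite !mxE -!sqr_enorm.
have H (a b c nu : R) : nu != 0 ->
    nu^-1 * a + - nu ^- 2 * (c / nu) * b = nu^-1 * (a - c / nu ^+ 2 * b).
  by move=> nu_neq0; field.
exact: H.
Qed.

Lemma ellipsoid_neq0 p : ellipsoid s p -> p != 0.
Proof.
rewrite /ellipsoid/= ellipsoid_formE => ep; apply/negP => /eqP p0.
by move: ep; rewrite p0 dotC dot0l => /eqP; rewrite eq_sym oner_eq0.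
Qed.

(** The form is constant along a curve of the ellipsoid, so its derivative
    vanishes.  Conversely the segment p + t v is pushed back to the ellipsoid by
    the radial projection; the form is stationary along it at t = 0, so the
    projection does not change the velocity. *)
Lemma tangent_ellipsoid p v : ellipsoid s p ->
  tangent (ellipsoid s) p v <-> dot (conormal s p) v = 0.
Proof.
move=> ep; split=> [[g [g0 gE dg]]|pv].
  have [_ d1] : is_derive (0 : R) 1 (fun t => ellipsoid_form s (g t)) 0.
    apply: (@near_eq_is_derive _ _ _ (fun=> 1 : R)).
    by near=> t; apply/esym; near: t.
  have := is_derive_form dg; rewrite g0 => -[_]; rewrite d1.
  by move=> /esym/eqP; rewrite mulf_eq0 pnatr_eq0/= => /eqP.
pose N t := Num.sqrt (ellipsoid_form s (p + t *: v)).
have dl : is_derive (0 : R) 1 (fun t : R => p + t *: v) v.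
  apply/is_derive_rowP => i.
  have := is_deriveD (is_derive_cst (p 0 i) (0 : R) 1)
    (is_deriveZ (v 0 i) (is_derive_id (0 : R) 1)).
  apply: is_derive_ext => [t|].
    by rewrite !mxE fctE /GRing.scale/= mulrC.
  by rewrite /GRing.scale/= mulr1 add0r.
have l0 : p + 0 *: v = p by rewrite scale0r addr0.
have dN : is_derive (0 : R) 1 N 0.
  have := is_derive_comp1 (is_derive_form dl) (@is_derive1_sqrt R _ _).
  rewrite l0 (ep : ellipsoid_form s p = 1) ltr01 => /(_ isT).
  by apply: is_derive_ext => //; rewrite pv !mulr0.
have N0 : N 0 = 1.
  by rewrite /N l0 (ep : ellipsoid_form s p = 1) sqrtr1.
have dNV : is_derive (0 : R) 1 (fun t => (N t)^-1) 0.
  have Nn0 : N 0 != 0 by rewrite N0 oner_eq0.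
  by have := is_derive_inv Nn0 dN; apply: is_derive_ext; rewrite ?mulr0.
exists (fun t => (N t)^-1 *: (p + t *: v)); split.
- by rewrite N0 l0 invr1 scale1r.
- have [dF _] := is_derive_form dl.
  move/derivable1_diffP/differentiable_continuous: dF => cF.
  have : \forall t \near (0 : R), 0 < ellipsoid_form s (p + t *: v).
    apply: (cvgr_gt _ cF).
    by rewrite l0 (ep : ellipsoid_form s p = 1).
  apply: filterS => t Ft; rewrite /ellipsoid/= ellipsoid_formE conormalZ.
  rewrite dotZl dotZr -ellipsoid_formE mulrA -expr2 exprVn.
  by rewrite sqr_sqrtr ?ltW// mulVf// gt_eqF.
- apply/is_derive_rowP => i.
  have /is_derive_rowP/(_ i) dli := dl.
  have := is_derive_mul dNV dli.
  apply: is_derive_ext => [t|]; first by rewrite !mxE.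
  by rewrite N0 mul0r addr0 invr1 mul1r.
Unshelve. all: by end_near. Qed.

(** Up to the factor |Dp|, m is the eigenvalue of the shape operator at v (see
    shape_eigenP); this form is linear in v and free of square roots. *)
Definition eigen p (m : R) v :=
  dot (conormal s p) v = 0 /\
  exists t : R, conormal s v = m *: v + t *: conormal s p.

Lemma shape_eigenP p v (k : R) : ellipsoid s p ->
  (tangent (ellipsoid s) p v /\ Defs.shape s p v = k *: v) <->
  eigen p (k * enorm (conormal s p)) v.
Proof.
move=> ep; have p0 := ellipsoid_neq0 ep.
have c0 : conormal s p != 0 by rewrite conormal_eq0.
have nu0 : enorm (conormal s p) != 0 by rewrite gt_eqF// enorm_gt0.
have d0 : dot (conormal s p) (conormal s p) != 0 by rewrite dot_eq0.
rewrite tangent_ellipsoid// shapeE//; split=> -[pv].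
  move=> E; split=> //.
  exists (dot (conormal s p) (conormal s v) / dot (conormal s p) (conormal s p)).
  rewrite mulrC -(scalerA _ k v) -E scalerA mulfV// scale1r subrK//.
move=> [t E]; split=> //; rewrite E dotDr !dotZr pv mulr0 add0r mulfK//.
by rewrite addrK scalerA mulrCA mulVf// mulr1.
Qed.

(** D is symmetric and v, v' are orthogonal to Dp, so Dv.v' = v.Dv' is both
    m v.v' and m' v.v'. *)
Lemma eigen_dot p m m' v v' :
  eigen p m v -> eigen p m' v' -> m != m' -> dot v v' = 0.
Proof.
move=> [pv [t E]] [pv' [t' E']] mm'.
have : (m - m') * dot v v' = 0.
  have := dot_conormalC v v'; rewrite E E' dotDl dotDr !dotZl !dotZr pv'.
  by rewrite (dotC v (conormal s p)) pv !mulr0 !addr0 => H; rewrite mulrBl H subrr.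
by move/eqP; rewrite mulf_eq0 subr_eq0 (negPf mm') => /eqP.
Qed.

Lemma eigenZ p m k v : eigen p m v -> eigen p m (k *: v).
Proof.
move=> [pv [t E]]; split; first by rewrite dotZr pv mulr0.
exists (k * t); rewrite conormalZ E scalerDr !scalerA.
by rewrite mulrC.
Qed.

End Ellipsoid.

(** * Principal frames *)

Lemma row_free_ker (F : fieldType) (m n : nat) (A : 'M[F]_(m, n)) :
  (forall u : 'rV_m, u *m A = 0 -> u = 0) -> row_free A.
Proof.
move=> A0; rewrite -kermx_eq0; apply/rowV0P => u /sub_kermxP; exact: A0.
Qed.

Lemma orthogonal_row_free (R : realType) (m n : nat) (A : 'M[R]_(m, n)) :
  (forall i, row i A != 0) ->
  (forall i j, i != j -> dot (row i A) (row j A) = 0) -> row_free A.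
Proof.
move=> A0 Aorth; apply: row_free_ker => u uA.
apply/rowP => i; rewrite mxE; apply/eqP.
have : (u *m A *m A^T) 0 i = 0 by rewrite uA mul0mx mxE.
rewrite -mulmxA mxE (bigD1 i)//= big1 ?addr0 => [/eqP|j ji].
  have -> : (A *m A^T) i i = dot (row i A) (row i A).
    by rewrite dotE tr_row -row_mul !mxE; apply: eq_bigr => j _; rewrite !mxE.
  by rewrite mulf_eq0 dot_eq0 (negPf (A0 i)) orbF.
have -> : (A *m A^T) j i = dot (row j A) (row i A).
  by rewrite dotE tr_row -row_mul !mxE; apply: eq_bigr => l _; rewrite !mxE.
by rewrite Aorth// mulr0.
Qed.

(** Some term of the Leibniz expansion is nonzero. *)
Lemma det_neq0_perm (F : fieldType) (n : nat) (A : 'M[F]_n) :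
  \det A != 0 -> exists sg : 'S_n, forall i, A i (sg i) != 0.
Proof.
move=> dA; apply: contrapT => noS; move/eqP: dA; apply.
apply: big1 => sg _; have [i /negP] : exists i, ~ A i (sg i) != 0.
  by apply/existsNP => H; apply: noS; exists sg.
rewrite negbK => /eqP Ai0; rewrite (bigD1 i)//= Ai0.
by rewrite mul0r mulr0.
Qed.

Lemma nondecreasing_perm (R : realType) (n : nat) (f g : 'I_n -> R)
    (sg : 'S_n) :
  (forall i j : 'I_n, (i <= j)%N -> f i <= f j) ->
  (forall i j : 'I_n, (i <= j)%N -> g i <= g j) ->
  (forall i, f i = g (sg i)) -> forall i, f i = g i.
Proof.
have sorted_codom (h : 'I_n -> R) : (forall i j : 'I_n, (i <= j)%N -> h i <= h j) ->
    sorted <=%R [seq h i | i <- enum 'I_n].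
  move=> hnd; rewrite sorted_map.
  have : sorted leq [seq val i | i <- enum 'I_n].
    by rewrite val_enum_ord iota_sorted.
  by rewrite sorted_map; apply: sub_sorted => i j /= /hnd.
move=> fnd gnd fg.
have E : [seq f i | i <- enum 'I_n] = [seq g i | i <- enum 'I_n].
  apply: (sorted_eq le_trans le_anti); [exact: sorted_codom|exact: sorted_codom|].
  have -> : [seq f i | i <- enum 'I_n] =
            [seq g i | i <- [seq sg i | i <- enum 'I_n]].
    rewrite -[RHS]map_comp. by apply: eq_map => i; rewrite fg.
  apply: perm_map; apply: uniq_perm.
  - by rewrite map_inj_uniq ?enum_uniq//; exact: perm_inj.
  - exact: enum_uniq.
  - move=> i; rewrite mem_enum; apply/mapP.
    by exists (sg^-1%g i); rewrite ?mem_enum// permKV.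
move=> i; have si : (i < size (enum 'I_n))%N by rewrite size_enum_ord.
have H : f (nth i (enum 'I_n) i) = g (nth i (enum 'I_n) i).
  by rewrite -(nth_map i 0 f si) -(nth_map i 0 g si) E.
by move: H; rewrite nth_ord_enum.
Qed.

Section Frame.
Variables (R : realType) (n : nat) (s : 'rV[R]_n.+1).
Hypothesis s_gt0 : forall i, 0 < s 0 i.

(** An orthogonal eigenbasis of the tangent space with sorted eigenvalues.
    Vectors of distinct eigenvalues are orthogonal in any eigenbasis; choosing
    orthogonal vectors for equal eigenvalues too makes linear independence and
    the expansion of a vector immediate. *)
Record principal_frame (p : 'rV[R]_n.+1) (m : 'I_n -> R) (e : 'M[R]_(n, n.+1)) :
    Prop := PrincipalFrame {
  frame_sorted : forall i j : 'I_n, (i <= j)%N -> m i <= m j;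
  frame_eigen : forall i, eigen s p (m i) (row i e);
  frame_neq0 : forall i, row i e != 0;
  frame_orth : forall i j, i != j -> dot (row i e) (row j e) = 0 }.

Variables (p : 'rV[R]_n.+1) (m : 'I_n -> R) (e : 'M[R]_(n, n.+1)).
Hypotheses (ep : ellipsoid s p) (Fe : principal_frame p m e).

Let c0 : conormal s p != 0.
Proof. by rewrite conormal_eq0//; exact: ellipsoid_neq0 ep. Qed.

Let nu0 : 0 < enorm (conormal s p). Proof. exact: enorm_gt0. Qed.

(** Together with Dp, the vectors of the frame are n + 1 orthogonal nonzero
    vectors of a space of dimension n + 1. *)
Lemma frame_eq0 (x : 'rV[R]_n.+1) :
  dot (conormal s p) x = 0 -> (forall i, dot x (row i e) = 0) -> x = 0.
Proof.
move=> px ex; pose B : 'M[R]_n.+1 := col_mx (conormal s p) e.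
have rB i : row i B = match fintype.split (i : 'I_(1 + n)) with
    | inl _ => conormal s p | inr j => row j e end.
  apply/rowP => j; rewrite mxE /B mxE; case: fintype.split => k; last by rewrite mxE.
  by rewrite ord1.
have Bu : B \in unitmx.
  rewrite -row_free_unit; apply: orthogonal_row_free => [i|i j ij].
    by rewrite rB; case: fintype.split => k; [exact: c0|exact: (frame_neq0 Fe)].
  rewrite !rB; case: fintype.splitP => k ik; case: fintype.splitP => l jl.
  - by move: ij; rewrite -val_eqE /= ik jl !ord1 eqxx.
  - by have [] := frame_eigen Fe l.
  - by rewrite dotC; have [] := frame_eigen Fe k.
  - apply: (frame_orth Fe); apply/eqP => kl; move/eqP: ij; apply.
    by apply: val_inj; rewrite /= ik jl kl.
have : x *m B^T = 0.
  apply/rowP => i; rewrite mxE [RHS]mxE.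
  have -> : \sum_j x 0 j * B^T j i = dot x (row i B).
    by apply: eq_bigr => j _; rewrite !mxE.
  by rewrite rB; case: fintype.split => // _; rewrite dotC.
have BTu : B^T \in unitmx by rewrite unitmx_tr.
by move=> /(congr1 (mulmx^~ (invmx B^T))); rewrite mulmxK// mul0mx.
Qed.

Lemma frame_row (x : 'rV[R]_n.+1) i :
  dot (conormal s p) x = 0 -> (forall j, j != i -> dot x (row j e) = 0) ->
  exists k, x = k *: row i e.
Proof.
move=> px ex; exists (dot x (row i e) / dot (row i e) (row i e)).
apply/eqP; rewrite -subr_eq0; apply/eqP; apply: frame_eq0.
  have [pe _] := frame_eigen Fe i.
  by rewrite -scaleNr dotDr dotZr pe px mulr0 addr0.
move=> j; rewrite -scaleNr dotDl dotZl.
have [->|ji] := eqVneq j i.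
  by rewrite mulNr divfK ?subrr// dot_eq0 (frame_neq0 Fe).
by rewrite ex// (frame_orth Fe (i := i) (j := j)) 1?eq_sym// mulr0 addr0.
Qed.

(** The curvatures do not depend on the eigenbasis.  The matrix of products
    between two eigenbases is invertible, hence has a permutation of nonzero
    entries; a nonzero product forces equal eigenvalues, so the two sorted
    families are permutations of each other. *)
Lemma frame_curvatures (k : 'I_n -> R) :
  principal_curvatures s p k <->
  k = (fun i => m i / enorm (conormal s p)).
Proof.
split=> [[knd [e' [e'free e'eig]]]|->]; last first.
  split=> [i j ij|].
    by rewrite ler_pM2r ?invr_gt0// (frame_sorted Fe).
  exists e; split.
    by apply: orthogonal_row_free; [exact: (frame_neq0 Fe)|exact: (frame_orth Fe)].
  move=> i; apply/shape_eigenP => //.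
  by rewrite divfK ?gt_eqF//; exact: (frame_eigen Fe).
have e'E i : eigen s p (k i * enorm (conormal s p)) (row i e').
  by apply/(shape_eigenP s_gt0 _ _ ep).
pose M := e' *m e^T.
have ME i j : M i j = dot (row i e') (row j e).
  by rewrite mxE; apply: eq_bigr => l _; rewrite !mxE.
(* M is invertible: a combination of the rows of e' which is orthogonal to the
   frame e and to Dp vanishes. *)
have : \det M != 0.
  rewrite -unitfE -unitmxE -row_free_unit; apply: row_free_ker => u uM.
  apply: (row_free_inj e'free); rewrite mul0mx; apply: frame_eq0.
    rewrite dotC dotE -mulmxA.
    have -> : e' *m (conormal s p)^T = 0.
      apply/colP => i; rewrite [RHS]mxE; have [pe _] := e'E i.
      rewrite -[RHS]pe dotC mxE; apply: eq_bigr => l _.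
      by rewrite !mxE.
    by rewrite mulmx0 mxE.
  move=> i; have /rowP/(_ i) := uM; rewrite mulmxA !mxE => <-.
  by apply: eq_bigr => l _; rewrite !mxE.
move=> /det_neq0_perm [sg Msg].
apply/funext; apply: (@nondecreasing_perm _ _ _ _ sg) => // [i j ij|i].
  by rewrite ler_pM2r ?invr_gt0// (frame_sorted Fe).
apply/eqP; rewrite eq_sym; apply/eqP.
have [<-|km] := eqVneq (k i * enorm (conormal s p)) (m (sg i)).
  by rewrite mulfK ?gt_eqF.
have := Msg i; rewrite ME (eigen_dot (e'E i) (frame_eigen Fe (sg i)) km).
by rewrite eqxx.
Qed.

(** An eigenvector of a simple eigenvalue is orthogonal to the other vectors of
    the frame, hence proportional to the remaining one. *)
Lemma frame_principal_line (i : 'I_n) (v : 'rV[R]_n.+1) :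
  principal_line s i p v <->
  [/\ forall j, j != i -> m j != m i, v != 0 & exists c, v = c *: row i e].
Proof.
have nuV : (enorm (conormal s p))^-1 != 0 by rewrite invr_eq0 gt_eqF.
split.
  move=> [_ [k [/frame_curvatures ->]]] mi tv /eqP v0 sv.
  have mi' j : j != i -> m j != m i.
    by move=> /mi /eqP; apply: contra_neq => ->.
  split => //.
  have : eigen s p (m i / enorm (conormal s p) * enorm (conormal s p)) v.
    by apply/(shape_eigenP s_gt0 _ _ ep).
  rewrite divfK ?gt_eqF// => ev; apply: frame_row; first by case: ev.
  move=> j ji; rewrite dotC; apply: (eigen_dot (frame_eigen Fe j) ev).
  exact: mi'.
move=> [mi v0 [c vE]]; split => //.
exists (fun i => m i / enorm (conormal s p)).
have : eigen s p (m i / enorm (conormal s p) * enorm (conormal s p)) v.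
  by rewrite divfK ?gt_eqF// vE; apply: eigenZ; exact: (frame_eigen Fe).
move=> /(shape_eigenP s_gt0 _ _ ep) [tv sv].
split => //; first exact/frame_curvatures; last exact/eqP.
by move=> j /mi /eqP mj /(mulIf nuV).
Qed.

End Frame.

(** * Coordinates in dimensions 3 and 4 *)

Lemma ord2P (P : 'I_2 -> Prop) : P 0 -> P 1 -> forall i, P i.
Proof.
move=> P0 P1 [[|[|//]] lti].
  by have -> : Ordinal lti = 0 by apply: val_inj.
by have -> : Ordinal lti = 1 by apply: val_inj.
Qed.

Lemma ord3P (P : 'I_3 -> Prop) : P 0 -> P 1 -> P 2 -> forall i, P i.
Proof.
move=> P0 P1 P2 [[|[|[|//]]] lti].
- by have -> : Ordinal lti = 0 by apply: val_inj.
- by have -> : Ordinal lti = 1 by apply: val_inj.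
- by have -> : Ordinal lti = 2 by apply: val_inj.
Qed.

Lemma ord4P (P : 'I_4 -> Prop) : P 0 -> P 1 -> P 2 -> P 3 -> forall i, P i.
Proof.
move=> P0 P1 P2 P3 [[|[|[|[|//]]]] lti].
- by have -> : Ordinal lti = 0 by apply: val_inj.
- by have -> : Ordinal lti = 1 by apply: val_inj.
- by have -> : Ordinal lti = 2 by apply: val_inj.
- by have -> : Ordinal lti = 3 by apply: val_inj.
Qed.

Lemma ord3_cases (i : 'I_3) : [\/ i = 0, i = 1 | i = 2].
Proof. by move: i; apply: ord3P; [constructor 1|constructor 2|constructor 3]. Qed.

Lemma ord4_cases (i : 'I_4) : [\/ i = 0, i = 1, i = 2 | i = 3].
Proof.
by move: i; apply: ord4P;
  [constructor 1|constructor 2|constructor 3|constructor 4].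
Qed.

Lemma sum_ord3 (V : nmodType) (F : 'I_3 -> V) :
  \sum_i F i = F 0 + F 1 + F 2.
Proof.
rewrite !big_ord_recr big_ord0 /= add0r; congr (_ + _ + _); congr F;
  exact: val_inj.
Qed.

Lemma sum_ord4 (V : nmodType) (F : 'I_4 -> V) :
  \sum_i F i = F 0 + F 1 + F 2 + F 3.
Proof.
rewrite !big_ord_recr big_ord0 /= add0r; congr (_ + _ + _ + _); congr F;
  exact: val_inj.
Qed.

Section Coordinates.
Variable R : realType.
Implicit Types x y z w r k : R.

Definition vec3 x y r : 'rV[R]_3 := \row_i nth 0 [:: x; y; r] i.

Lemma vec3E x y r :
  (vec3 x y r 0 0 = x) * (vec3 x y r 0 1 = y) * (vec3 x y r 0 2 = r).
Proof. by rewrite !mxE. Qed.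

Lemma vec4E x y z w :
  (vec4 x y z w 0 0 = x) * (vec4 x y z w 0 1 = y) *
  (vec4 x y z w 0 2 = z) * (vec4 x y z w 0 3 = w).
Proof. by rewrite !mxE. Qed.

Lemma vec3_eta (v : 'rV[R]_3) : v = vec3 (v 0 0) (v 0 1) (v 0 2).
Proof. by apply/rowP; apply: ord3P; rewrite !vec3E. Qed.

Lemma vec4_eta (v : 'rV[R]_4) : v = vec4 (v 0 0) (v 0 1) (v 0 2) (v 0 3).
Proof. by apply/rowP; apply: ord4P; rewrite !vec4E. Qed.

Lemma vec3_inj x y r x' y' r' :
  vec3 x y r = vec3 x' y' r' <-> [/\ x = x', y = y' & r = r'].
Proof.
split=> [E|[-> -> ->]//].
have := (congr1 (fun v : 'rV_3 => v 0 0) E, congr1 (fun v : 'rV_3 => v 0 1) E,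
  congr1 (fun v : 'rV_3 => v 0 2) E).
by rewrite /= !vec3E => -[[-> ->] ->].
Qed.

Lemma vec4_inj x y z w x' y' z' w' :
  vec4 x y z w = vec4 x' y' z' w' <-> [/\ x = x', y = y', z = z' & w = w'].
Proof.
split=> [E|[-> -> -> ->]//].
have := (congr1 (fun v : 'rV_4 => v 0 0) E, congr1 (fun v : 'rV_4 => v 0 1) E,
  congr1 (fun v : 'rV_4 => v 0 2) E, congr1 (fun v : 'rV_4 => v 0 3) E).
by rewrite /= !vec4E => -[[[-> ->] ->] ->].
Qed.

Lemma dot_vec3 (u v : 'rV[R]_3) :
  dot u v = u 0 0 * v 0 0 + u 0 1 * v 0 1 + u 0 2 * v 0 2.
Proof. exact: sum_ord3. Qed.

Lemma dot_vec4 (u v : 'rV[R]_4) :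
  dot u v = u 0 0 * v 0 0 + u 0 1 * v 0 1 + u 0 2 * v 0 2 + u 0 3 * v 0 3.
Proof. exact: sum_ord4. Qed.

Lemma addr_vec3 x y r x' y' r' :
  vec3 x y r + vec3 x' y' r' = vec3 (x + x') (y + y') (r + r').
Proof. by apply/rowP; apply: ord3P; rewrite mxE !vec3E. Qed.

Lemma scale_vec3 k x y r : k *: vec3 x y r = vec3 (k * x) (k * y) (k * r).
Proof. by apply/rowP; apply: ord3P; rewrite mxE !vec3E. Qed.

Lemma conormal_vec3 x y r x' y' r' :
  conormal (vec3 x y r) (vec3 x' y' r') =
  vec3 (x' / x ^+ 2) (y' / y ^+ 2) (r' / r ^+ 2).
Proof. by apply/rowP; apply: ord3P; rewrite mxE !vec3E. Qed.

Lemma addr_vec4 x y z w x' y' z' w' :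
  vec4 x y z w + vec4 x' y' z' w' = vec4 (x + x') (y + y') (z + z') (w + w').
Proof. by apply/rowP; apply: ord4P; rewrite mxE !vec4E. Qed.

Lemma scale_vec4 k x y z w :
  k *: vec4 x y z w = vec4 (k * x) (k * y) (k * z) (k * w).
Proof. by apply/rowP; apply: ord4P; rewrite mxE !vec4E. Qed.

Lemma conormal_vec4 x y z w x' y' z' w' :
  conormal (vec4 x y z w) (vec4 x' y' z' w') =
  vec4 (x' / x ^+ 2) (y' / y ^+ 2) (z' / z ^+ 2) (w' / w ^+ 2).
Proof. by apply/rowP; apply: ord4P; rewrite mxE !vec4E. Qed.

Lemma vec3_0 : 0 = vec3 0 0 0 :> 'rV[R]_3.
Proof. by apply/rowP; apply: ord3P; rewrite mxE !vec3E. Qed.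

Lemma vec4_0 : 0 = vec4 0 0 0 0 :> 'rV[R]_4.
Proof. by apply/rowP; apply: ord4P; rewrite mxE !vec4E. Qed.

(** For a unit vector h of the (z,w)-plane, the isometry of R^3 onto the
    hyperplane spanned by h and the first two axes. *)
Definition embed (h : R * R) (v : 'rV[R]_3) : 'rV[R]_4 :=
  vec4 (v 0 0) (v 0 1) (v 0 2 * h.1) (v 0 2 * h.2).

(** The adjoint of embed h, which inverts it on its image when h is a unit
    vector. *)
Definition fold (h : R * R) (v : 'rV[R]_4) : 'rV[R]_3 :=
  vec3 (v 0 0) (v 0 1) (v 0 2 * h.1 + v 0 3 * h.2).

Definition unit_pair (h : R * R) := h.1 ^+ 2 + h.2 ^+ 2 = 1.

Lemma embedK h : unit_pair h -> cancel (embed h) (fold h).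
Proof.
move=> hu v; rewrite [RHS]vec3_eta /fold /embed !vec4E -!mulrA -mulrDr -!expr2.
by rewrite hu mulr1.
Qed.

Lemma embedD h u v : embed h (u + v) = embed h u + embed h v.
Proof.
by rewrite /embed addr_vec4 !mxE !mulrDl.
Qed.

Lemma embedZ h k v : embed h (k *: v) = k *: embed h v.
Proof. by rewrite /embed scale_vec4 !mxE !mulrA. Qed.

Lemma embedB h u v : embed h (u - v) = embed h u - embed h v.
Proof. by rewrite -(scaleN1r v) embedD embedZ scaleN1r. Qed.

Lemma embed_eq0 h v : unit_pair h -> (embed h v == 0) = (v == 0).
Proof.
move=> hu; have E0 : embed h 0 = 0 by rewrite -(scale0r 0) embedZ scale0r.
by rewrite -{1}E0 (inj_eq (can_inj (embedK hu))).
Qed.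

Lemma dot_embed h u v : unit_pair h -> dot (embed h u) (embed h v) = dot u v.
Proof.
move=> hu; rewrite dot_vec4 dot_vec3 !vec4E -addrA; congr (_ + _).
by rewrite mulrACA [X in _ + X]mulrACA -mulrDr -!expr2 hu mulr1.
Qed.

(** The two last axes of the ellipsoid of R^4 are equal, so D acts on the
    (z,w)-plane as a scalar and commutes with embed h. *)
Lemma conormal_embed h a b c v :
  conormal (vec4 a b c c) (embed h v) = embed h (conormal (vec3 a b c) v).
Proof.
rewrite [in RHS](vec3_eta v) conormal_vec3 /embed conormal_vec4 !vec3E.
by rewrite !(mulrAC _ (c ^- 2)).
Qed.

Lemma ellipsoid_embed h a b c v : unit_pair h ->
  ellipsoid (vec4 a b c c) (embed h v) <-> ellipsoid (vec3 a b c) v.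
Proof.
by move=> hu; rewrite /ellipsoid/= !ellipsoid_formE conormal_embed dot_embed.
Qed.

Lemma eigen_embed h a b c p m v : unit_pair h ->
  eigen (vec3 a b c) p m v -> eigen (vec4 a b c c) (embed h p) m (embed h v).
Proof.
move=> hu [pv [t E]]; split; first by rewrite conormal_embed dot_embed.
by exists t; rewrite !conormal_embed E embedD !embedZ.
Qed.

(** The direction of the orbits of the rotations of the (z,w)-plane at the
    points of the image of embed h. *)
Definition rotation_field (h : R * R) : 'rV[R]_4 := vec4 0 0 (- h.2) h.1.

Lemma dot_embed_rotation_field h v : dot (embed h v) (rotation_field h) = 0.
Proof. by rewrite dot_vec4 !vec4E; ring. Qed.

Lemma rotation_field_neq0 h : unit_pair h -> rotation_field h != 0.
Proof.
move=> hu; apply/eqP; rewrite vec4_0 => /vec4_inj [_ _ h2 h1].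
have := hu; rewrite /unit_pair h1 -[h.2]opprK h2 oppr0 expr0n/= addr0.
by move/eqP; rewrite eq_sym oner_eq0.
Qed.

Lemma eigen_rotation_field h a b c p :
  eigen (vec4 a b c c) (embed h p) (c ^- 2) (rotation_field h).
Proof.
split; first by rewrite conormal_embed dot_embed_rotation_field.
exists 0; rewrite scale0r addr0 /rotation_field conormal_vec4 scale_vec4.
by rewrite !mul0r !mulr0 !(mulrC (c ^- 2)).
Qed.

End Coordinates.

(** * Principal directions of the surface with axes a, b, c *)

Lemma quadratic_roots (R : realType) (k l j C : R) :
  0 < k -> k * C ^+ 2 + l * C + j < 0 ->
  exists m m', [/\ m < C, C < m', k * m ^+ 2 + l * m + j = 0 &
    k * m' ^+ 2 + l * m' + j = 0].
Proof.
move=> k0 qC; have k2 : 0 < 2 * k by rewrite mulr_gt0.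
set h := 2 * k * C + l; set d := l ^+ 2 - 4 * k * j.
have hd : h ^+ 2 < d by rewrite /h /d; nra.
have d0 : 0 < d by apply: le_lt_trans hd; rewrite sqr_ge0.
have sd : Num.sqrt d ^+ 2 = d by rewrite sqr_sqrtr// ltW.
have hs : `|h| < Num.sqrt d.
  by rewrite -(@ltr_pXn2r _ 2)// ?nnegrE ?sqrtr_ge0// sd real_normK// num_real.
move: hs; rewrite ltr_norml => /andP[h1 h2].
have root S : S ^+ 2 = d -> k * ((S - l) / (2 * k)) ^+ 2 + l * ((S - l) / (2 * k)) + j = 0.
  move=> Sd; have -> : j = (l ^+ 2 - S ^+ 2) / (4 * k).
    by rewrite Sd /d; field; rewrite gt_eqF.
  by field; rewrite gt_eqF.
exists ((- Num.sqrt d - l) / (2 * k)), ((Num.sqrt d - l) / (2 * k)); split.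
- by rewrite ltr_pdivrMr//; rewrite /h in h1 h2; lra.
- by rewrite ltr_pdivlMr//; rewrite /h in h1 h2; lra.
- by apply: root; rewrite sqrrN.
- exact: root.
Qed.

Section Axes.
Variables (R : realType) (a b c : R).
Hypotheses (b0 : 0 < b) (bc : b < c) (ca : c < a).

Let c0 : 0 < c. Proof. exact: lt_trans bc. Qed.
Let a0 : 0 < a. Proof. exact: lt_trans ca. Qed.

Local Notation s3 := (vec3 a b c).
Local Notation s4 := (vec4 a b c c).
Local Notation A := (a ^- 2).
Local Notation B := (b ^- 2).
Local Notation C := (c ^- 2).

Lemma axes3_gt0 i : 0 < s3 0 i.
Proof. by move: i; apply: ord3P; rewrite vec3E. Qed.

Lemma axes4_gt0 i : 0 < s4 0 i.
Proof. by move: i; apply: ord4P; rewrite vec4E. Qed.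

Lemma ltAC : A < C.
Proof. by rewrite ltf_pV2 ?posrE ?exprn_gt0// ltr_pXn2r// nnegrE ltW. Qed.

Lemma ltCB : C < B.
Proof. by rewrite ltf_pV2 ?posrE ?exprn_gt0// ltr_pXn2r// nnegrE ltW. Qed.

Lemma eigen3I x y r m u v w t :
  x * A * u + y * B * v + r * C * w = 0 ->
  u * A = m * u + t * (x * A) -> v * B = m * v + t * (y * B) ->
  w * C = m * w + t * (r * C) -> eigen s3 (vec3 x y r) m (vec3 u v w).
Proof.
move=> D E1 E2 E3; split; first by rewrite conormal_vec3 dot_vec3 !vec3E.
by exists t; rewrite !conormal_vec3 !scale_vec3 addr_vec3 E1 E2 E3.
Qed.

(** The polynomial is the determinant of the system Dv = m v + t n, n.v = 0, up
    to sign.  If m is none of the entries of D the vector n_i / (D_i - m) is a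
    solution with t = 1; if m is an entry of D, the equation forces the matching
    coordinate of n to vanish and the axis is an eigenvector. *)
Lemma root_eigenvector (q : 'rV[R]_3) m : let n := conormal s3 q in q != 0 ->
  n 0 0 ^+ 2 * (B - m) * (C - m) + n 0 1 ^+ 2 * (A - m) * (C - m)
    + n 0 2 ^+ 2 * (A - m) * (B - m) = 0 ->
  exists2 v, v != 0 & eigen s3 q m v.
Proof.
move=> n q0 chi; have AC := ltAC; have CB := ltCB.
have AB : A < B by exact: lt_trans CB.
have := q0; rewrite -(conormal_eq0 axes3_gt0) -/n.
move: chi; rewrite /n {n q0} (vec3_eta q).
move: (q 0 0) (q 0 1) (q 0 2) => x y r; rewrite conormal_vec3 !vec3E => chi n0.
have nA : (A == 0) = false by rewrite invr_eq0 expf_eq0/= gt_eqF.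
have nB : (B == 0) = false by rewrite invr_eq0 expf_eq0/= gt_eqF.
have nC : (C == 0) = false by rewrite invr_eq0 expf_eq0/= gt_eqF.
have [mA|mA] := eqVneq m A.
  move: chi; rewrite mA subrr !(mulr0, mul0r, addr0) => /eqP.
  rewrite !mulf_eq0 !subr_eq0 !(gt_eqF AB, gt_eqF AC, nA) !orbF ?orbb => /eqP xA.
  exists (vec3 1 0 0).
    by apply/eqP; rewrite vec3_0 => /vec3_inj[/eqP]; rewrite oner_eq0.
  by apply: (@eigen3I _ _ _ _ _ _ _ 0); rewrite ?xA; ring.
have [mB|mB] := eqVneq m B.
  move: chi; rewrite mB subrr !(mulr0, mul0r, addr0, add0r) => /eqP.
  rewrite !mulf_eq0 !subr_eq0 !(lt_eqF AB, lt_eqF CB, nB) !orbF ?orbb => /eqP yB.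
  exists (vec3 0 1 0).
    by apply/eqP; rewrite vec3_0 => /vec3_inj[_ /eqP]; rewrite oner_eq0.
  by apply: (@eigen3I _ _ _ _ _ _ _ 0); rewrite ?yB; ring.
have [mC|mC] := eqVneq m C.
  move: chi; rewrite mC subrr !(mulr0, mul0r, addr0, add0r) => /eqP.
  rewrite !mulf_eq0 !subr_eq0 !(gt_eqF CB, lt_eqF AC, nC) !orbF ?orbb => /eqP rC.
  exists (vec3 0 0 1).
    by apply/eqP; rewrite vec3_0 => /vec3_inj[_ _ /eqP]; rewrite oner_eq0.
  by apply: (@eigen3I _ _ _ _ _ _ _ 0); rewrite ?rC; ring.
move: mA mB mC; rewrite !(eq_sym m) -!(subr_eq0 _ m) => mA mB mC.
exists (vec3 (x * A / (A - m)) (y * B / (B - m)) (r * C / (C - m))).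
  apply: contra_neq n0; rewrite vec3_0 => /vec3_inj [/eqP + /eqP + /eqP].
  rewrite ![_ / (_ - m) == 0]mulf_eq0 !invr_eq0 (negPf mA) (negPf mB) (negPf mC) !orbF.
  by move=> /eqP -> /eqP -> /eqP ->.
apply: (@eigen3I _ _ _ _ _ _ _ 1).
- have -> : x * A * (x * A / (A - m)) + y * B * (y * B / (B - m)) +
    r * C * (r * C / (C - m)) = 0 / ((A - m) * (B - m) * (C - m)).
    rewrite -chi; move: mA mB mC.
    move: (x * A) (y * B) (r * C) A B C => X Y Z A' B' C' hA hB hC.
    by field; rewrite hA hB hC.
  by rewrite mul0r.
- by move: mA; move: (x * A) A => X A' hA; field.
- by move: mB; move: (y * B) B => X A' hA; field.
- by move: mC; move: (r * C) C => X A' hA; field.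
Qed.

(** On r = 0 this has the sign of m_t - 1/c^2, where m_t belongs to the tangent
    of the ellipse; it vanishes at the umbilic points. *)
Definition umbilic_sign (q : 'rV[R]_3) : R :=
  (B - C) * (q 0 0 * A) ^+ 2 - (C - A) * (q 0 1 * B) ^+ 2.

Definition ellipse_tangent (q : 'rV[R]_3) : 'rV[R]_3 := vec3 (- (q 0 1 * B)) (q 0 0 * A) 0.

Definition eigenpair (q : 'rV[R]_3) (m m' : R) (v v' : 'rV[R]_3) : Prop :=
  [/\ eigen s3 q m v, eigen s3 q m' v', v != 0, v' != 0 & dot v v' = 0].

(** The characteristic polynomial has leading coefficient |Dq|^2 > 0, and at 1/c^2
    it has the sign of (1/a^2 - 1/c^2) (1/b^2 - 1/c^2) < 0 when r is nonzero, so
    1/c^2 separates its roots.  On r = 0 the eigenvectors are the tangent of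
    the ellipse and the last axis. *)
Lemma eigenpair_exists q : ellipsoid s3 q ->
  exists m m' v v', [/\ eigenpair q m m' v v', m <= C <= m',
    q 0 2 != 0 -> m < C < m' &
    q 0 2 = 0 ->
    [/\ umbilic_sign q < 0 ->
       [/\ m < C, m' = C, v = ellipse_tangent q & v' = vec3 0 0 1],
      0 < umbilic_sign q -> [/\ m = C, C < m', v = vec3 0 0 1 & v' = ellipse_tangent q] &
      umbilic_sign q = 0 -> m = C /\ m' = C]].
Proof.
move=> qE; have q0 := ellipsoid_neq0 qE.
have AC := ltAC; have CB := ltCB; have AB : A < B by exact: lt_trans CB.
pose n := conormal s3 q.
have nE : n = vec3 (q 0 0 * A) (q 0 1 * B) (q 0 2 * C).
  by rewrite /n [in LHS](vec3_eta q) conormal_vec3.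
have n0 : n != 0 by rewrite conormal_eq0//; exact: axes3_gt0.
have : 0 < dot n n by rewrite dot_gt0.
rewrite dot_vec3 nE !vec3E; set n0_ := q 0 0 * A; set n1_ := q 0 1 * B => nn.
have [r0|r0] := eqVneq (q 0 2) 0; last first.
  have n2 : q 0 2 * C != 0 by rewrite mulf_neq0// invr_eq0 expf_neq0// gt_eqF.
  have n2' : 0 < (q 0 2 * C) ^+ 2 by rewrite lt0r sqr_ge0 expf_neq0.
  move: nn n2 n2'; set n2_ := q 0 2 * C => nn n2 n2'.
  pose chi m := n0_ ^+ 2 * (B - m) * (C - m) + n1_ ^+ 2 * (A - m) * (C - m)
    + n2_ ^+ 2 * (A - m) * (B - m).
  pose l := - (n0_ ^+ 2 * (B + C) + n1_ ^+ 2 * (A + C) + n2_ ^+ 2 * (A + B)).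
  pose j := n0_ ^+ 2 * B * C + n1_ ^+ 2 * A * C + n2_ ^+ 2 * A * B.
  have chiE m : (n0_ * n0_ + n1_ * n1_ + n2_ * n2_) * m ^+ 2 + l * m + j = chi m.
    by rewrite /l /j /chi; move: A B C => A' B' C'; ring.
  have [m [m' [mC Cm' m0 m'0]]] :
    exists m m', [/\ m < C, C < m',
      (n0_ * n0_ + n1_ * n1_ + n2_ * n2_) * m ^+ 2 + l * m + j = 0 &
      (n0_ * n0_ + n1_ * n1_ + n2_ * n2_) * m' ^+ 2 + l * m' + j = 0].
    apply: quadratic_roots => //; rewrite chiE /chi subrr !mulr0 !add0r.
    by rewrite pmulr_llt0 ?subr_gt0// pmulr_rlt0// subr_lt0.
  have [v v0 ev] : exists2 v, v != 0 & eigen s3 q m v.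
    by apply: root_eigenvector => //; rewrite -/n nE !vec3E -[LHS]/(chi m) -chiE.
  have [v' v'0 ev'] : exists2 v, v != 0 & eigen s3 q m' v.
    by apply: root_eigenvector => //; rewrite -/n nE !vec3E -[LHS]/(chi m') -chiE.
  exists m, m', v, v'; split => //.
  - split => //; apply: (eigen_dot ev ev'); rewrite lt_eqF//; exact: lt_trans Cm'.
  - by rewrite !ltW.
  - by rewrite mC.
  - by move=> r0'; rewrite r0' eqxx in r0.
have nn' : 0 < n0_ ^+ 2 + n1_ ^+ 2.
  by move: nn; rewrite r0 mul0r mulr0 addr0 -!expr2.
pose mt := (A * n1_ ^+ 2 + B * n0_ ^+ 2) / (n0_ ^+ 2 + n1_ ^+ 2).
have mtC : mt - C = umbilic_sign q / (n0_ ^+ 2 + n1_ ^+ 2).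
  have H (A' B' C' x y : R) : 0 < x ^+ 2 + y ^+ 2 ->
      (A' * y ^+ 2 + B' * x ^+ 2) / (x ^+ 2 + y ^+ 2) - C' =
      ((B' - C') * x ^+ 2 - (C' - A') * y ^+ 2) / (x ^+ 2 + y ^+ 2).
    by move=> xy; field; rewrite gt_eqF.
  exact: H.
have et : eigen s3 q mt (ellipse_tangent q).
  rewrite /ellipse_tangent [X in eigen _ X](vec3_eta q).
  pose t := (B - A) * n0_ * n1_ / (n0_ ^+ 2 + n1_ ^+ 2).
  have H (A' B' x y : R) : 0 < x ^+ 2 + y ^+ 2 ->
      (x * B' = (A' * y ^+ 2 + B' * x ^+ 2) / (x ^+ 2 + y ^+ 2) * x
        + (B' - A') * x * y / (x ^+ 2 + y ^+ 2) * y) /\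
      (- y * A' = (A' * y ^+ 2 + B' * x ^+ 2) / (x ^+ 2 + y ^+ 2) * - y
        + (B' - A') * x * y / (x ^+ 2 + y ^+ 2) * x).
    by move=> xy; split; field; rewrite gt_eqF.
  have [H1 H2] := H A B _ _ nn'.
  apply: (@eigen3I _ _ _ _ _ _ _ t) => //.
  - by rewrite mulr0 addr0 mulrN mulrC addNr.
  - by rewrite r0 !(mulr0, mul0r, addr0).
have er : eigen s3 q C (vec3 0 0 1).
  rewrite [X in eigen _ X](vec3_eta q) r0.
  by apply: (@eigen3I _ _ _ _ _ _ _ 0); ring.
have r1 : vec3 0 0 1 != 0 :> 'rV[R]_3.
  by apply/eqP; rewrite vec3_0 => /vec3_inj[_ _ /eqP]; rewrite oner_eq0.
have tq0 : ellipse_tangent q != 0.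
  apply/eqP; rewrite vec3_0 => /vec3_inj[/eqP]; rewrite oppr_eq0 -/n0_ -/n1_.
  move=> /eqP n1E n0E _; move: nn'.
  by rewrite n1E n0E expr0n/= addr0 ltxx.
have rt : dot (ellipse_tangent q) (vec3 0 0 1) = 0.
  by rewrite dot_vec3 !vec3E; ring.
have [crit0|crit0|crit0] := ltgtP (umbilic_sign q) 0.
- exists mt, C, (ellipse_tangent q), (vec3 0 0 1); have mtC' : mt < C.
    by rewrite -subr_lt0 mtC pmulr_llt0// invr_gt0.
  split.
  + by split.
  + by rewrite ltW//= lexx.
  + by [].
  + by move=> _; split => // crit1; move: crit0; rewrite crit1 ltxx.
- exists C, mt, (vec3 0 0 1), (ellipse_tangent q); have mtC' : C < mt.
    by rewrite -subr_gt0 mtC pmulr_lgt0// invr_gt0.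
  split.
  + by split => //; rewrite dotC.
  + by rewrite lexx ltW.
  + by [].
  + by move=> _; split => // crit1; move: crit0; rewrite crit1 ltxx.
- exists mt, C, (ellipse_tangent q), (vec3 0 0 1).
  have mtE : mt = C by apply/eqP; rewrite -subr_eq0 mtC crit0 mul0r.
  split.
  + by split.
  + by rewrite mtE lexx.
  + by [].
  + by move=> _; split; rewrite ?ltxx.
Qed.

End Axes.

(** * Principal lines of the surface and of the ellipsoid of R^4 *)

Section Lines.
Variables (R : realType) (a b c : R).
Hypotheses (b0 : 0 < b) (bc : b < c) (ca : c < a).

Local Notation s3 := (vec3 a b c).
Local Notation s4 := (vec4 a b c c).
Local Notation C := (c ^- 2).

Definition list2 (T : Type) (x y : T) (i : 'I_2) : T := if i == ord0 then x else y.

Definition list3 (T : Type) (x y z : T) (i : 'I_3) : T :=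
  if i == ord0 then x else if i == ord_max then z else y.

Lemma ord2E (i : 'I_2) : (i = ord0) + (i = ord_max).
Proof. by case: i => [[|[|//]] lti]; [left|right]; exact: val_inj. Qed.

Lemma ord3E (i : 'I_3) : (i = ord0) + (i = inord 1) + (i = ord_max).
Proof.
by case: i => [[|[|[|//]]] lti]; [left; left|left; right|right]; apply: val_inj;
  rewrite /= ?inordK.
Qed.

Lemma list2E (T : Type) (x y : T) :
  (list2 x y ord0 = x) * (list2 x y ord_max = y).
Proof. by []. Qed.

Lemma inord1 : ((inord 1 : 'I_3) == ord0 = false) * ((inord 1 : 'I_3) == ord_max = false).
Proof. by rewrite -!val_eqE /= inordK. Qed.

Lemma list3E (T : Type) (x y z : T) :
  (list3 x y z ord0 = x) * (list3 x y z (inord 1) = y) * (list3 x y z ord_max = z).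
Proof. by rewrite /list3 !inord1. Qed.

Lemma frame2 q m m' v v' : eigenpair a b c q m m' v v' -> m <= m' ->
  principal_frame s3 q (list2 m m') (\matrix_i list2 v v' i).
Proof.
move=> [ev ev' v0 v'0 vv'] mm'; split => [i j|i|i|i j]; rewrite ?rowK.
- by case: (ord2E i) => ->; case: (ord2E j) => ->; rewrite !list2E.
- by case: (ord2E i) => ->; rewrite !list2E.
- by case: (ord2E i) => ->; rewrite !list2E.
- case: (ord2E i) => ->; case: (ord2E j) => ->; rewrite ?eqxx ?rowK !list2E//.
  by rewrite dotC.
Qed.

(** The bounds on m and m' place the eigenvalue 1/c^2 of the rotation field in
    the middle. *)
Lemma frame3 q m m' v v' h : unit_pair h -> eigenpair a b c q m m' v v' ->
  m <= C <= m' ->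
  principal_frame s4 (embed h q) (list3 m C m')
    (\matrix_i list3 (embed h v) (rotation_field h) (embed h v') i).
Proof.
move=> hu [ev ev' v0 v'0 vv'] /andP[mC Cm'].
have mm' := le_trans mC Cm'.
split => [i j|i|i|i j]; rewrite ?rowK.
- by case: (ord3E i) => [[->|->]|->]; case: (ord3E j) => [[->|->]|->];
    rewrite !list3E// /= ?inordK.
- by case: (ord3E i) => [[->|->]|->]; rewrite !list3E;
    [exact: eigen_embed|exact: eigen_rotation_field|exact: eigen_embed].
- by case: (ord3E i) => [[->|->]|->]; rewrite !list3E ?embed_eq0 ?rotation_field_neq0.
- case: (ord3E i) => [[->|->]|->]; case: (ord3E j) => [[->|->]|->];
    rewrite ?eqxx ?rowK !list3E//= ?(dotC (rotation_field h)) ?dot_embed_rotation_field// dot_embed//.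
  by rewrite dotC.
Qed.

Definition sgnb (f : bool) : R := if f then 1 else -1.
Definition idx2 (f : bool) : 'I_2 := if f then ord0 else ord_max.
Definition idx3 (f : bool) : 'I_3 := if f then ord0 else ord_max.

(** The boolean f selects the smaller (f = true) or the larger (f = false) of
    the two eigenvalues of the surface, so that L1 and L3 are treated at once:
    the two cases differ by the sign sgnb f of every comparison with 1/c^2.  Here
    m, v are the selected eigenvalue and eigenvector and m' is the other
    eigenvalue.  In R^4 the selected eigenvalue has to differ from 1/c^2, in R^3
    from m'; on the arcs where sgnb f times umbilic_sign is positive (the bad
    side) only the second condition holds. *)
Record line_data (f : bool) (q : 'rV[R]_3) (m m' : R) (v : 'rV[R]_3) : Prop :=
    LineData {
  ld_eigen : eigen s3 q m v;
  ld_neq0 : v != 0;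
  ld_le : 0 <= sgnb f * (C - m);
  ld_line3 : forall u, principal_line s3 (idx2 f) q u <->
    [/\ m != m', u != 0 & exists k, u = k *: v];
  ld_line4 : forall h, unit_pair h -> forall u,
    principal_line s4 (idx3 f) (embed h q) u <->
    [/\ m != C, u != 0 & exists k, u = k *: embed h v];
  ld_interior : q 0 2 != 0 -> m != C /\ m != m';
  ld_good : q 0 2 = 0 -> sgnb f * umbilic_sign a b c q < 0 ->
    [/\ m != C, m != m' & v = ellipse_tangent a b q];
  ld_bad : q 0 2 = 0 -> 0 < sgnb f * umbilic_sign a b c q ->
    [/\ m = C, m != m' & v = vec3 0 0 1];
  ld_umbilic : q 0 2 = 0 -> umbilic_sign a b c q = 0 -> m = C /\ m' = C }.

Lemma line_data_exists f q : ellipsoid s3 q ->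
  exists m m' v, line_data f q m m' v.
Proof.
move=> qE; have [m [m' [v [v' [evv /andP[mC Cm'] interior bdry]]]]] :=
  eigenpair_exists b0 bc ca qE.
have mm' := le_trans mC Cm'.
have F2 := frame2 evv mm'.
have F3 h hu : principal_frame s4 (embed h q) (list3 m C m') _ :=
  @frame3 q m m' v v' h hu evv (introT andP (conj mC Cm')).
have p3 := axes3_gt0 b0 bc ca; have p4 := axes4_gt0 b0 bc ca.
have neq2 f' : (forall j, j != idx2 f' -> list2 m m' j != list2 m m' (idx2 f')) <-> m != m'.
  split=> [H|H j].
    by case: f' H => /= H; [have := H ord_max isT; rewrite !list2E eq_sym|have := H ord0 isT].
  case: (ord2E j) => ->; case: f'; rewrite /= ?eqxx// !list2E//.
  by rewrite eq_sym.
have E4 h : unit_pair h -> ellipsoid s4 (embed h q).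
  by move=> hu; apply/ellipsoid_embed.
have [ev ev' v0 v'0 vv'] := evv.
case: f.
  exists m, m', v; split => //; rewrite ?mul1r.
  - by rewrite subr_ge0.
  - move=> u; rewrite (frame_principal_line p3 qE F2) rowK.
    by split=> -[H1 u0 H2]; split => //; exact/(neq2 true).
  - move=> h hu u; rewrite (frame_principal_line p4 (E4 h hu) (F3 h hu)) rowK.
    split=> -[H1 u0 H2]; split => //.
      by have := H1 (inord 1); rewrite /= inord1 !list3E eq_sym => /(_ isT).
    move=> j; case: (ord3E j) => [[->|->]|->]; rewrite ?eqxx//= !list3E => _.
      by rewrite eq_sym.
    by rewrite gt_eqF// (lt_le_trans _ Cm')// lt_neqAle H1.
  - by move=> /interior /andP[H1 H2]; rewrite !lt_eqF//; exact: lt_trans H2.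
  - move=> r0; rewrite ?mul1r => k0; have [/(_ k0)[H1 -> -> _] _ _] := bdry r0.
    by rewrite lt_eqF.
  - move=> r0; rewrite ?mul1r => k0; have [_ /(_ k0)[-> H1 -> _] _] := bdry r0.
    by rewrite lt_eqF.
  - by move=> r0 k0; have [_ _ /(_ k0)] := bdry r0.
exists m', m, v'; split => //.
- by rewrite /= mulN1r opprB subr_ge0.
- move=> u; rewrite (frame_principal_line p3 qE F2) rowK.
  by split=> -[H1 u0 H2]; split => //; [rewrite eq_sym; exact/(neq2 false)|
    apply/(neq2 false); rewrite eq_sym].
- move=> h hu u; rewrite (frame_principal_line p4 (E4 h hu) (F3 h hu)) rowK.
  split=> -[H1 u0 H2]; split => //.
    by have := H1 (inord 1); rewrite /= inord1 !list3E eq_sym => /(_ isT).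
  move=> j; case: (ord3E j) => [[->|->]|->]; rewrite ?eqxx//= !list3E => _.
    by rewrite lt_eqF// (le_lt_trans mC)// lt_neqAle eq_sym H1.
  by rewrite eq_sym.
- by move=> /interior /andP[H1 H2]; rewrite !gt_eqF//; exact: lt_trans H2.
- move=> r0; rewrite /= mulN1r oppr_lt0 => k0; have [_ /(_ k0)[-> H1 _ ->] _] := bdry r0.
  by rewrite gt_eqF.
- move=> r0; rewrite /= mulN1r oppr_gt0 => k0; have [/(_ k0)[H1 -> _ ->] _ _] := bdry r0.
  by rewrite gt_eqF.
- by move=> r0 k0; have [_ _ /(_ k0)[]] := bdry r0.
Qed.

Lemma curvature_data q : ellipsoid s3 q ->
  exists m m' nu : R, [/\ 0 < nu, m <= C <= m',
   forall h, unit_pair h ->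
    (forall k, principal_curvatures s4 (embed h q) k <->
       k = (fun i => list3 m C m' i / nu)) /\
    (forall u, principal_line s4 (inord 1) (embed h q) u <->
      [/\ m != C, m' != C, u != 0 & exists k, u = k *: rotation_field h]),
   q 0 2 != 0 -> m < C < m' &
   q 0 2 = 0 -> [/\ umbilic_sign a b c q < 0 -> m < C /\ m' = C,
     0 < umbilic_sign a b c q -> m = C /\ C < m' &
     umbilic_sign a b c q = 0 -> m = C /\ m' = C]].
Proof.
move=> qE; have [m [m' [v [v' [evv mCm' interior bdry]]]]] :=
  eigenpair_exists b0 bc ca qE.
have p3 := axes3_gt0 b0 bc ca; have p4 := axes4_gt0 b0 bc ca.
exists m, m', (enorm (conormal s3 q)); split => //.
- by apply: enorm_gt0; rewrite conormal_eq0//; exact: ellipsoid_neq0 qE.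
- move=> h hu; have E4 : ellipsoid s4 (embed h q) by apply/ellipsoid_embed.
  have F3 := frame3 hu evv mCm'.
  split=> [k|u].
    by rewrite (frame_curvatures p4 E4 F3) conormal_embed /enorm dot_embed.
  rewrite (frame_principal_line p4 E4 F3) rowK !list3E; split=> [[H1 u0 H2]|[H1 H1' u0 H2]].
    split => //.
      by have := H1 ord0; rewrite [ord0 == _]eq_sym inord1 !list3E => /(_ isT).
    by have := H1 ord_max; rewrite [ord_max == _]eq_sym inord1 !list3E => /(_ isT).
  split=> [j||]; [|by []|by []]; case: (ord3E j) => [[->|->]|->]; rewrite ?eqxx// !list3E.
- move=> r0; have [H1 H2 H3] := bdry r0; split => // k0.
    by have [h1 h2 _ _] := H1 k0.
  by have [h1 h2 _ _] := H2 k0.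
Qed.

End Lines.

(** * Umbilic and partially umbilic points *)

Section Arcs.
Variables (R : realType) (u1 : R).
Hypothesis u1_itv : 0 < u1 < pi / 2.

(** With 0 < u1 < pi/2, the five consecutive parameters at which cos^2 takes the
    value cos^2 u1 along a full turn starting at - u1. *)
Definition arc_end (j : nat) : R :=
  nth 0 [:: - u1; u1; pi - u1; pi + u1; pi *+ 2 - u1] j.

Let u10 : 0 < u1. Proof. by case/andP: u1_itv. Qed.
Let u1p : u1 < pi / 2. Proof. by case/andP: u1_itv. Qed.
Let p0 : 0 < pi :> R. Proof. exact: pi_gt0. Qed.

Let cos0 : 0 < cos u1.
Proof. by move: (u10) (p0) => h1 h2; apply: cos_gt0_pihalf; rewrite u1p andbT; lra. Qed.

Let sin0 : 0 < sin u1.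
Proof. by apply: sin_gt0_pihalf; rewrite u1p andbT. Qed.

Lemma cosPB (x : R) : cos (pi - x) = - cos x.
Proof. by rewrite cosB cospi sinpi; ring. Qed.

Lemma sinPB (x : R) : sin (pi - x) = sin x.
Proof. by rewrite sinB cospi sinpi; ring. Qed.

Lemma cos2PB (x : R) : cos (pi *+ 2 - x) = cos x.
Proof. by rewrite cosB cos2pi sin2pi; ring. Qed.

Lemma sin2PB (x : R) : sin (pi *+ 2 - x) = - sin x.
Proof. by rewrite sinB cos2pi sin2pi; ring. Qed.

Lemma cosPD (x : R) : cos (pi + x) = - cos x.
Proof. by rewrite cosD cospi sinpi; ring. Qed.

Lemma sinPD (x : R) : sin (pi + x) = - sin x.
Proof. by rewrite sinD cospi sinpi; ring. Qed.

Lemma arc_end_lt j : (j < 4)%N -> arc_end j < arc_end j.+1.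
Proof.
move: (u10) (u1p) (p0) => ? ? ?.
by case: j => [|[|[|[|//]]]] _; rewrite /arc_end/= ?mulr2n; lra.
Qed.

Lemma arc_end_cos j : (j < 4)%N -> cos (arc_end j) ^+ 2 = cos u1 ^+ 2.
Proof.
case: j => [|[|[|[|//]]]] _; rewrite /arc_end/=.
- by rewrite cosN.
- by [].
- by rewrite cosPB sqrrN.
- by rewrite cosPD sqrrN.
Qed.

Lemma cos_inner (u : R) : - u1 < u < u1 -> cos u1 ^+ 2 < cos u ^+ 2.
Proof.
move: (u10) (u1p) (p0) => h1 h2 h3.
wlog u0 : u / 0 <= u => [W|/andP[_ uu1]].
  have [/W//|u0] := leP 0 u; rewrite -(cosN u) => H; apply: W; first lra.
  by move/andP: H => [H1 H2]; apply/andP; split; lra.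
have : cos u1 < cos u by rewrite ltr_cos// in_itv/=; apply/andP; split; lra.
by move=> ?; rewrite ltr_pXn2r// nnegrE ltW// (lt_trans cos0).
Qed.

Lemma cos_outer (u : R) : u1 < u < pi - u1 -> cos u ^+ 2 < cos u1 ^+ 2.
Proof.
move: (u10) (u1p) (p0) => h1 h2 h3 /andP[H1 H2].
have l1 : cos u < cos u1 by rewrite ltr_cos// in_itv/=; apply/andP; split; lra.
have l2 : - cos u1 < cos u.
  by rewrite -cosPB ltr_cos// in_itv/=; apply/andP; split; lra.
by nra.
Qed.

Lemma arc_cos j u : (j < 4)%N -> arc_end j < u < arc_end j.+1 ->
  cos u ^+ 2 != cos u1 ^+ 2.
Proof.
have cosE : cos u ^+ 2 = cos (u - pi) ^+ 2.
  by rewrite cosB cospi sinpi; ring.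
case: j => [|[|[|[|//]]]] _; rewrite /arc_end/= => uj.
- by rewrite gt_eqF// cos_inner.
- by rewrite lt_eqF// cos_outer.
- rewrite cosE gt_eqF// cos_inner//; move/andP: uj => [? ?].
  by apply/andP; split; lra.
- rewrite cosE lt_eqF// cos_outer//; move/andP: uj; rewrite mulr2n => -[? ?].
  by apply/andP; split; lra.
Qed.

Lemma arc_surj (X Y : R) : X ^+ 2 + Y ^+ 2 = 1 -> X ^+ 2 != cos u1 ^+ 2 ->
  exists2 j, (j < 4)%N & exists2 u, arc_end j < u < arc_end j.+1 &
    X = cos u /\ Y = sin u.
Proof.
move: (u10) (u1p) (p0) => h1 h2 h3.
move=> XY Xk; have X1 : -1 <= X <= 1 by apply/andP; split; nra.
have [/andP[ua0 uap] cosE] := acos_def X1.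
have sinE : sin (acos X) = `|Y|.
  by rewrite sin_acos// -XY addrAC subrr add0r sqrtr_sqr.
move: (acos X) ua0 uap cosE sinE => u ua0 uap cosE sinE.
have nu1 : u != u1 by apply: contra_neq Xk => uE; rewrite -cosE uE.
have nu2 : u != pi - u1.
  by apply: contra_neq Xk => uE; rewrite -cosE uE cosPB sqrrN.
have [Y0|Y0] := leP 0 Y.
  rewrite ger0_norm// in sinE.
  have [uu1|uu1|/eqP] := ltgtP u u1; last by rewrite (negPf nu1).
    by exists 0%N => //; exists u => //; rewrite /arc_end/= uu1 andbT; lra.
  have [uu2|uu2|/eqP] := ltgtP u (pi - u1); last by rewrite (negPf nu2).
    by exists 1%N => //; exists u => //; rewrite /arc_end/= uu1.
  by exists 2%N => //; exists u => //; rewrite /arc_end/= uu2/=; lra.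
rewrite ltr0_norm// in sinE.
have YE : Y = - sin u by rewrite sinE opprK.
have [uu1|uu1|/eqP] := ltgtP u u1; last by rewrite (negPf nu1).
  exists 0%N => //; exists (- u); last by rewrite cosN sinN.
  by rewrite /arc_end/=; apply/andP; split; lra.
have [uu2|uu2|/eqP] := ltgtP u (pi - u1); last by rewrite (negPf nu2).
  exists 3%N => //; exists (pi *+ 2 - u); last by rewrite cos2PB sin2PB.
  by rewrite /arc_end/= mulr2n; apply/andP; split; lra.
exists 2%N => //; exists (pi *+ 2 - u); last by rewrite cos2PB sin2PB.
by rewrite /arc_end/= mulr2n; apply/andP; split; lra.
Qed.

Lemma arc_end_surj (X Y : R) : X ^+ 2 + Y ^+ 2 = 1 -> X ^+ 2 = cos u1 ^+ 2 ->
  exists2 j, (j < 4)%N & X = cos (arc_end j) /\ Y = sin (arc_end j).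
Proof.
move=> XY Xk; have Yk : Y ^+ 2 = sin u1 ^+ 2 by rewrite sin2cos2 -Xk -XY; ring.
move/eqP: Xk; move/eqP: Yk; rewrite !eqf_sqr.
move=> /orP[]/eqP -> /orP[]/eqP ->.
- by exists 1%N.
- by exists 2%N => //; rewrite /arc_end/= cosPB sinPB.
- by exists 0%N => //; rewrite /arc_end/= cosN sinN.
- by exists 3%N => //; rewrite /arc_end/= cosPD sinPD.
Qed.

Lemma arc_end_inj i j : (i < 4)%N -> (j < 4)%N ->
  cos (arc_end i) = cos (arc_end j) -> sin (arc_end i) = sin (arc_end j) ->
  i = j.
Proof.
move: (cos0) (sin0) => c0 s0.
case: i => [|[|[|[|//]]]] _; case: j => [|[|[|[|//]]]] _ //;
 rewrite /arc_end/= ?(cosN, sinN, cosPB, sinPB, cosPD, sinPD) => E1 E2;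
 exfalso; lra.
Qed.

End Arcs.

Section Umbilics.
Variables (R : realType) (a b c : R).
Hypotheses (b0 : 0 < b) (bc : b < c) (ca : c < a).

Let c0 : 0 < c. Proof. exact: lt_trans bc. Qed.
Let a0 : 0 < a. Proof. exact: lt_trans ca. Qed.

Local Notation s3 := (vec3 a b c).
Local Notation s4 := (vec4 a b c c).

Lemma ellipsoid3E q : ellipsoid s3 q <->
  (q 0 0 / a) ^+ 2 + (q 0 1 / b) ^+ 2 + (q 0 2 / c) ^+ 2 = 1.
Proof. by rewrite /ellipsoid /ellipsoid_form /= sum_ord3 !vec3E. Qed.

(** Polar coordinates in the (z,w)-plane; h is arbitrary when z = w = 0. *)
Lemma embed_surj (p : 'rV[R]_4) :
  exists h q, [/\ unit_pair h, p = embed h q & 0 <= q 0 2].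
Proof.
pose r := Num.sqrt (p 0 2 ^+ 2 + p 0 3 ^+ 2).
have r0 : 0 <= p 0 2 ^+ 2 + p 0 3 ^+ 2 by rewrite addr_ge0// sqr_ge0.
have r2 : r ^+ 2 = p 0 2 ^+ 2 + p 0 3 ^+ 2 by rewrite sqr_sqrtr.
have [rE|rE] := eqVneq r 0.
  move: r2; rewrite rE expr0n/= => /esym/eqP; rewrite paddr_eq0 ?sqr_ge0//.
  rewrite !sqrf_eq0 => /andP[/eqP z0 /eqP w0].
  exists (1, 0), (vec3 (p 0 0) (p 0 1) 0); split.
  - by rewrite /unit_pair/=; ring.
  - by rewrite {1}(vec4_eta p) /embed !vec3E z0 w0 !mul0r.
  - by rewrite vec3E.
exists (p 0 2 / r, p 0 3 / r), (vec3 (p 0 0) (p 0 1) r); split.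
- by rewrite /unit_pair/= !expr_div_n -mulrDl -r2 divff// expf_neq0.
- by rewrite {1}(vec4_eta p) /embed !vec3E /= !(mulrC r) !divfK.
- by rewrite vec3E sqrtr_ge0.
Qed.

Lemma E0_embed h q : unit_pair h -> ellipsoid s3 q ->
  E0 a b (embed h q) <-> q 0 2 = 0.
Proof.
move=> hu /ellipsoid3E qE; split=> [[x [y [_ /vec4_inj[_ _ z0 w0]]]]|q2].
  have : q 0 2 ^+ 2 * (h.1 ^+ 2 + h.2 ^+ 2) = 0.
    by rewrite mulrDr -!exprMn z0 w0 expr0n/= addr0.
  by rewrite hu mulr1 => /eqP; rewrite sqrf_eq0 => /eqP.
exists (q 0 0), (q 0 1); split; last by rewrite /embed q2 !mul0r.
by rewrite -qE q2 mul0r expr0n/= addr0 !expr_div_n.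
Qed.

Lemma E0_ellipsoid p : E0 a b p -> forall h, unit_pair h ->
  exists q, [/\ ellipsoid s3 q, p = embed h q & q 0 2 = 0].
Proof.
move=> [x [y [xy ->]]] h hu; exists (vec3 x y 0); split.
- by apply/ellipsoid3E; rewrite !vec3E mul0r expr0n/= addr0 !expr_div_n.
- by rewrite /embed !vec3E !mul0r.
- by rewrite vec3E.
Qed.

Lemma umbilic_signE (x y : R) : (x / a) ^+ 2 + (y / b) ^+ 2 = 1 ->
  umbilic_sign a b c (vec3 x y 0) = ((a ^+ 2 - b ^+ 2) * (x / a) ^+ 2 - (a ^+ 2 - c ^+ 2))
    / (a ^+ 2 * b ^+ 2 * c ^+ 2).
Proof.
move=> xy; rewrite /umbilic_sign !vec3E.
have -> : a ^+ 2 - c ^+ 2 = (a ^+ 2 - c ^+ 2) * ((x / a) ^+ 2 + (y / b) ^+ 2).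
  by rewrite xy mulr1.
by field; rewrite !gt_eqF.
Qed.

Lemma umbilics_embed h q : unit_pair h -> ellipsoid s3 q ->
  umbilics s4 (embed h q) <-> q 0 2 = 0 /\ umbilic_sign a b c q = 0.
Proof.
move=> hu qE; have E4 : ellipsoid s4 (embed h q) by apply/ellipsoid_embed.
have [m [m' [nu [nu0 /andP[mC Cm'] + int bd]]]] := curvature_data b0 bc ca qE.
move=> /(_ h hu)[pc _]; have nuV : nu^-1 != 0 by rewrite invr_eq0 gt_eqF.
split=> [[_ [k [/pc -> keq]]]|[r0 k0]].
  have mm' : m = m'.
    by have := keq ord0 ord_max; rewrite !list3E => /(mulIf nuV).
  have r0 : q 0 2 = 0.
    apply: contrapT => /eqP/int; rewrite mm' => /andP[H1 H2].
    by have := lt_trans H1 H2; rewrite ltxx.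
  split => //; have [H1 H2 _] := bd r0.
  have [k0|k0|//] := ltgtP (umbilic_sign a b c q) 0.
    by have [+ mE] := H1 k0; rewrite mm' mE ltxx.
  by have [mE +] := H2 k0; rewrite -mm' mE ltxx.
split => //; exists (fun i => list3 m (c ^- 2) m' i / nu); split; first exact/pc.
have [_ _ /(_ k0)[-> ->]] := bd r0 => i j.
by case: (ord3E i) => [[->|->]|->]; case: (ord3E j) => [[->|->]|->]; rewrite !list3E.
Qed.

Lemma partial_umbilics_embed h q : unit_pair h -> ellipsoid s3 q ->
  partial_umbilics s4 (embed h q) <-> q 0 2 = 0 /\ umbilic_sign a b c q != 0.
Proof.
move=> hu qE; have E4 : ellipsoid s4 (embed h q) by apply/ellipsoid_embed.
have [m [m' [nu [nu0 mCm' + int bd]]]] := curvature_data b0 bc ca qE.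
move=> /(_ h hu)[pc _]; have nuV : 0 < nu^-1 by rewrite invr_gt0.
have nuV0 : nu^-1 != 0 by rewrite gt_eqF.
split=> [[_ [k [/pc -> ]]]|[r0 k0]].
  rewrite !list3E !ltr_pM2r// => H.
  have r0 : q 0 2 = 0.
    apply: contrapT => /eqP/int/andP[H1 H2].
    by case: H => -[] => [/(mulIf nuV0) E|_ /(mulIf nuV0) E]; move: H1 H2;
      rewrite E ltxx.
  split => //; apply/eqP => k0; have [_ _ /(_ k0)[mE m'E]] := bd r0.
  by move: H; rewrite mE m'E ltxx => -[[]|[]].
split => //; exists (fun i => list3 m (c ^- 2) m' i / nu); split; first exact/pc.
rewrite !list3E !ltr_pM2r//; have [H1 H2 _] := bd r0.
have [/H1[mC ->]|/H2[-> Cm']|/eqP] := ltgtP (umbilic_sign a b c q) 0; last by rewrite (negPf k0).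
  by right.
by left.
Qed.

(** By umbilics_embed and partial_umbilics_embed the two sets are the zero set
    of umbilic_sign on E0 and its complement in E0, and at parameter u
    umbilic_sign vanishes when cos^2 u has the critical value.  The value lies
    strictly between 0 and 1, so it is cos^2 u1 for some 0 < u1 < pi/2. *)
Lemma umbilics_part :
  [/\ umbilics s4 `<=` E0 a b,
      umbilics s4 =
        [set ellipse_point a b u | u in
           [set u | cos u ^+ 2 = (a ^+ 2 - c ^+ 2) / (a ^+ 2 - b ^+ 2)]],
      (umbilics s4 #= `I_4)%card,
      partial_umbilics s4 = E0 a b `\` umbilics s4 &
      exists t : nat -> R,
        [/\ forall j, (j < 4)%N -> t j < t j.+1,
            t 4%N = t 0%N + pi *+ 2,
            umbilics s4 = [set ellipse_point a b (t j) | j in `I_4] &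
            partial_umbilics s4 =
              \bigcup_(j in `I_4)
                 [set ellipse_point a b u | u in `]t j, t j.+1[]]].
Proof.
pose h : R * R := (1, 0).
have hu : unit_pair h by rewrite /unit_pair/=; ring.
have ab : 0 < a ^+ 2 - b ^+ 2.
  by rewrite subr_gt0 ltr_pXn2r// ?nnegrE ?ltW// (lt_trans bc).
have ac : 0 < a ^+ 2 - c ^+ 2 by rewrite subr_gt0 ltr_pXn2r// ?nnegrE ltW.
have acb : a ^+ 2 - c ^+ 2 < a ^+ 2 - b ^+ 2.
  by rewrite ltrD2l ltrN2 ltr_pXn2r// nnegrE ltW.
set k := (a ^+ 2 - c ^+ 2) / (a ^+ 2 - b ^+ 2).
have k0 : 0 < k by rewrite divr_gt0.
have k1 : k < 1 by rewrite ltr_pdivrMr// mul1r.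
pose u1 := acos (Num.sqrt k).
have sk0 : 0 < Num.sqrt k by rewrite sqrtr_gt0.
have sk1 : Num.sqrt k < 1 by rewrite -sqrtr1 ltr_sqrt.
have skB : -1 <= Num.sqrt k <= 1 by apply/andP; split; lra.
have [u1B cosu1] := acos_def skB.
have cosu1k : cos u1 ^+ 2 = k by rewrite cosu1 sqr_sqrtr// ltW.
have u1_itv : 0 < u1 < pi / 2.
  have p0 := pi_gt0 R; rewrite acos_gt0/=; last by apply/andP; split; lra.
  rewrite -ltr_cos ?in_itv//=; last by apply/andP; split; lra.
  by rewrite cos_pihalf cosu1.
pose t := arc_end u1.
have EP u : ellipse_point a b u = embed h (vec3 (a * cos u) (b * sin u) 0).
  by rewrite /embed !vec3E !mul0r.
have an0 : a != 0 by rewrite gt_eqF. have bn0 : b != 0 by rewrite gt_eqF.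
have XY (u : R) : (a * cos u / a) ^+ 2 + (b * sin u / b) ^+ 2 = 1.
  by rewrite ![_ * _ / _]mulrAC !divff// !mul1r cos2Dsin2.
have E3 u : ellipsoid s3 (vec3 (a * cos u) (b * sin u) 0).
  by apply/ellipsoid3E; rewrite !vec3E XY mul0r expr0n/= addr0.
have critu u : (umbilic_sign a b c (vec3 (a * cos u) (b * sin u) 0) == 0) =
    (cos u ^+ 2 == k).
  have D0 : (a ^+ 2 * b ^+ 2 * c ^+ 2)^-1 != 0.
    by rewrite invr_eq0 gt_eqF// !mulr_gt0// exprn_gt0.
  rewrite umbilic_signE// mulf_eq0 (negPf D0) orbF subr_eq0 mulrAC divff// mul1r.
  have abn0 : a ^+ 2 - b ^+ 2 != 0 by rewrite gt_eqF.
  rewrite /k; apply/eqP/eqP => [<-|->]; first by rewrite mulrAC divff// mul1r.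
  by rewrite mulrCA divff// mulr1.
have umbu u : umbilics s4 (ellipse_point a b u) <-> cos u ^+ 2 = k.
  rewrite EP (umbilics_embed hu (E3 u)) vec3E.
  split=> [[_ /eqP]|/eqP uk]; first by rewrite critu => /eqP.
  by split=> //; apply/eqP; rewrite critu.
have pumbu u : partial_umbilics s4 (ellipse_point a b u) <-> cos u ^+ 2 != k.
  by rewrite EP (partial_umbilics_embed hu (E3 u)) vec3E critu; split=> [[]|].
have E0u u : E0 a b (ellipse_point a b u).
  by rewrite EP; apply/(E0_embed hu (E3 u)); rewrite vec3E.
have EPcs X Y u : X = cos u -> Y = sin u -> vec4 (a * X) (b * Y) 0 0 = ellipse_point a b u.
  by move=> -> ->.
have E0P p : E0 a b p -> exists X Y, X ^+ 2 + Y ^+ 2 = 1 /\ p = vec4 (a * X) (b * Y) 0 0.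
  move=> [x [y [xy ->]]]; exists (x / a), (y / b); split.
    by rewrite -xy !expr_div_n.
  by rewrite !(mulrC _ (_ / _)) !divfK.
have E0uE p : E0 a b p -> exists u, p = ellipse_point a b u.
  move=> /E0P[X [Y [XY1 ->]]].
  have [Xk|Xk] := eqVneq (X ^+ 2) (cos u1 ^+ 2).
    by have [j _ [XE YE]] := arc_end_surj XY1 Xk; exists (arc_end u1 j); apply: EPcs.
  by have [j _ [u _ [XE YE]]] := arc_surj u1_itv XY1 Xk; exists u; apply: EPcs.
have embE p : ellipsoid s4 p -> exists h q, [/\ unit_pair h, p = embed h q & ellipsoid s3 q].
  move=> pE; have [h' [q [h'u pq _]]] := embed_surj p; exists h', q; split => //.
  by apply/(ellipsoid_embed a b c q h'u); rewrite -pq.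
have umbE0 : umbilics s4 `<=` E0 a b.
  move=> p pu; have [pE _] := pu; have [h' [q [h'u pq qE]]] := embE p pE.
  by move: pu; rewrite pq umbilics_embed// => -[q2 _]; apply/E0_embed.
have pumbE0 : partial_umbilics s4 `<=` E0 a b.
  move=> p pu; have [pE _] := pu; have [h' [q [h'u pq qE]]] := embE p pE.
  by move: pu; rewrite pq partial_umbilics_embed// => -[q2 _]; apply/E0_embed.
have umb_t : umbilics s4 = [set ellipse_point a b (t j) | j in `I_4].
  apply/seteqP; split=> [p pu|p [j j4 <-]]; last first.
    by apply/umbu; rewrite arc_end_cos.
  have [X [Y [XY1 pE]]] := E0P p (umbE0 p pu).
  have [v pv] := E0uE p (umbE0 p pu).
  have Xk : X ^+ 2 = cos u1 ^+ 2.
    move: pu; rewrite pv umbu cosu1k; move: pv; rewrite pE => /vec4_inj[].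
    by move=> /(mulfI an0) ->.
  have [j j4 [XE YE]] := arc_end_surj XY1 Xk.
  by exists j => //; rewrite pE (EPcs _ _ (t j)).
split => //.
- apply/seteqP; split=> [p pu|p [u uk <-]]; last exact/umbu.
  have [u uE] := E0uE p (umbE0 p pu).
  by exists u; rewrite ?uE//=; apply/umbu; rewrite -uE.
- rewrite umb_t; apply: inj_card_eq => i j /set_mem/= i4 /set_mem/= j4.
  move=> /vec4_inj[/(mulfI an0) H1 /(mulfI bn0) H2 _ _].
  exact: (arc_end_inj u1_itv i4 j4).
- apply/seteqP; split=> [p pu|p [pE pnu]].
    split; first exact: pumbE0.
    have [u uE] := E0uE p (pumbE0 p pu); move: pu; rewrite uE.
    by rewrite pumbu umbu => /eqP.
  have [u uE] := E0uE p pE; move: pnu; rewrite uE umbu => /eqP H.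
  exact/pumbu.
- exists t; split => //.
  + by move=> j; exact: arc_end_lt.
  + by rewrite /t /arc_end/=; ring.
  apply/seteqP; split=> [p pu|p [j j4 [u]]]; last first.
    rewrite /= in_itv/= => uj <-; apply/pumbu; rewrite -cosu1k.
    exact: (arc_cos u1_itv j4).
  have [X [Y [XY1 pE]]] := E0P p (pumbE0 p pu).
  have [v pv] := E0uE p (pumbE0 p pu).
  have Xk : X ^+ 2 != cos u1 ^+ 2.
    move: pu; rewrite pv pumbu cosu1k; move: pv; rewrite pE => /vec4_inj[].
    by move=> /(mulfI an0) ->.
  have [j j4 [u uj [XE YE]]] := arc_surj u1_itv XY1 Xk.
  exists j => //; exists u; rewrite /= ?in_itv// pE.
  by rewrite (EPcs _ _ u).
Qed.

End Umbilics.

(** * The pencil and the middle foliation *)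

Lemma angle_exists (R : realType) (X Y : R) : X ^+ 2 + Y ^+ 2 = 1 ->
  exists u, X = cos u /\ Y = sin u.
Proof.
move=> XY; have X1 : -1 <= X <= 1 by apply/andP; split; nra.
have [_ cosE] := acos_def X1.
have sinE : sin (acos X) = `|Y|.
  by rewrite sin_acos// -XY addrAC subrr add0r sqrtr_sqr.
have [Y0|Y0] := leP 0 Y; [exists (acos X)|exists (- acos X)].
  by rewrite cosE sinE ger0_norm.
by rewrite cosN sinN cosE sinE ltr0_norm// opprK.
Qed.

Lemma constant_on_interval (R : realType) (f : R -> R) (al be t0 t1 : R) :
  (forall t, al < t < be -> is_derive t 1 f 0) ->
  al < t0 < be -> al < t1 < be -> f t0 = f t1.
Proof.
move=> df; wlog t01 : t0 t1 / t0 <= t1 => [W H0 H1|/andP[H0 _] /andP[_ H1]].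
  by have [/W|/ltW/W] := leP t0 t1; [exact|move=> /(_ H1 H0) ->].
have inside t : t0 <= t <= t1 -> al < t < be.
  by move=> /andP[h0 h1]; rewrite (lt_le_trans H0 h0) (le_lt_trans h1 H1).
have [] := @MVT_segment R f (fun=> 0) t0 t1 t01.
- move=> t; rewrite in_itv/= => /andP[/ltW h0 /ltW h1].
  by apply: df; apply: inside; rewrite h0.
- apply: derivable_within_continuous => t; rewrite in_itv/= => tt.
  by have [] := df t (inside t tt).
- by move=> t _; rewrite mul0r => /eqP; rewrite subr_eq0 => /eqP.
Qed.

Section LinearCurves.
Variables (R : realType) (V : normedModType R) (h : R * R).

Lemma is_derive_vec3 (x y r : V -> R) (p v : V) (dx dy dr : R) :
  is_derive p v x dx -> is_derive p v y dy -> is_derive p v r dr ->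
  is_derive p v (fun t => vec3 (x t) (y t) (r t)) (vec3 dx dy dr).
Proof.
move=> Hx Hy Hr; apply/is_derive_rowP; apply: ord3P; rewrite vec3E.
- by move: Hx; apply: is_derive_ext => // t; rewrite vec3E.
- by move: Hy; apply: is_derive_ext => // t; rewrite vec3E.
- by move: Hr; apply: is_derive_ext => // t; rewrite vec3E.
Qed.

Lemma is_derive_vec4 (x y z w : V -> R) (p v : V) (dx dy dz dw : R) :
  is_derive p v x dx -> is_derive p v y dy -> is_derive p v z dz ->
  is_derive p v w dw ->
  is_derive p v (fun t => vec4 (x t) (y t) (z t) (w t)) (vec4 dx dy dz dw).
Proof.
move=> Hx Hy Hz Hw; apply/is_derive_rowP; apply: ord4P; rewrite vec4E.
- by move: Hx; apply: is_derive_ext => // t; rewrite vec4E.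
- by move: Hy; apply: is_derive_ext => // t; rewrite vec4E.
- by move: Hz; apply: is_derive_ext => // t; rewrite vec4E.
- by move: Hw; apply: is_derive_ext => // t; rewrite vec4E.
Qed.

Lemma is_derive_mulr (x : V -> R) (k : R) (p v : V) (d : R) :
  is_derive p v x d -> is_derive p v (fun t => x t * k) (d * k).
Proof.
by move=> Hx; have := is_derive_mul Hx (is_derive_cst k p v);
  apply: is_derive_ext => //=; rewrite mulr0 add0r.
Qed.

Lemma is_derive_embed (g : V -> 'rV[R]_3) (p v : V) (d : 'rV[R]_3) :
  is_derive p v g d -> is_derive p v (fun t => embed h (g t)) (embed h d).
Proof.
move=> /is_derive_rowP dg; by apply: is_derive_vec4 => //; apply: is_derive_mulr (dg _).
Qed.

Lemma is_derive_fold (g : V -> 'rV[R]_4) (p v : V) (d : 'rV[R]_4) :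
  is_derive p v g d -> is_derive p v (fun t => fold h (g t)) (fold h d).
Proof.
move=> /is_derive_rowP dg; apply: is_derive_vec3 => //.
by apply: is_deriveD; apply: is_derive_mulr (dg _).
Qed.

End LinearCurves.

Section RowContinuity.
Variables (R : realType) (T : topologicalType).
Implicit Types (x y z w : T -> R) (q : T).

Lemma continuous_vec3 x y z q :
  {for q, continuous x} -> {for q, continuous y} -> {for q, continuous z} ->
  {for q, continuous (fun t => vec3 (x t) (y t) (z t))}.
Proof.
move=> cx cy cz; apply: continuous_rowP => i; case: (ord3_cases i) => -> {i}.
- by rewrite (_ : (fun t => _) = x)//; apply/funext => t; rewrite vec3E.
- by rewrite (_ : (fun t => _) = y)//; apply/funext => t; rewrite vec3E.
- by rewrite (_ : (fun t => _) = z)//; apply/funext => t; rewrite vec3E.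
Qed.

Lemma continuous_vec4 x y z w q :
  {for q, continuous x} -> {for q, continuous y} -> {for q, continuous z} ->
  {for q, continuous w} ->
  {for q, continuous (fun t => vec4 (x t) (y t) (z t) (w t))}.
Proof.
move=> cx cy cz cw; apply: continuous_rowP => i; case: (ord4_cases i) => -> {i}.
- by rewrite (_ : (fun t => _) = x)//; apply/funext => t; rewrite vec4E.
- by rewrite (_ : (fun t => _) = y)//; apply/funext => t; rewrite vec4E.
- by rewrite (_ : (fun t => _) = z)//; apply/funext => t; rewrite vec4E.
- by rewrite (_ : (fun t => _) = w)//; apply/funext => t; rewrite vec4E.
Qed.

Lemma continuous_mulr x (k : R) q :
  {for q, continuous x} -> {for q, continuous (fun t => x t * k)}.
Proof. by move=> cx; apply: cvgM => //; exact: cvg_cst. Qed.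

Lemma continuous_addr x y q :
  {for q, continuous x} -> {for q, continuous y} ->
  {for q, continuous (fun t => x t + y t)}.
Proof. by move=> cx cy; apply: cvgD. Qed.

Lemma continuous_oppr x q :
  {for q, continuous x} -> {for q, continuous (fun t => - x t)}.
Proof. by move=> cx; apply: cvgN. Qed.

Lemma continuous_mul x y q :
  {for q, continuous x} -> {for q, continuous y} ->
  {for q, continuous (fun t => x t * y t)}.
Proof. by move=> cx cy; apply: cvgM. Qed.

Lemma continuous_inv x q :
  x q != 0 -> {for q, continuous x} -> {for q, continuous (fun t => (x t)^-1)}.
Proof. by move=> xq cx; apply: cvgV. Qed.

Lemma continuous_scale (n : nat) (g : T -> 'rV[R]_n) (k : R) q :
  {for q, continuous g} -> {for q, continuous (fun t => k *: g t)}.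
Proof. by move=> cg; apply: cvgZl_tmp. Qed.

End RowContinuity.

Lemma embed_continuous (R : realType) (h : R * R) : continuous (embed h).
Proof.
move=> q; apply: (@continuous_vec4 _ _ (fun t : 'rV[R]_3 => t 0 0) (fun t => t 0 1)
    (fun t => t 0 2 * h.1) (fun t => t 0 2 * h.2)); try exact: row_coord_continuous;
  by apply: continuous_mulr; exact: row_coord_continuous.
Qed.

Lemma fold_continuous (R : realType) (h : R * R) : continuous (fold h).
Proof.
move=> q; apply: (@continuous_vec3 _ _ (fun t : 'rV[R]_4 => t 0 0) (fun t => t 0 1)
    (fun t => t 0 2 * h.1 + t 0 3 * h.2)); try exact: row_coord_continuous.
by apply: continuous_addr; apply: continuous_mulr; exact: row_coord_continuous.
Qed.

Section Pencil.
Variables (R : realType) (a b c : R).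
Hypotheses (b0 : 0 < b) (bc : b < c) (ca : c < a).

Let c0 : 0 < c. Proof. exact: lt_trans bc. Qed.
Let a0 : 0 < a. Proof. exact: lt_trans ca. Qed.
Let p3 := axes3_gt0 b0 bc ca.
Let p4 := axes4_gt0 b0 bc ca.

Local Notation s3 := (vec3 a b c).
Local Notation s4 := (vec4 a b c c).

(** The section of the ellipsoid by the hyperplane of embed h; h and - h give
    the same sheet. *)
Definition sheet (h : R * R) : set 'rV[R]_4 := embed h @` ellipsoid s3.

Definition pencil : set (set 'rV[R]_4) :=
  [set X | exists2 h, unit_pair h & X = sheet h].

Lemma ellipsoid_sheet p : ellipsoid s4 p ->
  exists h q, [/\ unit_pair h, p = embed h q, 0 <= q 0 2 & ellipsoid s3 q].
Proof.
move=> pE; have [h [q [hu pq q2]]] := embed_surj p; exists h, q; split => //.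
by apply/(ellipsoid_embed a b c q hu); rewrite -pq.
Qed.

Lemma sheet_flip (h h' : R * R) (e : R) : e ^+ 2 = 1 ->
  h.1 = e * h'.1 -> h.2 = e * h'.2 -> sheet h `<=` sheet h'.
Proof.
move=> e1 h1 h2 _ [q qE <-]; exists (vec3 (q 0 0) (q 0 1) (q 0 2 * e)).
  apply/ellipsoid3E => //; rewrite !vec3E.
  have -> : (q 0 2 * e / c) ^+ 2 = (q 0 2 / c) ^+ 2 * e ^+ 2 by ring.
  by rewrite e1 mulr1; exact/ellipsoid3E.
by rewrite /embed !vec3E h1 h2 !mulrA.
Qed.

(** A common point of two sheets outside E0 determines h up to sign, hence the
    sheet. *)
Lemma pencil_foliated : foliated_by_pencil (ellipsoid s4) (E0 a b) pencil.
Proof.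
split.
- apply/seteqP; split=> [p [X [h hu ->] [q qE <-]]|p pE].
    exact/ellipsoid_embed.
  have [h [q [hu -> _ qE]]] := ellipsoid_sheet pE.
  by exists (sheet h); [exists h|exists q].
- move=> _ [h hu ->] p /(@E0_ellipsoid _ _ _ c)/(_ h hu)[q [qE -> _]].
  by exists q.
- move=> _ _ [h hu ->] [h' h'u ->] hh'; apply/seteqP; split=> p; last first.
    move=> pE; split.
      by have [q [qE -> _]] := E0_ellipsoid c pE hu; exists q.
    by have [q [qE -> _]] := E0_ellipsoid c pE h'u; exists q.
  move=> [[q qE <-] [q' q'E /vec4_inj[_ _ z w]]].
  apply/(E0_embed hu qE); apply: contrapT => /eqP q2.
  have qq' : q' 0 2 ^+ 2 = q 0 2 ^+ 2.
    rewrite -[LHS]mulr1 -[RHS]mulr1 -{1}h'u -hu !mulrDr -!exprMn.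
    by rewrite z w.
  have q'2 : q' 0 2 != 0 by rewrite -sqrf_eq0 qq' sqrf_eq0.
  apply: hh'; apply/seteqP; split.
    apply: (@sheet_flip _ _ (q' 0 2 / q 0 2)).
    - by rewrite expr_div_n qq' divff// sqrf_eq0.
    - by rewrite mulrAC z mulrAC divff// mul1r.
    - by rewrite mulrAC w mulrAC divff// mul1r.
  apply: (@sheet_flip _ _ (q 0 2 / q' 0 2)).
  - by rewrite expr_div_n qq' divff// sqrf_eq0.
  - by rewrite mulrAC -z mulrAC divff// mul1r.
  - by rewrite mulrAC -w mulrAC divff// mul1r.
Qed.

Lemma sheet_ellipsoid h : unit_pair h -> two_dim_ellipsoid (sheet h).
Proof.
move=> hu; exists s3, (\matrix_i embed h (delta_mx 0 i)), 0; split => //.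
- apply/matrixP => i j; rewrite !mxE.
  have -> : \sum_k (\matrix_i0 embed h (delta_mx 0 i0)) i k *
      (\matrix_i0 embed h (delta_mx 0 i0))^T k j =
      dot (embed h (delta_mx 0 i)) (embed h (delta_mx 0 j)).
    by apply: eq_bigr => k _; rewrite !mxE.
  rewrite dot_embed// /dot (bigD1 i)//= big1 => [|k ki]; rewrite !mxE !eqxx/=.
    by rewrite mul1r addr0.
  by rewrite (negPf ki) mul0r.
- rewrite /sheet; congr (_ @` _); apply/funext => q.
  rewrite add0r; apply/rowP => i; rewrite [RHS]mxE sum_ord3 ![(\matrix_i _) _ _]mxE.
  by case: (ord4_cases i) => ->; rewrite !vec4E !mxE /=; ring.
Qed.

Lemma tangent_sheet h q u : unit_pair h -> ellipsoid s3 q ->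
  tangent (sheet h) (embed h q) u <->
  exists2 v, tangent (ellipsoid s3) q v & u = embed h v.
Proof.
move=> hu qE; split=> [[g [g0 gS dg]]|[v [g [g0 gS dg]] ->]]; last first.
  exists (fun t => embed h (g t)); split; first by rewrite g0.
    by apply: filterS gS => t gt; exists (g t).
  exact: is_derive_embed.
have dg' := is_derive_fold h dg.
have gE : \forall t \near (0 : R), g t = embed h (fold h (g t)).
  by apply: filterS gS => t [q' _ <-]; rewrite embedK.
exists (fold h u).
  exists (fun t => fold h (g t)); split => //; first by rewrite g0 embedK.
  by apply: filterS gS => t [q' q'E <-]; rewrite embedK.
have [_ E1] := dg; have [_ E2] := is_derive_embed h dg'.
rewrite -E2 -E1; exact: near_eq_derive.
Qed.

(** Both lines are defined at a point only if m < 1/c^2 < m'; their vectors are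
    then orthogonal and span the tangent plane of the surface. *)
Lemma sheet_integral_leaf h : unit_pair h ->
  integral_leaf (sheet h) (principal_line s4 ord0) (principal_line s4 ord_max).
Proof.
move=> hu _ [q qE <-] w w' Lw Lw' u.
have [m [mm [v D]]] := line_data_exists b0 bc ca true qE.
have [m' [mm' [v' D']]] := line_data_exists b0 bc ca false qE.
have [mC w0 [k wE]] := (ld_line4 D hu w).1 Lw.
have [m'C w'0 [k' w'E]] := (ld_line4 D' hu w').1 Lw'.
have mC' : m < c ^- 2.
  by have := ld_le D; rewrite mul1r subr_ge0 lt_neqAle mC.
have Cm' : c ^- 2 < m'.
  by have := ld_le D'; rewrite /= mulN1r opprB subr_ge0 lt_neqAle eq_sym m'C.
have mm'lt := lt_trans mC' Cm'.
have vv' : dot v v' = 0.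
  by apply: (eigen_dot (ld_eigen D) (ld_eigen D')); rewrite lt_eqF.
have EP : eigenpair a b c q m m' v v'.
  split => //; [exact: (ld_eigen D)|exact: (ld_eigen D')|exact: (ld_neq0 D)|].
  exact: (ld_neq0 D').
have F := frame2 EP (ltW mm'lt).
have k0 : k != 0 by apply: contra_neq w0 => k0; rewrite wE k0 scale0r.
have k'0 : k' != 0 by apply: contra_neq w'0 => k'0; rewrite w'E k'0 scale0r.
have [[pv _] [pv' _]] := (ld_eigen D, ld_eigen D').
rewrite tangent_sheet//; split=> [[x /(tangent_ellipsoid _ qE) tx ->]|[l [l' ->]]].
  have [v0 v'0] : dot v v != 0 /\ dot v' v' != 0.
    by rewrite !dot_eq0 (ld_neq0 D) (ld_neq0 D').
  pose y := x + (- (dot x v / dot v v)) *: v + (- (dot x v' / dot v' v')) *: v'.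
  have y0 : y = 0.
    apply: (frame_eq0 p3 qE F); first by rewrite !dotDr !dotZr tx pv pv'; ring.
    move=> i; rewrite rowK; case: (ord2E i) => ->; rewrite list2E !dotDl !dotZl.
      by rewrite (dotC v') vv' mulr0 addr0 mulNr divfK// subrr.
    by rewrite vv' mulr0 addr0 mulNr divfK// subrr.
  exists (dot x v / dot v v / k), (dot x v' / dot v' v' / k').
  rewrite wE w'E !scalerA !divfK// -!embedZ -embedD; congr (embed _ _).
  move/eqP: y0; rewrite /y -addrA addr_eq0 !scaleNr => /eqP xE.
  by rewrite [LHS]xE opprD !opprK.
exists (l *: (k *: v) + l' *: (k' *: v')); last first.
  by rewrite wE w'E embedD !embedZ.
apply/tangent_ellipsoid => //.
by rewrite dotDr !dotZr pv pv'; ring.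
Qed.

(** The eigenvalue 1/c^2 of the rotation field is simple exactly off E0. *)
Lemma middle_line h q u : unit_pair h -> ellipsoid s3 q ->
  principal_line s4 (inord 1) (embed h q) u <->
  [/\ q 0 2 != 0, u != 0 & exists k, u = k *: rotation_field h].
Proof.
move=> hu qE; have [m [m' [nu [nu0 mCm' + int bd]]]] := curvature_data b0 bc ca qE.
move=> /(_ h hu)[_ ->]; split=> [[mC m'C u0 uE]|[q2 u0 uE]].
  split => //; apply/eqP => q2; have [H1 H2 H3] := bd q2.
  have [k|k|k] := ltgtP (umbilic_sign a b c q) 0.
  - by move: m'C; have [_ ->] := H1 k; rewrite eqxx.
  - by move: mC; have [->] := H2 k; rewrite eqxx.
  - by move: mC; have [->] := H3 k; rewrite eqxx.
by have /andP[mC Cm'] := int q2; rewrite lt_eqF// gt_eqF.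
Qed.

Lemma middle_line_orthogonal S p v u : pencil S -> S p ->
  principal_line s4 (inord 1) p v -> tangent S p u -> dot v u = 0.
Proof.
move=> [h hu ->] [q qE <-] /(middle_line _ hu qE)[_ _ [k ->]].
move=> /(tangent_sheet _ hu qE)[x _ ->].
by rewrite dotZl dotC dot_embed_rotation_field mulr0.
Qed.

Lemma middle_line_singular :
  singular_points (ellipsoid s4) (principal_line s4 (inord 1)) = E0 a b.
Proof.
pose h1 : R * R := (1, 0); have h1u : unit_pair h1 by rewrite /unit_pair/=; ring.
apply/seteqP; split=> p.
  move=> [pE L0]; have [h [q [hu pq _ qE]]] := ellipsoid_sheet pE.
  rewrite pq; apply/(E0_embed hu qE); apply: contrapT => /eqP q2.
  have : principal_line s4 (inord 1) p (rotation_field h).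
    rewrite pq; apply/middle_line => //; split => //; first exact: rotation_field_neq0.
    by exists 1; rewrite scale1r.
  by rewrite L0.
move=> pE; have [q [qE -> q2]] := E0_ellipsoid c pE h1u.
split; first exact/ellipsoid_embed.
by apply/seteqP; split=> // u /(middle_line _ h1u qE)[]; rewrite q2 eqxx.
Qed.

Definition rotate_pair (h : R * R) (t : R) : R * R :=
  (cos t * h.1 - sin t * h.2, cos t * h.2 + sin t * h.1).

Lemma rotate_pair_unit h t : unit_pair h -> unit_pair (rotate_pair h t).
Proof.
rewrite /unit_pair/= => hu.
have -> : (cos t * h.1 - sin t * h.2) ^+ 2 + (cos t * h.2 + sin t * h.1) ^+ 2 =
  (cos t ^+ 2 + sin t ^+ 2) * (h.1 ^+ 2 + h.2 ^+ 2) by ring.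
by rewrite cos2Dsin2 hu mulr1.
Qed.

(** The velocity of an integral curve is a multiple of the rotation field, so x,
    y and z^2 + w^2 are constant along it. *)
Lemma middle_leaf h q : unit_pair h -> ellipsoid s3 q -> q 0 2 != 0 ->
  leaf (ellipsoid s4) (principal_line s4 (inord 1)) (embed h q) =
  [set embed (rotate_pair h t) q | t in [set: R]].
Proof.
move=> hu qE q2; apply/seteqP; split=> p.
  move=> [al [be [t0 [t1 [g [[gL _] t0I t1I gt0 gt1]]]]]].
  have key t : al < t < be ->
      [/\ is_derive t 1 (fun t => g t 0 0) 0, is_derive t 1 (fun t => g t 0 1) 0 &
       is_derive t 1 (fun t => g t 0 2 ^+ 2 + g t 0 3 ^+ 2) 0].
    move=> tI; have [gE dg Lg] := gL t tI.
    have [h' [q' [h'u gq _ q'E]]] := ellipsoid_sheet gE.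
    move: Lg; rewrite gq derive1E => /(middle_line _ h'u q'E)[_ _ [k dgE]].
    have dgt : is_derive t 1 g (k *: rotation_field h') by rewrite -dgE; exact: derivableP.
    have dgi i : is_derive t 1 (fun t => g t 0 i) (k * rotation_field h' 0 i).
      have /is_derive_rowP/(_ i) := dgt; by rewrite mxE.
    split.
    - by move: (dgi 0); apply: is_derive_ext => //; rewrite vec4E mulr0.
    - by move: (dgi 1); apply: is_derive_ext => //; rewrite vec4E mulr0.
    - have := is_deriveD (is_derive_mul (dgi 2) (dgi 2)) (is_derive_mul (dgi 3) (dgi 3)).
      apply: is_derive_ext => [//|]; rewrite gq !vec4E; ring.
  have E0' := constant_on_interval (fun t tI => let: And3 H _ _ := key t tI in H) t0I t1I.
  have E1' := constant_on_interval (fun t tI => let: And3 _ H _ := key t tI in H) t0I t1I.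
  have E2' := constant_on_interval (fun t tI => let: And3 _ _ H := key t tI in H) t0I t1I.
  move: E0' E1' E2'; rewrite /= gt0 gt1 !vec4E => x0 y0 zw.
  have zw' : p 0 2 ^+ 2 + p 0 3 ^+ 2 = q 0 2 ^+ 2.
    by rewrite -zw !exprMn -mulrDr hu mulr1.
  (* The angle from h to (z,w). *)
  have [t [ct st]] : exists t, (p 0 2 * h.1 + p 0 3 * h.2) / q 0 2 = cos t /\
      (p 0 3 * h.1 - p 0 2 * h.2) / q 0 2 = sin t.
    apply: angle_exists; rewrite !expr_div_n -mulrDl.
    have -> : (p 0 2 * h.1 + p 0 3 * h.2) ^+ 2 + (p 0 3 * h.1 - p 0 2 * h.2) ^+ 2 =
      (p 0 2 ^+ 2 + p 0 3 ^+ 2) * (h.1 ^+ 2 + h.2 ^+ 2) by ring.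
    by rewrite hu mulr1 zw' divff// sqrf_eq0.
  exists t => //; rewrite [RHS]vec4_eta; apply/vec4_inj; split => //=.
    rewrite -ct -st.
    have -> : q 0 2 * ((p 0 2 * h.1 + p 0 3 * h.2) / q 0 2 * h.1 -
      (p 0 3 * h.1 - p 0 2 * h.2) / q 0 2 * h.2) =
      p 0 2 * (h.1 ^+ 2 + h.2 ^+ 2) by field.
    by rewrite hu mulr1.
  rewrite -ct -st.
  have -> : q 0 2 * ((p 0 2 * h.1 + p 0 3 * h.2) / q 0 2 * h.2 +
    (p 0 3 * h.1 - p 0 2 * h.2) / q 0 2 * h.1) =
    p 0 3 * (h.1 ^+ 2 + h.2 ^+ 2) by field.
  by rewrite hu mulr1.
move=> [t _ <-]; pose g t := embed (rotate_pair h t) q.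
have dg (s : R) : is_derive s 1 g (q 0 2 *: rotation_field (rotate_pair h s)).
  rewrite /g /embed /rotation_field scale_vec4 !mulr0.
  apply: is_derive_vec4.
  - have := is_deriveZ (q 0 2) (is_deriveB (is_derive_mulr h.1 (is_derive_cos s))
      (is_derive_mulr h.2 (is_derive_sin s))).
    by apply: is_derive_ext => [//|]; rewrite /GRing.scale/=; ring.
  - have := is_deriveZ (q 0 2) (is_deriveD (is_derive_mulr h.2 (is_derive_cos s))
      (is_derive_mulr h.1 (is_derive_sin s))).
    by apply: is_derive_ext => [//|]; rewrite /GRing.scale/=; ring.
have t1 : 0 < `|t| + 1 by rewrite ltr_wpDl.
exists (- (`|t| + 1)), (`|t| + 1), 0, t, g; split => //.
- split=> s _.
    split; first by apply/ellipsoid_embed => //; exact: rotate_pair_unit.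
      by have [] := dg s.
    rewrite derive1E; have [_ ->] := dg s; apply/middle_line => //.
      exact: rotate_pair_unit.
    split => //; last by exists (q 0 2).
    by rewrite scaler_eq0 negb_or q2 rotation_field_neq0//; exact: rotate_pair_unit.
  have -> : derive1 g = fun s => q 0 2 *: rotation_field (rotate_pair h s).
    by apply/funext => s'; rewrite derive1E; have [_ ->] := dg s'.
  apply: continuous_scale.
  apply: (@continuous_vec4 _ _ (fun=> 0) (fun=> 0)
    (fun s => - (cos s * h.2 + sin s * h.1)) (fun s => cos s * h.1 + - (sin s * h.2))).
  + exact: cvg_cst.
  + exact: cvg_cst.
  + apply: continuous_oppr; apply: continuous_addr; apply: continuous_mulr.
      exact: continuous_cos.
    exact: continuous_sin.
  + apply: continuous_addr; last apply: continuous_oppr.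
      by apply: continuous_mulr; exact: continuous_cos.
    by apply: continuous_mulr; exact: continuous_sin.
- by rewrite oppr_lt0 t1.
- by rewrite -ltr_norml ltrDl.
- rewrite /g; congr (embed _ _); rewrite /rotate_pair cos0 sin0 !mul0r !mul1r subr0 addr0.
  by case: (h).
Qed.

Lemma middle_leaf_circle p : ellipsoid s4 p -> ~ E0 a b p ->
  is_circle (leaf (ellipsoid s4) (principal_line s4 (inord 1)) p).
Proof.
move=> pE nE0; have [h [q [hu pq q2 qE]]] := ellipsoid_sheet pE.
have q20 : q 0 2 != 0.
  by apply/eqP => q20; apply: nE0; rewrite pq; apply/(E0_embed hu qE).
rewrite pq middle_leaf//.
exists (vec4 (q 0 0) (q 0 1) 0 0), (vec4 0 0 h.1 h.2), (rotation_field h), (q 0 2); split.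
- by rewrite lt0r q20.
- by rewrite -[RHS]hu dot_vec4 !vec4E; ring.
- by rewrite -[RHS]hu dot_vec4 !vec4E; ring.
- by rewrite dot_vec4 !vec4E; ring.
- congr (_ @` _); apply/funext => t; rewrite /rotation_field !scale_vec4 !addr_vec4 /embed /=.
  by apply/vec4_inj; split; ring.
Qed.

End Pencil.

(** * Extension of the line fields across E0 *)

Lemma row_norm_lt (R : realType) (n : nat) (v : 'rV[R]_n) (e : R) :
  0 < e -> (forall i, `|v 0 i| < e) -> `|v| < e.
Proof.
move=> e0 ve; rewrite [ltLHS]/Num.Def.normr/= mx_normrE.
by apply/bigmax_ltP; split => // -[i j] _ /=; rewrite ord1.
Qed.

Lemma embed_norm (R : realType) (h : R * R) (v : 'rV[R]_3) :
  unit_pair h -> `|embed h v| <= `|v|.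
Proof.
move=> hu; have [h1 h2] : `|h.1| <= 1 /\ `|h.2| <= 1.
  by move: hu; rewrite /unit_pair => hu'; split; rewrite ler_norml;
    apply/andP; split; nra.
rewrite [leLHS]/Num.Def.normr/= mx_normrE; apply: bigmax_le => // -[i j] _ /=.
rewrite ord1; case: (ord4_cases j) => ->; rewrite vec4E ?coord_norm// normrM.
  by rewrite (le_trans _ (coord_norm v 2))// ler_piMr.
by rewrite (le_trans _ (coord_norm v 2))// ler_piMr.
Qed.

(** A continuous linear map which respects the line fields maps integral curves
    to integral curves; linearity enters through the rule of derivation only. *)
Section LeafTransfer.
Variables (R : realType) (m n : nat).
Variables (X : set 'rV[R]_m.+1) (Y : set 'rV[R]_n.+1).
Variables (L : line_field R m) (L' : line_field R n).
Variable phi : 'rV[R]_m.+1 -> 'rV[R]_n.+1.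
Hypothesis phi_continuous : continuous phi.
Hypothesis phi_derive : forall (g : R -> 'rV[R]_m.+1) (t : R) d,
  is_derive t 1 g d -> is_derive t 1 (fun t => phi (g t)) (phi d).
Hypothesis phiXY : forall x, X x -> Y (phi x).
Hypothesis phiLL' : forall x v, X x -> L x v -> L' (phi x) (phi v).

Lemma leaf_transfer p x : leaf X L p x -> leaf Y L' (phi p) (phi x).
Proof.
move=> [al [be [t0 [t1 [g [[gL gc] t0I t1I <- <-]]]]]].
have dphi t : al < t < be -> derive1 (fun t => phi (g t)) t = phi (derive1 g t).
  move=> /gL[_ dg _]; rewrite !derive1E.
  by have [_ ->] := phi_derive (derivableP dg).
exists al, be, t0, t1, (fun t => phi (g t)); split => //; split=> t tI.
  have [gX dg Lg] := gL t tI; split; [exact: phiXY| |].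
    by have [] := phi_derive (derivableP dg).
  by rewrite dphi//; exact: phiLL'.
rewrite /prop_for /continuous_at dphi//.
have : phi (derive1 g x) @[x --> t] --> phi (derive1 g t).
  by apply: continuous_comp; [exact: gc|exact: phi_continuous].
apply: cvg_trans; apply: near_eq_cvg.
have : t \in `]al, be[ by rewrite in_itv.
by move/near_in_itvoo; apply: filterS => u; rewrite in_itv/= => /dphi.
Qed.

End LeafTransfer.

Section Restricted.
Variables (R : realType) (a b c : R).
Hypotheses (b0 : 0 < b) (bc : b < c) (ca : c < a).

Let c0 : 0 < c. Proof. exact: lt_trans bc. Qed.
Let a0 : 0 < a. Proof. exact: lt_trans ca. Qed.

Local Notation s3 := (vec3 a b c).
Local Notation line_data := (line_data a b c).
Local Notation crit := (umbilic_sign a b c).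

(** Rotate the ellipse r = 0 towards the last axis. *)
Lemma interior_near q (U : set 'rV[R]_3) : ellipsoid s3 q -> q 0 2 = 0 ->
  nbhs q U -> exists q', [/\ U q', ellipsoid s3 q' & 0 < q' 0 2].
Proof.
move=> /ellipsoid3E qE q2 qU.
pose g (t : R) := vec3 (q 0 0 * cos t) (q 0 1 * cos t) (c * sin t).
have gc : {for 0, continuous g}.
  apply: (@continuous_vec3 _ _ (fun t => q 0 0 * cos t) (fun t => q 0 1 * cos t)
    (fun t => c * sin t)); apply: continuous_mul; try exact: cvg_cst;
    by [exact: continuous_cos|exact: continuous_sin].
have g0 : g 0 = q.
  by rewrite /g cos0 sin0 !mulr1 mulr0 [RHS]vec3_eta q2.
have : \forall t \near (0 : R), U (g t) by apply: gc; rewrite g0.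
move=> /nbhs_ballP[e /= e0 He]; pose t := Num.min (e / 2) 1.
have t0 : 0 < t by rewrite lt_min ltr01 divr_gt0.
exists (g t); split.
- apply: He; rewrite /ball/= sub0r normrN gtr0_norm//.
  by rewrite gt_min ltr_pdivrMr// ltr_pMr// ltr1n.
- apply/ellipsoid3E; rewrite !vec3E.
  have -> : (q 0 0 * cos t / a) ^+ 2 + (q 0 1 * cos t / b) ^+ 2 + (c * sin t / c) ^+ 2
     = ((q 0 0 / a) ^+ 2 + (q 0 1 / b) ^+ 2) * cos t ^+ 2 + sin t ^+ 2.
    by field; rewrite !gt_eqF.
  move: qE; rewrite q2 mul0r expr0n/= addr0 => ->.
  by rewrite mul1r cos2Dsin2.
- rewrite vec3E mulr_gt0// sin_gt0_pi// t0/=.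
  by rewrite (le_lt_trans _ (lt_le_trans (ltr1n _ 2 : 1 < 2) (pi_ge2 R)))// ge_min lexx orbT.
Qed.

(** Moving along the ellipse from an umbilic point, umbilic_sign has a nonzero
    derivative, hence takes both signs; in the parameter t it is sin t times a
    factor G that does not vanish at t = 0. *)
Lemma umbilic_sides q (U : set 'rV[R]_3) : ellipsoid s3 q -> q 0 2 = 0 ->
  crit q = 0 -> nbhs q U -> forall sg : R, sg ^+ 2 = 1 ->
  exists q', [/\ U q', ellipsoid s3 q', q' 0 2 = 0 & 0 < sg * crit q'].
Proof.
move=> /ellipsoid3E qE q2 k0 qU sg sg1.
pose X := q 0 0 / a; pose Y := q 0 1 / b.
have XY : X ^+ 2 + Y ^+ 2 = 1 by rewrite -qE q2 mul0r expr0n/= addr0.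
have xE : q 0 0 = a * X by rewrite mulrC divfK// gt_eqF.
have yE : q 0 1 = b * Y by rewrite mulrC divfK// gt_eqF.
have ab : 0 < a ^+ 2 - b ^+ 2.
  by rewrite subr_gt0 ltr_pXn2r// ?nnegrE ?ltW// (lt_trans bc).
have ac : 0 < a ^+ 2 - c ^+ 2 by rewrite subr_gt0 ltr_pXn2r// ?nnegrE ltW.
have cb : 0 < c ^+ 2 - b ^+ 2 by rewrite subr_gt0 ltr_pXn2r// ?nnegrE ltW.
have D0 : 0 < (a ^+ 2 * b ^+ 2 * c ^+ 2)^-1 by rewrite invr_gt0 !mulr_gt0// exprn_gt0.
have critXY (x y : R) : x ^+ 2 + y ^+ 2 = 1 -> crit (vec3 (a * x) (b * y) 0) =
    ((a ^+ 2 - b ^+ 2) * x ^+ 2 - (a ^+ 2 - c ^+ 2)) / (a ^+ 2 * b ^+ 2 * c ^+ 2).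
  have an0 : a != 0 by rewrite gt_eqF. have bn0 : b != 0 by rewrite gt_eqF.
  move=> xy; rewrite umbilic_signE//; last by rewrite ![_ * _ / _]mulrAC !divff// !mul1r.
  by rewrite [_ * _ / a]mulrAC divff// mul1r.
have Xk : (a ^+ 2 - b ^+ 2) * X ^+ 2 = a ^+ 2 - c ^+ 2.
  move: k0; rewrite [q]vec3_eta q2 xE yE critXY// => /eqP.
  by rewrite mulf_eq0 (gt_eqF D0) orbF subr_eq0 => /eqP.
have Yk : (a ^+ 2 - b ^+ 2) * Y ^+ 2 = c ^+ 2 - b ^+ 2.
  by have -> : Y ^+ 2 = 1 - X ^+ 2 by [rewrite -XY; ring]; rewrite mulrBr Xk; ring.
have X0 : X != 0 by apply/eqP => X0; move: Xk ac; rewrite X0 expr0n/= mulr0 => <-; rewrite ltxx.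
have Y0 : Y != 0 by apply/eqP => Y0; move: Yk cb; rewrite Y0 expr0n/= mulr0 => <-; rewrite ltxx.
pose Xt t := X * cos t - Y * sin t; pose Yt t := Y * cos t + X * sin t.
have XYt t : Xt t ^+ 2 + Yt t ^+ 2 = 1.
  have -> : Xt t ^+ 2 + Yt t ^+ 2 = (X ^+ 2 + Y ^+ 2) * (cos t ^+ 2 + sin t ^+ 2).
    by rewrite /Xt /Yt; ring.
  by rewrite XY cos2Dsin2 mul1r.
pose g (t : R) := vec3 (a * Xt t) (b * Yt t) 0.
pose G (t : R) := - (2 * X * Y * cos t + (X ^+ 2 - Y ^+ 2) * sin t).
have critg t : crit (g t) = (a ^+ 2 - b ^+ 2) * (sin t * G t) / (a ^+ 2 * b ^+ 2 * c ^+ 2).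
  rewrite critXY// -Xk -mulrBr; congr (_ * _ / _).
  have -> : Xt t ^+ 2 - X ^+ 2 = Xt t ^+ 2 - X ^+ 2 * (cos t ^+ 2 + sin t ^+ 2).
    by rewrite cos2Dsin2 mulr1.
  by rewrite /Xt /G; ring.
have cXt : {for 0, continuous Xt}.
  apply: continuous_addr; last apply: continuous_oppr;
    apply: continuous_mul; try exact: cvg_cst;
    by [exact: continuous_cos|exact: continuous_sin].
have cYt : {for 0, continuous Yt}.
  apply: continuous_addr; apply: continuous_mul; try exact: cvg_cst;
    by [exact: continuous_cos|exact: continuous_sin].
have cG : {for 0, continuous G}.
  apply: continuous_oppr; apply: continuous_addr;
    apply: continuous_mul; try exact: cvg_cst;
    by [exact: continuous_cos|exact: continuous_sin].
have gc : {for 0, continuous g}.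
  apply: (@continuous_vec3 _ _ (fun t => a * Xt t) (fun t => b * Yt t) (fun=> 0));
   try exact: cvg_cst; by apply: continuous_mul => //; exact: cvg_cst.
have g0 : g 0 = q.
  rewrite /g /Xt /Yt cos0 sin0 !mulr1 !mulr0 subr0 addr0 [RHS]vec3_eta q2 -xE -yE.
  by [].
have G0 : G 0 != 0.
  rewrite /G cos0 sin0 mulr1 mulr0 addr0 oppr_eq0.
  by apply: mulf_neq0 => //; apply: mulf_neq0 => //; rewrite pnatr_eq0.
have U0 : \forall t \near (0 : R), U (g t) by apply: gc; rewrite g0.
have G1 : \forall t \near (0 : R), 0 < G 0 * G t.
  have cGG : {for 0, continuous (fun t => G 0 * G t)}.
    by apply: continuous_mul => //; exact: cvg_cst.
  apply: (cvgr_gt _ cGG).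
  by rewrite -expr2 lt0r sqr_ge0 sqrf_eq0 G0.
have [e /= e0 He] : exists2 e : R, 0 < e & forall t, `|t| < e -> U (g t) /\ 0 < G 0 * G t.
  have /nbhs_ballP[e /= e0 He] : \forall t \near (0 : R), U (g t) /\ 0 < G 0 * G t.
    by near=> t; split; near: t.
  by exists e => // t te; apply: He; rewrite /ball/= sub0r normrN.
pose d := Num.min (e / 2) 1.
have d0 : 0 < d by rewrite lt_min ltr01 divr_gt0.
have de : d < e by rewrite gt_min ltr_pdivrMr// ltr_pMr// ltr1n.
have sd : 0 < sin d.
  apply: sin_gt0_pi; rewrite d0/=.
  by rewrite (le_lt_trans _ (lt_le_trans (ltr1n _ 2 : 1 < 2) (pi_ge2 R)))// ge_min lexx orbT.
have gE t : ellipsoid s3 (g t).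
  have an0 : a != 0 by rewrite gt_eqF. have bn0 : b != 0 by rewrite gt_eqF.
  apply/ellipsoid3E; rewrite !vec3E mul0r expr0n/= addr0.
  by rewrite ![_ * _ / _]mulrAC !divff// !mul1r XYt.
have main t : `|t| < e -> 0 < sg * (sin t * G 0) ->
    exists q', [/\ U q', ellipsoid s3 q', q' 0 2 = 0 & 0 < sg * crit q'].
  move=> /He[Ut Gt] st; exists (g t); split => //; first by rewrite vec3E.
  rewrite critg mulrA pmulr_lgt0// mulrCA pmulr_rgt0//.
  have : 0 < (sg * (sin t * G 0)) * (G 0 * G t) by rewrite mulr_gt0.
  have -> : sg * (sin t * G 0) * (G 0 * G t) = G 0 ^+ 2 * (sg * (sin t * G t)) by ring.
  by rewrite pmulr_rgt0// lt0r sqr_ge0 sqrf_eq0 G0.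
have sg0 : sg * G 0 != 0.
  by rewrite mulf_neq0// -sqrf_eq0 sg1 oner_eq0.
have [s0|s0] := ltP 0 (sg * G 0).
  by apply: (main d); rewrite ?gtr0_norm// mulrCA mulr_gt0.
apply: (main (- d)); rewrite ?normrN ?gtr0_norm// sinN mulNr mulrN mulrCA -mulrN.
by rewrite mulr_gt0// oppr_gt0 lt_neqAle sg0.
Unshelve. all: by end_near. Qed.

End Restricted.

Lemma continuous_norm (R : realType) (T : topologicalType) (x : T -> R) (q : T) :
  {for q, continuous x} -> {for q, continuous (fun t => `|x t|)}.
Proof. by move=> cx; apply: cvg_norm. Qed.

Lemma small_eq0 (R : realType) (x K : R) :
  (forall e : R, 0 < e -> e <= 2^-1 -> `|x| <= e * K) -> x = 0.
Proof.
move=> xK; apply/eqP; rewrite -normr_le0; apply/ler_addgt0Pl => d d0.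
rewrite addr0; pose e := Num.min (2^-1) (d / (`|K| + 1)).
have K1 : 0 < `|K| + 1 by rewrite ltr_wpDl.
have e0 : 0 < e by rewrite lt_min invr_gt0 ltr0n divr_gt0.
apply: le_trans (xK e e0 _) _; first by rewrite ge_min lexx.
apply: le_trans (_ : e * (`|K| + 1) <= _).
  by rewrite ler_wpM2l ?(ltW e0)// (le_trans (ler_norm K))// lerDl.
by rewrite -ler_pdivlMr// ge_min lexx orbT.
Qed.

Section Extension.
Variables (R : realType) (a b c : R).
Hypotheses (b0 : 0 < b) (bc : b < c) (ca : c < a).

Let c0 : 0 < c. Proof. exact: lt_trans bc. Qed.
Let a0 : 0 < a. Proof. exact: lt_trans ca. Qed.

Local Notation s3 := (vec3 a b c).
Local Notation s4 := (vec4 a b c c).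
Local Notation A := (a ^- 2).
Local Notation B := (b ^- 2).
Local Notation C := (c ^- 2).
Local Notation line_data := (line_data a b c).
Local Notation crit := (umbilic_sign a b c).
Local Notation sgn := (@sgnb R).

(** Let s be the product of (v0,v1) with (-n1,n0).  Tangency says that the
    product with (n0,n1) is - n2 v2, and the elimination of t shows that
    s (K + (C - m) D) is a multiple of n2 v2.  As K and C - m do not have opposite
    signs, the factor of s is bounded away from zero by K alone, whatever m is.
    Near r = 0, n2 is small and the eigenvector is close to the last axis. *)
Lemma eigenvector_estimate (sg m v0 v1 v2 t n0 n1 n2 : R) :
  let K := (B - C) * n0 ^+ 2 - (C - A) * n1 ^+ 2 in
  let D := n0 ^+ 2 + n1 ^+ 2 in
  `|sg| = 1 -> 0 < D -> 0 < sg * K -> 0 <= sg * (C - m) ->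
  n0 * v0 + n1 * v1 + n2 * v2 = 0 ->
  v0 * A = m * v0 + t * n0 -> v1 * B = m * v1 + t * n1 ->
  let G := `|n2| * ((`|n0| + `|n1|) * (1 + `|n0 * n1| * (B - A) / (sg * K)) / D) in
  `|v0| <= G * `|v2| /\ `|v1| <= G * `|v2|.
Proof.
move=> K D sg1 D0 K0 Cm E E0 E1 G.
have BA : 0 < B - A.
  by rewrite subr_gt0 (lt_trans (ltAC b0 bc ca))// (ltCB b0 bc).
pose s := n0 * v1 - n1 * v0.
have E01 : (B - m) * (n0 * v1) - (A - m) * (n1 * v0) = 0.
  have -> : (B - m) * (n0 * v1) - (A - m) * (n1 * v0) =
    n0 * (v1 * B - m * v1) - n1 * (v0 * A - m * v0) by ring.
  by rewrite E0 E1; ring.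
have Dv0 : D * v0 = - (n2 * v2 * n0 + s * n1).
  have -> : n2 * v2 = - (n0 * v0 + n1 * v1).
    by apply/eqP; rewrite -addr_eq0 addrC E.
  by rewrite /D /s; ring.
have Dv1 : D * v1 = - (n2 * v2 * n1 - s * n0).
  have -> : n2 * v2 = - (n0 * v0 + n1 * v1).
    by apply/eqP; rewrite -addr_eq0 addrC E.
  by rewrite /D /s; ring.
have sE : s * (K + (C - m) * D) = n0 * n1 * n2 * v2 * (B - A).
  have H : D * ((B - m) * (n0 * v1) - (A - m) * (n1 * v0)) = 0 by rewrite E01 mulr0.
  apply/eqP; rewrite -subr_eq0 -H; apply/eqP.
  have -> : D * ((B - m) * (n0 * v1) - (A - m) * (n1 * v0)) =
    (B - m) * n0 * (D * v1) - (A - m) * n1 * (D * v0) by ring.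
  by rewrite Dv0 Dv1 /K /D; ring.
have sK : `|s| * (sg * K) <= `|n0 * n1| * (B - A) * (`|n2| * `|v2|).
  have -> : `|n0 * n1| * (B - A) * (`|n2| * `|v2|) = `|n0 * n1 * n2 * v2 * (B - A)|.
    by rewrite !normrM (gtr0_norm BA); ring.
  rewrite -sE normrM ler_wpM2l//.
  have h1 : sg * K <= sg * (K + (C - m) * D).
    have -> : sg * (K + (C - m) * D) = sg * K + sg * (C - m) * D by ring.
    by rewrite lerDl mulr_ge0// ltW.
  by rewrite (le_trans h1)// (le_trans (ler_norm _))// normrM sg1 mul1r.
have sb : `|s| <= `|n2| * (`|n0 * n1| * (B - A) / (sg * K)) * `|v2|.
  have -> : `|n2| * (`|n0 * n1| * (B - A) / (sg * K)) * `|v2| =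
     (`|n0 * n1| * (B - A) * (`|n2| * `|v2|)) / (sg * K) by ring.
  by rewrite ler_pdivlMr.
move: sb; set L := `|n0 * n1| * (B - A) / (sg * K) => sb.
have L0 : 0 <= L.
  by apply: divr_ge0; [apply: mulr_ge0 => //; exact: ltW|exact: ltW].
have GE : G * `|v2| = (`|n2| * ((`|n0| + `|n1|) * (1 + L)) * `|v2|) / D.
  by rewrite /G -/L; ring.
have bound (x y z : R) : D * x = - (n2 * v2 * y + s * z) ->
    `|y| + `|z| = `|n0| + `|n1| -> `|x| <= G * `|v2|.
  move=> Dx yz; rewrite GE ler_pdivlMr// mulrC -{1}(gtr0_norm D0) -normrM Dx normrN.
  apply: le_trans (ler_normD _ _) _; rewrite !normrM.
  have h1 : `|s| * `|z| <= `|n2| * L * `|v2| * `|z| by rewrite ler_wpM2r.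
  apply: le_trans (lerD (lexx _) h1) _; rewrite -yz.
  have := normr_ge0 n2; have := normr_ge0 v2; have := normr_ge0 y; have := normr_ge0 z.
  move=> z0 y0 v20 n20.
  have h2 : 0 <= `|n2| * `|v2| * `|z| by rewrite !mulr_ge0.
  have h3 : 0 <= `|n2| * `|v2| * `|y| * L.
    by apply: mulr_ge0 => //; rewrite !mulr_ge0.
  have -> : `|n2| * ((`|y| + `|z|) * (1 + L)) * `|v2| =
    `|n2| * `|v2| * `|y| + `|n2| * L * `|v2| * `|z| + `|n2| * `|v2| * `|z|
    + `|n2| * `|v2| * `|y| * L by ring.
  by move: h2 h3; lra.
split; first exact: (bound v0 n0 n1).
apply: (bound v1 n1 (- n0)); first by rewrite mulrN.
by rewrite normrN addrC.
Qed.

Lemma sgnb_norm f : `|sgn f| = 1.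
Proof. by case: f; rewrite /= ?normrN normr1. Qed.

Lemma ld_neq f q m m' v : line_data f q m m' v -> m != C -> m != m'.
Proof.
move=> D mC; have [q2|/(ld_interior D)[]//] := eqVneq (q 0 2) 0.
have [k|k|k] := ltgtP (sgn f * crit q) 0.
- by have [] := ld_good D q2 k.
- by move: mC; have [->] := ld_bad D q2 k; rewrite eqxx.
- have k0 : crit q = 0.
    by move/eqP: k; rewrite mulf_eq0 -normr_eq0 sgnb_norm oner_eq0 => /eqP.
  by move: mC; have [->] := ld_umbilic D q2 k0; rewrite eqxx.
Qed.

(** The bound of eigenvector_estimate is a continuous function of the
    point which vanishes at q0. *)
Lemma bad_side_limit f (q0 : 'rV[R]_3) (eps : R) :
  q0 0 2 = 0 -> 0 < sgn f * crit q0 -> 0 < eps ->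
  \forall q \near q0, forall m m' v, line_data f q m m' v -> m != C ->
    exists2 k, k != 0 & `|k *: v - vec3 0 0 1| < eps.
Proof.
move=> q2 k0 eps0.
pose n0 (q : 'rV[R]_3) := q 0 0 * A; pose n1 (q : 'rV[R]_3) := q 0 1 * B.
pose n2 (q : 'rV[R]_3) := q 0 2 * C.
pose D q := n0 q ^+ 2 + n1 q ^+ 2.
pose G q := `|n2 q| * ((`|n0 q| + `|n1 q|) *
  (1 + `|n0 q * n1 q| * (B - A) / (sgn f * crit q)) / D q).
have cn0 : {for q0, continuous n0} by apply: continuous_mulr; exact: row_coord_continuous.
have cn1 : {for q0, continuous n1} by apply: continuous_mulr; exact: row_coord_continuous.
have cn2 : {for q0, continuous n2} by apply: continuous_mulr; exact: row_coord_continuous.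
have ccst (k : R) : {for q0, continuous (fun _ : 'rV[R]_3 => k)}.
  exact: cst_continuous.
have csq (x : 'rV[R]_3 -> R) : {for q0, continuous x} ->
    {for q0, continuous (fun q => x q ^+ 2)}.
  by move=> cx; exact: (continuous_mul cx cx).
have cD : {for q0, continuous D}.
  by apply: continuous_addr; exact: csq.
have ck : {for q0, continuous (fun q => sgn f * crit q)}.
  apply: continuous_mul => //.
  by apply: continuous_addr; last apply: continuous_oppr;
    apply: continuous_mul => //; exact: csq.
have D0 : 0 < D q0.
  rewrite lt0r addr_ge0 ?sqr_ge0// andbT; apply/negP.
  rewrite paddr_eq0 ?sqr_ge0// !sqrf_eq0 => /andP[/eqP n0E /eqP n1E].
  move: k0; rewrite /umbilic_sign -/(n0 q0) -/(n1 q0) n0E n1E expr0n/= !mulr0 subr0 mulr0.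
  by rewrite ltxx.
have cG : {for q0, continuous G}.
  apply: continuous_mul; first exact: continuous_norm.
  apply: continuous_mul; last by apply: continuous_inv => //; rewrite gt_eqF.
  apply: continuous_mul.
    by apply: continuous_addr; exact: continuous_norm.
  apply: continuous_addr => //; apply: continuous_mul.
    by apply: continuous_mulr; apply: continuous_norm; exact: continuous_mul.
  by apply: continuous_inv => //; rewrite gt_eqF.
have G0 : G q0 = 0 by rewrite /G /n2 q2 mul0r normr0 mul0r.
near=> q; move=> m m' v L mC.
have kq : 0 < sgn f * crit q by near: q; exact: (cvgr_gt _ ck).
have Dq : 0 < D q by near: q; exact: (cvgr_gt _ cD).
have Gq : G q < eps by near: q; apply: (cvgr_lt _ cG); rewrite G0.
have [pv [t]] := ld_eigen L.
rewrite (vec3_eta v) (vec3_eta q) !conormal_vec3 !scale_vec3 addr_vec3.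
move=> /vec3_inj[E0 E1 E2]; move: pv.
rewrite [X in dot _ X](vec3_eta v) (vec3_eta q) conormal_vec3 dot_vec3 !vec3E => pv.
have [H0 H1] := @eigenvector_estimate (sgn f) m _ _ _ t (n0 q) (n1 q) (n2 q)
  (sgnb_norm f) Dq kq (ld_le L) pv E0 E1.
have v2 : v 0 2 != 0.
  apply/eqP => v2; move: H0 H1; rewrite v2 normr0 mulr0 !normr_le0 => /eqP v0 /eqP v1.
  by move: (ld_neq0 L); rewrite (vec3_eta v) v0 v1 v2 -vec3_0 eqxx.
have v2' : 0 < `|v 0 2| by rewrite normr_gt0.
exists (v 0 2)^-1; first (by rewrite invr_eq0); apply: row_norm_lt => // i; rewrite (vec3_eta v) scale_vec3.
case: (ord3_cases i) => ->; rewrite !mxE/= ?subr0 ?mulVf ?subrr ?normr0//.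
- rewrite normrM normfV mulrC ltr_pdivrMr//; apply: le_lt_trans H0 _.
  by rewrite ltr_pM2r.
- rewrite normrM normfV mulrC ltr_pdivrMr//; apply: le_lt_trans H1 _.
  by rewrite ltr_pM2r.
Unshelve. all: by end_near. Qed.

(** Here w is a vector that is within e of the lines at the points of V; the
    lemmas of this section confine w in terms of e, and are applied for all
    small e. *)
Section Limits.
Variables (h : R * R) (f : bool) (V : set 'rV[R]_4) (w : 'rV[R]_4) (e : R).
Hypotheses (hu : unit_pair h) (e0 : 0 < e) (e1 : e <= 2^-1).
Hypothesis wV : forall p, V p -> sheet a b c h p ->
  principal_line s4 (idx3 f) p !=set0 ->
  exists2 u, principal_line s4 (idx3 f) p u & `|u - w| < e.

Let h12 : `|h.1| <= 1 /\ `|h.2| <= 1.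
Proof.
by move: hu; rewrite /unit_pair => hu'; split; rewrite ler_norml;
  apply/andP; split; nra.
Qed.

Lemma limit_line q m m' v : ellipsoid s3 q -> V (embed h q) ->
  line_data f q m m' v -> m != C ->
  exists k, `|k *: embed h v - w| < e.
Proof.
move=> qE Vq L mC.
have [||u /(ld_line4 L hu)[_ _ [k ->]] uw] := wV Vq; last by exists k.
  by exists q.
exists (embed h v); apply/(ld_line4 L hu); split => //.
  by rewrite embed_eq0// (ld_neq0 L).
by exists 1; rewrite scale1r.
Qed.

(** On a good arc the line is tangent to E0, which has no component in the
    (z,w)-plane. *)
Lemma good_limit q : ellipsoid s3 q -> q 0 2 = 0 -> sgn f * crit q < 0 ->
  V (embed h q) -> `|w 0 2| <= e /\ `|w 0 3| <= e.
Proof.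
move=> qE q2 k0 Vq; have [m [m' [v L]]] := line_data_exists b0 bc ca f qE.
have [mC _ vE] := ld_good L q2 k0.
have [k kw] := limit_line qE Vq L mC.
have wi i : (k *: embed h v) 0 i = 0 -> `|w 0 i| <= e.
  move=> i0; apply: le_trans (ltW kw).
  by have := coord_norm (k *: embed h v - w) i; rewrite !mxE in i0 *; rewrite i0 sub0r normrN.
by split; apply: wi; rewrite mxE vec4E vE vec3E mul0r mulr0.
Qed.

(** Near a bad arc the lines are almost the last axis of the sheet.  As w is
    close to such a line, its x and y components are small and its component
    along h carries almost all of its length. *)
Lemma bad_limit q : ellipsoid s3 q -> q 0 2 = 0 -> 0 < sgn f * crit q ->
  nbhs (embed h q) V ->
  [/\ `|w 0 0| <= e * (4 * `|w| + 5), `|w 0 1| <= e * (4 * `|w| + 5) &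
     `|w 0 2 * h.2 - w 0 3 * h.1| <= e * 2].
Proof.
move=> qE q2 k0 nV; have [h1 h2] := h12.
have nU : \forall q' \near q, V (embed h q') /\
    (forall m m' v, line_data f q' m m' v -> m != C ->
      exists2 k, k != 0 & `|k *: v - vec3 0 0 1| < e).
  have H1 : \forall q' \near q, V (embed h q') := embed_continuous nV.
  have H2 := bad_side_limit q2 k0 e0.
  by apply: filterS2 H1 H2.
have [q' [[Vq' Lq'] q'E q'2]] := interior_near b0 bc ca qE q2 nU.
have [m [m' [v L]]] := line_data_exists b0 bc ca f q'E.
have [mC _] := ld_interior L (lt0r_neq0 q'2).
have [k kw] := limit_line q'E Vq' L mC.
have [k' k'0 k'v] := Lq' _ _ _ L mC.
pose y := k' *: v.
have yi i : `|y 0 i - vec3 0 0 1 0 i| <= e.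
  by have := coord_norm (y - vec3 0 0 1) i; rewrite !mxE => H; apply: le_trans H (ltW k'v).
have y0 : `|y 0 0| <= e by have := yi 0; rewrite vec3E subr0.
have y1 : `|y 0 1| <= e by have := yi 1; rewrite vec3E subr0.
have y2 : 2^-1 <= y 0 2.
  have := yi 2; rewrite vec3E ler_norml => /andP[H _].
  by move: H e1; lra.
pose u := k *: embed h v; pose ka := k / k'.
have uE : u = ka *: embed h y.
  by rewrite /u /y embedZ scalerA divfK.
have ui i : `|u 0 i - w 0 i| <= e.
  by have := coord_norm (u - w) i; rewrite !mxE => H; apply: le_trans H (ltW kw).
have un : `|u| <= `|w| + 1.
  rewrite -(subrK w u); apply: le_trans (ler_normD _ _) _; rewrite addrC lerD2l.
  by apply: le_trans (ltW kw) _; move: e1; lra.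
have u0 : u 0 0 = ka * y 0 0 by rewrite uE mxE vec4E.
have u1 : u 0 1 = ka * y 0 1 by rewrite uE mxE vec4E.
have u2 : u 0 2 = ka * (y 0 2 * h.1) by rewrite uE mxE vec4E.
have u3 : u 0 3 = ka * (y 0 2 * h.2) by rewrite uE mxE vec4E.
have kab : `|ka| <= 4 * (`|w| + 1).
  have : `|ka * y 0 2| <= `|u 0 2| + `|u 0 3|.
    have -> : ka * y 0 2 = u 0 2 * h.1 + u 0 3 * h.2.
      rewrite u2 u3 -[LHS]mulr1 -hu; ring.
    apply: le_trans (ler_normD _ _) _; rewrite !normrM.
    by apply: lerD; rewrite ler_piMr.
  have y2' : 0 <= y 0 2 by apply: le_trans y2; rewrite invr_ge0.
  rewrite normrM (ger0_norm y2').
  have := coord_norm u 2; have := coord_norm u 3; have := normr_ge0 ka.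
  move: un y2; nra.
have main (x : R) (i : 'I_4) : `|x| <= e -> u 0 i = ka * x -> `|w 0 i| <= e * (4 * `|w| + 5).
  move=> xe uix; have := ui i; rewrite uix => H.
  have : `|w 0 i| <= `|ka * x| + e.
    rewrite -[w 0 i](subKr (ka * x)).
    by apply: le_trans (ler_normB _ _) _; rewrite lerD2l.
  rewrite normrM; have := normr_ge0 ka; have := normr_ge0 x.
  move: e0 kab; nra.
split; [exact: (main _ 0 y0)|exact: (main _ 1 y1)|].
have -> : w 0 2 * h.2 - w 0 3 * h.1 = (u 0 3 - w 0 3) * h.1 - (u 0 2 - w 0 2) * h.2.
  by rewrite u2 u3; ring.
apply: le_trans (ler_normB _ _) _; rewrite !normrM mulr2n mulrDr mulr1.
apply: lerD.
  by apply: le_trans (ui 3); rewrite ler_piMr.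
by apply: le_trans (ui 2); rewrite ler_piMr.
Qed.

End Limits.

End Extension.

(** * Principal equivalence of a sheet with a surface of R^3 *)

Section Equivalence.
Variables (R : realType) (a b c : R).
Hypotheses (b0 : 0 < b) (bc : b < c) (ca : c < a).

Let c0 : 0 < c. Proof. exact: lt_trans bc. Qed.
Let a0 : 0 < a. Proof. exact: lt_trans ca. Qed.
Let p3 := axes3_gt0 b0 bc ca.

Local Notation s3 := (vec3 a b c).
Local Notation s4 := (vec4 a b c c).
Local Notation C := (c ^- 2).
Local Notation line_data := (line_data a b c).
Local Notation crit := (umbilic_sign a b c).
Local Notation sgn := (@sgnb R).
Local Notation sheet := (sheet a b c).

Lemma sgn_sqr f : sgn f ^+ 2 = 1.
Proof. by case: f; rewrite /= ?sqrrN expr1n. Qed.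

(** If the line is defined in R^4 it is the image of the line of the surface.
    Otherwise the point lies on E0.  On a bad arc the lines at neighbouring
    points converge to the last axis, which is the line of the surface; at an
    umbilic point a limit would be at once tangent to E0 and normal to it, and
    the surface has no line there either. *)
Lemma restricted_lineE h f q w : unit_pair h -> ellipsoid s3 q ->
  restricted_line (sheet h) (principal_line s4 (idx3 f)) (embed h q) w <->
  exists2 v, principal_line s3 (idx2 f) q v & w = embed h v.
Proof.
move=> hu qE; have [m [m' [v L]]] := line_data_exists b0 bc ca f qE.
have Sq : sheet h (embed h q) by exists q.
have [mC|mC] := eqVneq m C; last first.
  have mm' := ld_neq L mC.
  have Lv : principal_line s4 (idx3 f) (embed h q) (embed h v).
    apply/(ld_line4 L hu); split => //; first by rewrite embed_eq0// (ld_neq0 L).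
    by exists 1; rewrite scale1r.
  split=> [[_ [/(ld_line4 L hu)[_ w0 [k wE]]|[L0]]]|[x /(ld_line3 L)[_ x0 [k xE]] ->]].
  - exists (k *: v); last by rewrite embedZ.
    apply/(ld_line3 L); split => //; last by exists k.
    by rewrite -(embed_eq0 _ hu) embedZ -wE.
  - by move: Lv; rewrite L0.
  - split => //; left; apply/(ld_line4 L hu); split => //; first by rewrite embed_eq0.
    by exists k; rewrite xE embedZ.
have q2 : q 0 2 = 0.
  by apply/eqP; apply: contraT => /(ld_interior L)[]; rewrite mC eqxx.
have L40 : principal_line s4 (idx3 f) (embed h q) = set0.
  by apply/seteqP; split=> // u /(ld_line4 L hu)[]; rewrite mC eqxx.
have [k|k|k] := ltgtP (sgn f * crit q) 0.
- by have [] := ld_good L q2 k; rewrite mC eqxx.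
- have [_ mm' vE] := ld_bad L q2 k.
  split.
    move=> [_ [|[_ w0 _ lim]]]; first by rewrite L40.
    have B e (e0 : 0 < e) (e1 : e <= 2^-1) := bad_limit b0 bc ca hu e0 e1
      (fun p Vp => Vp) qE q2 k (lim e e0).
    have w0E : w 0 0 = 0.
      by apply: (@small_eq0 _ _ (4 * `|w| + 5)) => e e0 e1; have [] := B e e0 e1.
    have w1E : w 0 1 = 0.
      by apply: (@small_eq0 _ _ (4 * `|w| + 5)) => e e0 e1; have [] := B e e0 e1.
    have w23 : w 0 2 * h.2 - w 0 3 * h.1 = 0.
      by apply: (@small_eq0 _ _ 2) => e e0 e1; have [] := B e e0 e1.
    pose z := w 0 2 * h.1 + w 0 3 * h.2.
    have wE : w = embed h (z *: v).
      rewrite vE scale_vec3 [LHS]vec4_eta /embed !vec3E w0E w1E mulr0 mulr1.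
      apply/vec4_inj; split => //.
        rewrite -[LHS]mulr1 -hu /z.
        have -> : w 0 2 * (h.1 ^+ 2 + h.2 ^+ 2) = (w 0 2 * h.1 + w 0 3 * h.2) * h.1
          + h.2 * (w 0 2 * h.2 - w 0 3 * h.1) by ring.
        by rewrite w23 mulr0 addr0.
      rewrite -[LHS]mulr1 -hu /z.
      have -> : w 0 3 * (h.1 ^+ 2 + h.2 ^+ 2) = (w 0 2 * h.1 + w 0 3 * h.2) * h.2
        - h.1 * (w 0 2 * h.2 - w 0 3 * h.1) by ring.
      by rewrite w23 mulr0 subr0.
    exists (z *: v) => //; apply/(ld_line3 L); split => //; last by exists z.
    by rewrite -(embed_eq0 _ hu) -wE; apply/eqP.
  move=> [x /(ld_line3 L)[_ x0 [l xE]] ->]; split => //; right; split => //.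
  + by apply/eqP; rewrite embed_eq0.
  + move=> U nU; have nU' : \forall q' \near q, U (embed h q') := embed_continuous nU.
    have [q' [Uq' q'E q'2]] := interior_near b0 bc ca qE q2 nU'.
    have [n [n' [y M]]] := line_data_exists b0 bc ca f q'E.
    have [nC _] := ld_interior M (lt0r_neq0 q'2).
    exists (embed h q'); split => //; split; first by exists q'.
    exists (embed h y); apply/(ld_line4 M hu); split => //.
      by rewrite embed_eq0// (ld_neq0 M).
    by exists 1; rewrite scale1r.
  + move=> e e0.
    have l0 : l != 0 by apply: contra_neq x0 => l0; rewrite xE l0 scale0r.
    have l0' : 0 < `|l| by rewrite normr_gt0.
    have el0 : 0 < e / `|l| by rewrite divr_gt0.
    pose P q' := forall m m' v, line_data f q' m m' v -> m != C ->
      exists2 k, k != 0 & `|k *: v - vec3 0 0 1| < e / `|l|.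
    have H0 : \forall q' \near fold h (embed h q), P q'.
      by rewrite embedK//; exact: bad_side_limit.
    have H1 : \forall p \near embed h q, P (fold h p) := fold_continuous H0.
    apply: filterS H1 => p Hp [q' q'E pq] [u Lu]; rewrite -pq in Lu Hp *.
    move: Hp; rewrite /= embedK// => Hq'.
    have [n [n' [y M]]] := line_data_exists b0 bc ca f q'E.
    have [nC _ _] := (ld_line4 M hu u).1 Lu.
    have [k' k'n0 k'y] := Hq' _ _ _ M nC.
    exists (embed h (l *: (k' *: y))).
      apply/(ld_line4 M hu); split => //; last by exists (l * k'); rewrite scalerA embedZ.
      by rewrite embed_eq0// !scaler_eq0 !negb_or l0 k'n0 (ld_neq0 M).
    rewrite xE vE; have -> : embed h (l *: (k' *: y)) - embed h (l *: vec3 0 0 1) =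
       embed h (l *: (k' *: y - vec3 0 0 1)).
      by rewrite scalerBr embedB.
    apply: le_lt_trans (embed_norm _ hu) _; rewrite normrZ mulrC.
    by rewrite -ltr_pdivlMr.
- have k0 : crit q = 0.
    by move/eqP: k; rewrite mulf_eq0 -normr_eq0 sgnb_norm oner_eq0 => /eqP.
  have [_ m'C] := ld_umbilic L q2 k0.
  split=> [|[x /(ld_line3 L)[]]]; last by rewrite mC m'C eqxx.
  move=> [_ [|[_ w0 _ lim]]]; first by rewrite L40.
  case: w0; suff [H0 H1 H2 H3] : [/\ w 0 0 = 0, w 0 1 = 0, w 0 2 = 0 & w 0 3 = 0].
    by rewrite (vec4_eta w) H0 H1 H2 H3 -vec4_0.
  have key e : 0 < e -> e <= 2^-1 -> [/\ `|w 0 0| <= e * (4 * `|w| + 5),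
      `|w 0 1| <= e * (4 * `|w| + 5), `|w 0 2| <= e * 1 & `|w 0 3| <= e * 1].
    move=> e0 e1; pose V : set 'rV[R]_4 := fun p => sheet h p ->
      principal_line s4 (idx3 f) p !=set0 ->
      exists2 u, principal_line s4 (idx3 f) p u & `|u - w| < e.
    have lime : nbhs (embed h q) V := lim e e0.
    have nV : \forall q' \near q, V° (embed h q').
      by apply: embed_continuous; exact: nbhs_interior.
    have sN : (- sgn f) ^+ 2 = 1 by rewrite sqrrN sgn_sqr.
    have [q' [Vq' q'E q'2 q'k]] := umbilic_sides b0 bc ca qE q2 k0 nV sN.
    have [q'' [Vq'' q''E q''2 q''k]] := umbilic_sides b0 bc ca qE q2 k0 nV (sgn_sqr f).
    have q'k' : sgn f * crit q' < 0 by rewrite -oppr_gt0 -mulNr.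
    have [G2 G3] := good_limit b0 bc ca hu (fun p Vp => Vp) q'E q'2 q'k'
      (interior_subset Vq').
    have [B0 B1 _] := bad_limit b0 bc ca hu e0 e1 (fun p Vp => Vp) q''E q''2 q''k Vq''.
    by rewrite mulr1.
  by split; apply: small_eq0 => e e0 e1; have [H0 H1 H2 H3] := key e e0 e1;
    [exact: H0|exact: H1|exact: H2|exact: H3].
Qed.

(** On the surface, either line is missing exactly when the two eigenvalues
    agree. *)
Lemma umbilics_line q f : ellipsoid s3 q ->
  umbilics s3 q <-> principal_line s3 (idx2 f) q = set0.
Proof.
move=> qE; have [m [m' [v [v' [evv /andP[mC Cm'] _ _]]]]] :=
  eigenpair_exists b0 bc ca qE.
have F := frame2 evv (le_trans mC Cm').
have nu0 : (enorm (conormal s3 q))^-1 != 0.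
  rewrite invr_eq0 gt_eqF// enorm_gt0// conormal_eq0//.
  exact: ellipsoid_neq0 qE.
have LE u := frame_principal_line p3 qE F (idx2 f) u.
split=> [[_ [k [/(frame_curvatures p3 qE F) -> keq]]]|L0].
  have mm' : m = m'.
    by have := keq ord0 ord_max; rewrite !list2E => /(mulIf nu0).
  have E i : list2 m m' i = m by case: (ord2E i) => ->; rewrite list2E.
  apply/seteqP; split=> // u /LE[H _ _].
  have [j jf] : exists j, j != idx2 f by case: (f); [exists ord_max|exists ord0].
  by have := H j jf; rewrite !E eqxx.
split => //; exists (fun i => list2 m m' i / enorm (conormal s3 q)).
split; first exact/(frame_curvatures p3 qE F).
have mm' : m = m'.
  apply: contrapT => /eqP mm'.
  suff : set0 (row (idx2 f) (\matrix_i list2 v v' i)) by [].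
  rewrite -L0; apply/LE; split; last by exists 1; rewrite scale1r.
    move=> j; case: (ord2E j) => ->; case: (f) => //=; rewrite !list2E//.
    by rewrite eq_sym.
  exact: (frame_neq0 F).
by move=> i j; case: (ord2E i) => ->; case: (ord2E j) => ->; rewrite !list2E ?mm'.
Qed.

Lemma axes3_injective : injective (s3 0).
Proof.
have ba := lt_trans bc ca.
move=> i j; case: (ord3_cases i) => ->; case: (ord3_cases j) => ->; rewrite !vec3E//;
  move=> /eqP; by rewrite ?(lt_eqF ba, gt_eqF ba, lt_eqF ca, gt_eqF ca, lt_eqF bc, gt_eqF bc).
Qed.

(** The maps embed h and fold h are linear, mutually inverse between the sheet
    and the surface, and exchange the line fields by restricted_lineE; the
    singular points are those where a line is missing. *)
Lemma sheet_equivalent h : unit_pair h ->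
  principally_equivalent (restricted_configuration s4 (sheet h))
    (ellipsoid_configuration s3).
Proof.
move=> hu; exists (fold h).
have L4 f q v : ellipsoid s3 q ->
    restricted_line (sheet h) (principal_line s4 (idx3 f)) (embed h q) v ->
    principal_line s3 (idx2 f) q (fold h v).
  by move=> qE /(restricted_lineE f v hu qE)[x Lx ->]; rewrite embedK.
have L3 f q v : ellipsoid s3 q -> principal_line s3 (idx2 f) q v ->
    restricted_line (sheet h) (principal_line s4 (idx3 f)) (embed h q) (embed h v).
  by move=> qE Lv; apply/(restricted_lineE f _ hu qE); exists v.
have leaves f p : sheet h p ->
    fold h @` leaf (sheet h) (restricted_line (sheet h) (principal_line s4 (idx3 f))) p =
    leaf (ellipsoid s3) (principal_line s3 (idx2 f)) (fold h p).
  move=> [q qE <-]; apply/seteqP; split=> [_ [x lx <-]|x].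
    apply: leaf_transfer lx.
    - exact: fold_continuous.
    - by move=> g t d; exact: is_derive_fold.
    - by move=> _ [y yE <-]; rewrite embedK.
    - by move=> _ u [y yE <-]; rewrite embedK//; exact: L4.
  rewrite embedK// => lx; exists (embed h x); last by rewrite embedK.
  apply: leaf_transfer lx.
  - exact: embed_continuous.
  - by move=> g t d; exact: is_derive_embed.
  - by move=> y yE; exists y.
  - by move=> y u yE; exact: L3.
split.
- exists (embed h); split.
  + by move=> _ [q qE <-]; rewrite embedK.
  + by move=> q qE; rewrite embedK//; split => //; exists q.
  + by apply: continuous_subspaceT; exact: fold_continuous.
  + by apply: continuous_subspaceT; exact: embed_continuous.
- exact: (leaves true).
- exact: (leaves false).
have sing f q : ellipsoid s3 q ->
    restricted_line (sheet h) (principal_line s4 (idx3 f)) (embed h q) = set0 <->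
    umbilics s3 q.
  move=> qE; rewrite (umbilics_line f qE); split=> L0; apply/seteqP; split=> // v.
    by move=> /(L3 _ _ _ qE); rewrite L0.
  by move=> /(L4 _ _ _ qE); rewrite L0.
apply/seteqP; split=> [_ [p [] [[q qE <-] L0] <-]|q qU].
- by rewrite embedK//; apply/(sing true).
- by rewrite embedK//; apply/(sing false).
have [qE _] := qU; exists (embed h q); last by rewrite embedK.
by left; split; [exists q|apply/(sing true)].
Qed.

End Equivalence.

(** * Smoothness of the functions generated by a given one *)

Section CkGenerated.
Variables (R : realType) (m : nat) (U : set 'rV[R]_m.+1).
Hypothesis openU : open U.

Lemma near_open p (P : 'rV[R]_m.+1 -> Prop) : U p ->
  (forall q, U q -> P q) -> \forall q \near p, P q.
Proof.
by move=> Up UP; apply: filterS UP _; exact: open_nbhs_nbhs.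
Qed.

Lemma Ck_ext (n k : nat) (f g : 'rV[R]_m.+1 -> 'rV[R]_n.+1) :
  (forall p, U p -> f p = g p) -> Ck k U f -> Ck k U g.
Proof.
elim: k f g => [|k IH] f g fg /= [cf df];
  have nfg p : U p -> \forall q \near p, f q = g q;
  do ?[by move=> Up; exact: near_open];
  (have cg p : U p -> {for p, continuous g};
    first by move=> Up; rewrite /prop_for /continuous_at -fg//;
      exact: (cvg_trans (near_eq_cvg (nfg p Up)) (cf p Up)));
  split => //.
move=> i; have [df1 df2] := df i.
split=> [p Up|].
  by apply: near_eq_derivable (df1 p Up); exact: nfg.
apply: IH df2 => p Up; apply: near_eq_derive; exact: nfg.
Qed.

(** If the partial derivatives of h are polynomials in h and the coordinates,
    so are those of every member of this algebra, which therefore consists of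
    smooth functions.  It contains the rational and radical expressions used
    below, for h the inverse of a denominator or of a radius. *)
Inductive generated (h : 'rV[R]_m.+1 -> R) : ('rV[R]_m.+1 -> R) -> Prop :=
| GenCst r : generated h (fun=> r)
| GenCoord i : generated h (fun q => q 0 i)
| GenExtra : generated h h
| GenAdd f g : generated h f -> generated h g -> generated h (fun q => f q + g q)
| GenMul f g : generated h f -> generated h g -> generated h (fun q => f q * g q).

Variable h : 'rV[R]_m.+1 -> R.
Hypothesis h_derive : forall i, exists2 d, generated h d &
  forall p, U p -> is_derive p (delta_mx 0 i) h (d p).
Hypothesis h_continuous : forall p, U p -> {for p, continuous h}.

Lemma generated_continuous f p : U p -> generated h f -> {for p, continuous f}.
Proof.
move=> Up; elim=> {f} [r|i||f g _ cf _ cg|f g _ cf _ cg].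
- exact: cst_continuous.
- exact: row_coord_continuous.
- exact: h_continuous.
- exact: continuous_addr.
- exact: continuous_mul.
Qed.

Lemma generated_derive f i : generated h f -> exists2 d, generated h d &
  forall p, U p -> is_derive p (delta_mx 0 i) f (d p).
Proof.
elim=> {f} [r|j||f g Gf [df Gdf Hf] Gg [dg Gdg Hg]|f g Gf [df Gdf Hf] Gg [dg Gdg Hg]].
- by exists (fun=> 0); [exact: GenCst|move=> p _; exact: is_derive_cst].
- exists (fun=> (delta_mx 0 i : 'rV[R]_m.+1) 0 j); first exact: GenCst.
  by move=> p _; exact: is_derive_coord.
- exact: h_derive.
- exists (fun q => df q + dg q); first exact: GenAdd.
  by move=> p Up; apply: is_deriveD; [exact: Hf|exact: Hg].
- exists (fun q => f q * dg q + df q * g q).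
    by apply: GenAdd; exact: GenMul.
  by move=> p Up; apply: is_derive_mul; [exact: Hf|exact: Hg].
Qed.

Lemma generated_Ck (n k : nat) (g : 'rV[R]_m.+1 -> 'rV[R]_n.+1) :
  (forall j, generated h (fun q => g q 0 j)) -> Ck k U g.
Proof.
have cont (f : 'rV[R]_m.+1 -> 'rV[R]_n.+1) : (forall j, generated h (fun q => f q 0 j)) ->
    forall p, U p -> {for p, continuous f}.
  by move=> Gf p Up; apply: continuous_rowP => j; exact: generated_continuous.
elim: k g => [|k IH] g Gg; split; [exact: cont|by []|exact: cont|] => i.
have /choice[d Hd] : forall j, exists d : 'rV[R]_m.+1 -> R, generated h d /\
    forall p, U p -> is_derive p (delta_mx 0 i) (fun q => g q 0 j) (d p).
  by move=> j; have [d Gd Hd] := generated_derive i (Gg j); exists d.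
have dg p : U p -> is_derive p (delta_mx 0 i) g (\row_j d j p).
  by move=> Up; apply/is_derive_rowP => j; rewrite mxE; have [_] := Hd j; exact.
split=> [p /dg[]//|].
apply: (@Ck_ext n k (fun p => \row_j d j p)); first by move=> p /dg[].
apply: IH => j; have [Gd _] := Hd j.
by rewrite (_ : (fun q => _) = d j)//; apply/funext => q; rewrite mxE.
Qed.

Lemma generated_smooth (n : nat) (X : set 'rV[R]_m.+1)
    (g : 'rV[R]_m.+1 -> 'rV[R]_n.+1) :
  X `<=` U -> (forall j, generated h (fun q => g q 0 j)) -> smooth X g.
Proof.
move=> XU Gg p Xp; exists U, g; split => //; first exact: XU.
by move=> k; exact: generated_Ck.
Qed.

Lemma GenOpp f : generated h f -> generated h (fun q => - f q).
Proof.
move=> Gf; have := GenMul (GenCst h (-1)) Gf.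
by rewrite (_ : (fun q => -1 * f q) = (fun q => - f q))//; apply/funext => q; rewrite mulN1r.
Qed.

Lemma generated_eq f g : f =1 g -> generated h f -> generated h g.
Proof. by move=> /funext ->. Qed.

End CkGenerated.

(** * The book structure *)

Lemma ord2_cases (i : 'I_2) : i = 0 \/ i = 1.
Proof. by move: i; apply: ord2P; [left|right]. Qed.

Lemma closure_ge0 (R : realType) (T : topologicalType) (g : T -> R) (D : set T)
    (p : T) : {for p, continuous g} -> (forall x, D x -> 0 <= g x) ->
  closure D p -> 0 <= g p.
Proof.
move=> cg gD Dp; rewrite leNgt; apply/negP => gp.
have [x [Dx]] := Dp _ (cvgr_lt _ cg 0 gp).
by rewrite /= ltNge gD.
Qed.

Section PlaneVectors.
Variable R : realType.

Definition vec2 (x y : R) : 'rV[R]_2 := \row_i nth 0 [:: x; y] i.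

Lemma vec2E x y : (vec2 x y 0 0 = x) * (vec2 x y 0 1 = y).
Proof. by rewrite !mxE. Qed.

Lemma vec2_eta (v : 'rV[R]_2) : v = vec2 (v 0 0) (v 0 1).
Proof. by apply/rowP; apply: ord2P; rewrite !vec2E. Qed.

Lemma vec2_inj x y x' y' : vec2 x y = vec2 x' y' <-> x = x' /\ y = y'.
Proof.
split=> [E|[-> ->]//].
have := (congr1 (fun v : 'rV_2 => v 0 0) E, congr1 (fun v : 'rV_2 => v 0 1) E).
by rewrite /= !vec2E => -[-> ->].
Qed.

Lemma dot_vec2 (u v : 'rV[R]_2) : dot u v = u 0 0 * v 0 0 + u 0 1 * v 0 1.
Proof.
rewrite /dot !big_ord_recr big_ord0 /= add0r; congr (_ + _);
  by congr (u 0 _ * v 0 _); apply: val_inj.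
Qed.

Definition pair_of (th : 'rV[R]_2) : R * R := (th 0 0, th 0 1).

Lemma unit_pair_of th : unit_circle R th <-> unit_pair (pair_of th).
Proof. by rewrite /unit_circle/= dot_vec2 -!expr2. Qed.

Lemma pair_ofK h : pair_of (vec2 h.1 h.2) = h.
Proof. by rewrite /pair_of !vec2E; case: h. Qed.

Lemma vec2_pair_of th : vec2 (pair_of th).1 (pair_of th).2 = th.
Proof. by rewrite [RHS]vec2_eta. Qed.

End PlaneVectors.

Section Book.
Variables (R : realType) (a b c : R).
Hypotheses (b0 : 0 < b) (bc : b < c) (ca : c < a).

Let c0 : 0 < c. Proof. exact: lt_trans bc. Qed.
Let a0 : 0 < a. Proof. exact: lt_trans ca. Qed.

Local Notation s3 := (vec3 a b c).
Local Notation s4 := (vec4 a b c c).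
Local Notation E := (ellipsoid s4).
Local Notation E0 := (E0 a b).
Implicit Types (h : R * R) (q : 'rV[R]_3).

Definition inv_radius (p : 'rV[R]_4) : R := (Num.sqrt (p 0 2 ^+ 2 + p 0 3 ^+ 2))^-1.

Definition angle (p : 'rV[R]_4) : 'rV[R]_2 :=
  vec2 (p 0 2 * inv_radius p) (p 0 3 * inv_radius p).

Definition off_axis : set 'rV[R]_4 := [set p | 0 < p 0 2 ^+ 2 + p 0 3 ^+ 2].

Let sq_continuous (i : 'I_4) : continuous (fun q : 'rV[R]_4 => q 0 i ^+ 2).
Proof.
move=> q; have ci := @row_coord_continuous _ _ i q.
exact: (continuous_mul ci ci).
Qed.

Let sum_continuous : continuous (fun q : 'rV[R]_4 => q 0 2 ^+ 2 + q 0 3 ^+ 2).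
Proof.
by move=> q; exact: (continuous_addr (@sq_continuous 2 q) (@sq_continuous 3 q)).
Qed.

Lemma open_off_axis : open off_axis.
Proof.
rewrite openE => p /= p0; exact: (cvgr_gt _ (@sum_continuous p) 0 p0).
Qed.

Lemma inv_radius_derive p v : off_axis p ->
  is_derive p v inv_radius (- (inv_radius p * (inv_radius p * inv_radius p))
    * (p 0 2 * v 0 2 + p 0 3 * v 0 3)).
Proof.
move=> p0; have d i := is_derive_mul (is_derive_coord p v i) (is_derive_coord p v i).
have ds := is_derive_comp1 (is_deriveD (d 2) (d 3))
  (is_derive1_sqrt (p0 : 0 < p 0 2 * p 0 2 + p 0 3 * p 0 3)).
have r0 : Num.sqrt (p 0 2 * p 0 2 + p 0 3 * p 0 3) != 0 by rewrite gt_eqF// sqrtr_gt0.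
have := @is_derive_inv _ _
  (fun q : 'rV[R]_4 => Num.sqrt (q 0 2 * q 0 2 + q 0 3 * q 0 3)) p v _ r0 ds.
apply: is_derive_ext => [//|].
rewrite /inv_radius -[p 0 2 ^+ 2]/(p 0 2 * p 0 2) -[p 0 3 ^+ 2]/(p 0 3 * p 0 3).
by move: r0; set r := Num.sqrt _ => r0; field.
Qed.

Lemma inv_radius_generated i : exists2 d, generated inv_radius d &
  forall p, off_axis p -> is_derive p (delta_mx 0 i) inv_radius (d p).
Proof.
pose v : 'rV[R]_4 := delta_mx 0 i.
exists (fun p => - (inv_radius p * (inv_radius p * inv_radius p))
    * (p 0 2 * v 0 2 + p 0 3 * v 0 3)).
  apply: GenMul.
    by apply: GenOpp; apply: GenMul; [|apply: GenMul]; exact: GenExtra.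
  by apply: GenAdd; apply: GenMul; [exact: GenCoord|exact: GenCst|exact: GenCoord|exact: GenCst].
by move=> p; exact: inv_radius_derive.
Qed.

Lemma inv_radius_continuous p : off_axis p -> {for p, continuous inv_radius}.
Proof.
move=> p0; apply: continuous_inv; first by rewrite gt_eqF// sqrtr_gt0.
apply: (@continuous_comp _ _ _ (fun q : 'rV[R]_4 => q 0 2 ^+ 2 + q 0 3 ^+ 2)).
  exact: sum_continuous.
exact: sqrt_continuous.
Qed.

Let off_smooth n (X : set 'rV[R]_4) (g : 'rV[R]_4 -> 'rV[R]_n.+1) :=
  @generated_smooth _ _ _ open_off_axis _ inv_radius_generated inv_radius_continuous n X g.

Lemma inv_radius_embed h q : unit_pair h -> 0 < q 0 2 ->
  inv_radius (embed h q) = (q 0 2)^-1.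
Proof.
move=> hu q2; rewrite /inv_radius !vec4E !exprMn -mulrDr hu mulr1 sqrtr_sqr.
by rewrite gtr0_norm.
Qed.

Lemma angle_embed h q : unit_pair h -> 0 < q 0 2 ->
  angle (embed h q) = vec2 h.1 h.2.
Proof.
move=> hu q2; have q20 : q 0 2 != 0 by rewrite gt_eqF.
rewrite /angle inv_radius_embed// !vec4E.
by rewrite ![q 0 2 * _ / _]mulrAC divff// !mul1r.
Qed.

Lemma off_E0P p : (E `\` E0) p <->
  exists h q, [/\ unit_pair h, p = embed h q, 0 < q 0 2 & ellipsoid s3 q].
Proof.
split=> [[pE nE0]|[h [q [hu -> q2 qE]]]].
  have [h [q [hu pq q2 qE]]] := ellipsoid_sheet pE; exists h, q; split => //.
  rewrite lt0r q2 andbT; apply/eqP => q20; apply: nE0.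
  by rewrite pq; apply/(E0_embed hu qE).
split; first exact/ellipsoid_embed.
by move/(E0_embed hu qE) => q20; move: q2; rewrite q20 ltxx.
Qed.

Lemma off_E0_off_axis : E `\` E0 `<=` off_axis.
Proof.
move=> p /off_E0P[h [q [hu -> q2 _]]].
by rewrite /off_axis/= !vec4E !exprMn -mulrDr hu mulr1 exprn_gt0.
Qed.

(** The trivialization: the angle of p, and p rotated onto the page of angle
    y.  The radius r is written as its square times its inverse, so as to stay in
    the algebra generated by inv_radius. *)
Definition trivialize (y : 'rV[R]_2) (p : 'rV[R]_4) : 'rV[R]_(2 + 4) :=
  let r := (p 0 2 ^+ 2 + p 0 3 ^+ 2) * inv_radius p in
  row_mx (angle p) (vec4 (p 0 0) (p 0 1) (r * y 0 0) (r * y 0 1)).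

(** On the page of angle y the radius is the product d of (z,w) with y, so the
    inverse is polynomial. *)
Definition untrivialize (y : 'rV[R]_2) (r : 'rV[R]_(2 + 4)) : 'rV[R]_4 :=
  let u (i : 'I_2) := r 0 (lshift 4 i) in
  let x (i : 'I_4) := r 0 (rshift 2 i) in
  let d := x 2 * y 0 0 + x 3 * y 0 1 in
  vec4 (x 0) (x 1) (d * u 0) (d * u 1).

Lemma trivializeEl y p (k : 'I_2) : trivialize y p 0 (lshift 4 k) = angle p 0 k.
Proof. exact: row_mxEl. Qed.

Lemma trivializeEr (y : 'rV[R]_2) (p : 'rV[R]_4) (k : 'I_4) :
  let r := (p 0 2 ^+ 2 + p 0 3 ^+ 2) * inv_radius p in
  trivialize y p 0 (rshift 2 k) =
  vec4 (p 0 0) (p 0 1) (r * y 0 0) (r * y 0 1) 0 k.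
Proof. exact: row_mxEr. Qed.

Lemma trivialize_embed y h q : unit_pair h -> 0 < q 0 2 ->
  trivialize y (embed h q) = row_mx (vec2 h.1 h.2) (embed (pair_of y) q).
Proof.
move=> hu q2; rewrite /trivialize angle_embed// inv_radius_embed// !vec4E.
have -> // : ((q 0 2 * h.1) ^+ 2 + (q 0 2 * h.2) ^+ 2) / q 0 2 = q 0 2.
by rewrite !exprMn -mulrDr hu mulr1 expr2 mulfK ?gt_eqF.
Qed.

Lemma untrivialize_embed y u q : unit_circle R y ->
  untrivialize y (row_mx u (embed (pair_of y) q)) = embed (pair_of u) q.
Proof.
move=> /unit_pair_of yu; rewrite /untrivialize !row_mxEl !row_mxEr !vec4E /=.
rewrite -!mulrA -mulrDr -!expr2 [_ ^+ 2 + _]yu mulr1.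
by [].
Qed.

Lemma angle_smooth : smooth (E `\` E0) angle.
Proof.
apply: off_smooth; first exact: off_E0_off_axis.
move=> j; have G (i : 'I_4) : generated inv_radius (fun q : 'rV[R]_4 => q 0 i * inv_radius q).
  by apply: GenMul; [exact: GenCoord|exact: GenExtra].
case: (ord2_cases j) => ->.
  by apply: generated_eq (G 2) => q; rewrite vec2E.
by apply: generated_eq (G 3) => q; rewrite vec2E.
Qed.

Lemma trivialize_smooth y : smooth (E `\` E0) (trivialize y).
Proof.
apply: off_smooth; first exact: off_E0_off_axis.
have G (i : 'I_4) : generated inv_radius (fun q : 'rV[R]_4 => q 0 i * inv_radius q).
  by apply: GenMul; [exact: GenCoord|exact: GenExtra].
have Gr (k : R) : generated inv_radius
    (fun p => (p 0 2 ^+ 2 + p 0 3 ^+ 2) * inv_radius p * k).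
  apply: GenMul; last exact: GenCst.
  apply: GenMul; last exact: GenExtra.
  apply: GenAdd.
    exact: (GenMul (GenCoord _ _) (GenCoord _ _)).
  exact: (GenMul (GenCoord _ _) (GenCoord _ _)).
move=> j; case: (split_ordP (j : 'I_(2 + 4))) => k ->.
  case: (ord2_cases k) => ->.
    by apply: generated_eq (G 2) => q; rewrite trivializeEl vec2E.
  by apply: generated_eq (G 3) => q; rewrite trivializeEl vec2E.
case: (ord4_cases k) => ->.
- by apply: generated_eq (GenCoord _ 0) => q; rewrite trivializeEr vec4E.
- by apply: generated_eq (GenCoord _ 1) => q; rewrite trivializeEr vec4E.
- by apply: generated_eq (Gr (y 0 0)) => q; rewrite trivializeEr vec4E.
- by apply: generated_eq (Gr (y 0 1)) => q; rewrite trivializeEr vec4E.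
Qed.

Lemma untrivialize_smooth y X : smooth X (untrivialize y).
Proof.
have h0 (i : 'I_(1 + 4).+1) : exists2 d : 'rV[R]_(1 + 4).+1 -> R, generated (fun=> 0) d &
    forall p, setT p -> is_derive p (delta_mx 0 i) (fun=> 0 : R) (d p).
  by exists (fun=> 0); [exact: GenCst|move=> p _; exact: is_derive_cst].
apply: (@generated_smooth _ _ setT openT (fun=> 0) h0) => //.
  by move=> p _; exact: cst_continuous.
pose x (i : 'I_4) (r : 'rV[R]_(1 + 4).+1) := r 0 (rshift 2 i).
pose u (i : 'I_2) (r : 'rV[R]_(1 + 4).+1) := r 0 (lshift 4 i).
have Gx i : generated (fun=> 0) (x i) by exact: GenCoord.
have Gu i : generated (fun=> 0) (u i) by exact: GenCoord.
have Gd i : generated (fun=> 0) (fun r => (x 2 r * y 0 0 + x 3 r * y 0 1) * u i r).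
  apply: GenMul; last exact: Gu.
  by apply: GenAdd; apply: GenMul; (exact: Gx || exact: GenCst).
move=> j; case: (ord4_cases j) => ->.
- by apply: generated_eq (Gx 0) => q; rewrite vec4E.
- by apply: generated_eq (Gx 1) => q; rewrite vec4E.
- by apply: generated_eq (Gd 0) => q; rewrite vec4E.
- by apply: generated_eq (Gd 1) => q; rewrite vec4E.
Qed.

Lemma angle_fibration : smooth_fibration (E `\` E0) (unit_circle R) angle.
Proof.
split; first exact: angle_smooth.
  apply/seteqP; split=> [_ [p /off_E0P[h [q [hu -> q2 qE]]] <-]|th thu].
    by rewrite angle_embed//; apply/unit_pair_of; rewrite pair_ofK.
  have hu := (unit_pair_of th).1 thu.
  exists (embed (pair_of th) (vec3 0 0 c)).
    apply/off_E0P; exists (pair_of th), (vec3 0 0 c); split => //.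
      by rewrite vec3E.
    by apply/ellipsoid3E; rewrite !vec3E !mul0r divff ?gt_eqF//; ring.
  by rewrite angle_embed ?vec3E// vec2_pair_of.
move=> y yu; exists setT, (trivialize y); split => //; first exact: openT.
  exists (untrivialize y); split.
  - move=> _ [/off_E0P[h [q [hu -> q2 qE]]] _].
    rewrite trivialize_embed//; split.
      rewrite /= row_mxKl row_mxKr; split => //.
      + by apply/unit_pair_of; rewrite pair_ofK.
      + by apply/off_E0P; exists (pair_of y), q; split => //; apply/unit_pair_of.
      + by rewrite angle_embed ?vec2_pair_of//; apply/unit_pair_of.
    by rewrite untrivialize_embed// pair_ofK.
  - move=> r [ru _ /off_E0P[h [q [hu rq q2 qE]]]].
    rewrite rq angle_embed// => yE.
    have hE : h = pair_of y by rewrite -yE pair_ofK.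
    have rE : r = row_mx (@lsubmx _ 1 2 4 r) (embed (pair_of y) q).
      by rewrite -hE -rq (@hsubmxK _ 1 2 4 r).
    have uu := (unit_pair_of _).1 ru.
    have GE : untrivialize y r = embed (pair_of (@lsubmx _ 1 2 4 r)) q.
      by rewrite [in LHS]rE untrivialize_embed.
    rewrite GE; split.
      by split => //; apply/off_E0P; exists (pair_of (@lsubmx _ 1 2 4 r)), q.
    by rewrite trivialize_embed// vec2_pair_of -rE.
  - by move=> p [Xp _]; have [V [g [oV Vp Cg fg]]] := trivialize_smooth y Xp;
      exists V, g; split => // q [Xq _]; exact: fg.
  - exact: untrivialize_smooth.
by move=> p _ _; rewrite row_mxKl.
Qed.

Definition half_sheet (h : R * R) : set 'rV[R]_4 :=
  [set embed h q | q in [set q | ellipsoid s3 q /\ 0 <= q 0 2]].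

(** The page of angle h satisfies the closed conditions that (z,w) is a
    nonnegative multiple of h, and its points on E0 are limits of points with
    r > 0. *)
Lemma page_angle th : unit_circle R th ->
  page E E0 angle th = half_sheet (pair_of th).
Proof.
move=> thu; have hu := (unit_pair_of th).1 thu; set h := pair_of th in hu *.
apply/seteqP; split=> [p [pE pcl]|_ [q [qE q2] <-]].
  pose g (p : 'rV[R]_4) := p 0 2 * h.1 + p 0 3 * h.2.
  pose k (p : 'rV[R]_4) := p 0 2 * h.2 + - (p 0 3 * h.1).
  have cg : {for p, continuous g}.
    by apply: continuous_addr; apply: continuous_mulr; exact: row_coord_continuous.
  have ck : {for p, continuous k}.
    by apply: continuous_addr; last apply: continuous_oppr;
      apply: continuous_mulr; exact: row_coord_continuous.
  have onA r : ((E `\` E0) r /\ angle r = th) -> 0 <= g r /\ k r = 0.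
    move=> [/off_E0P[h' [q' [h'u -> q'2 q'E]]]]; rewrite angle_embed// => thE.
    have hE : h' = h by rewrite /h -thE pair_ofK.
    rewrite hE /g /k !vec4E; split; last by ring.
    by rewrite -!mulrA -mulrDr -!expr2 hu mulr1 ltW.
  have g0 : 0 <= g p by apply: closure_ge0 cg _ pcl => q /onA[].
  have k0 : 0 <= k p by apply: closure_ge0 ck _ pcl => q /onA[_ ->].
  have k1 : 0 <= - k p.
    by apply: closure_ge0 (continuous_oppr ck) _ pcl => q /onA[_ ->]; rewrite oppr0.
  have k00 : k p = 0 by apply/eqP; rewrite eq_le k0 -oppr_ge0 k1.
  have pq : p = embed h (fold h p).
    rewrite [LHS]vec4_eta /embed /fold !vec3E; apply/vec4_inj; split => //.
      rewrite -[LHS]mulr1 -hu.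
      have -> : p 0 2 * (h.1 ^+ 2 + h.2 ^+ 2) =
        (p 0 2 * h.1 + p 0 3 * h.2) * h.1 + h.2 * k p by rewrite /k; ring.
      by rewrite k00 mulr0 addr0.
    rewrite -[LHS]mulr1 -hu.
    have -> : p 0 3 * (h.1 ^+ 2 + h.2 ^+ 2) =
      (p 0 2 * h.1 + p 0 3 * h.2) * h.2 - h.1 * k p by rewrite /k; ring.
    by rewrite k00 mulr0 subr0.
  exists (fold h p) => //; split; last by rewrite /fold vec3E.
  by apply/(ellipsoid_embed a b c _ hu); rewrite -pq.
split; first exact/ellipsoid_embed.
have inA q' : ellipsoid s3 q' -> 0 < q' 0 2 ->
    (E `\` E0) (embed h q') /\ angle (embed h q') = th.
  move=> q'E q'2; split; first by apply/off_E0P; exists h, q'.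
  by rewrite angle_embed// vec2_pair_of.
have [q20|q20] := eqVneq (q 0 2) 0; last first.
  by apply: subset_closure; apply: inA; rewrite // lt0r q20.
move=> U nU; have nU' : \forall q' \near q, U (embed h q') := embed_continuous nU.
have [q' [Uq' q'E q'2]] := interior_near b0 bc ca qE q20 nU'.
by exists (embed h q'); split => //; exact: inA.
Qed.

Lemma E0_half_sheet h : unit_pair h -> E0 `<=` half_sheet h.
Proof.
move=> hu p pE; have [q [qE -> q2]] := E0_ellipsoid c pE hu.
by exists q => //; split => //; rewrite q2.
Qed.

Lemma sheet_halves h : sheet a b c h = half_sheet h `|` half_sheet (- h.1, - h.2).
Proof.
apply/seteqP; split=> [_ [q qE <-]|p].
  have [q2|q2] := leP 0 (q 0 2); first by left; exists q.
  right; exists (vec3 (q 0 0) (q 0 1) (- q 0 2)).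
    split; last by rewrite vec3E oppr_ge0 ltW.
    by apply/ellipsoid3E; rewrite !vec3E mulNr sqrrN; exact/ellipsoid3E.
  by rewrite /embed !vec3E /= !mulrNN.
case=> -[q [qE _] <-]; first by exists q.
exists (vec3 (q 0 0) (q 0 1) (- q 0 2)).
  by apply/ellipsoid3E; rewrite !vec3E mulNr sqrrN; exact/ellipsoid3E.
by rewrite /embed !vec3E /= !mulrN !mulNr.
Qed.

End Book.

(** * Charts of the half ellipsoids *)

Section Charts.
Variables (R : realType) (a b c : R).
Hypotheses (b0 : 0 < b) (bc : b < c) (ca : c < a).

Let c0 : 0 < c. Proof. exact: lt_trans bc. Qed.
Let a0 : 0 < a. Proof. exact: lt_trans ca. Qed.
Let an0 : a != 0. Proof. by rewrite gt_eqF. Qed.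
Let bn0 : b != 0. Proof. by rewrite gt_eqF. Qed.
Let cn0 : c != 0. Proof. by rewrite gt_eqF. Qed.

Local Notation s3 := (vec3 a b c).
Local Notation s4 := (vec4 a b c c).
Local Notation E := (ellipsoid s4).
Local Notation E0 := (E0 a b).
Local Notation half_sheet := (half_sheet a b c).

Definition chart_weight (u : 'rV[R]_2) : R := (1 + u 0 0 ^+ 2 + u 0 1 ^+ 2)^-1.

(** The inverse of the stereographic projection from the point (0,e,0) of the
    unit sphere, rescaled to the ellipsoid; e is 1 or -1.  The pole lies on E0, so
    the last coordinate of the image has the sign of the second coordinate of u,
    and the half ellipsoid minus the pole is the image of a half plane. *)
Definition chart_point (e : R) (u : 'rV[R]_2) : 'rV[R]_3 :=
  let k := chart_weight u in
  vec3 (a * (2 * u 0 0 * k)) (e * b * (1 - 2 * k)) (c * (2 * u 0 1 * k)).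

Definition chart_coord (e : R) (h : R * R) (p : 'rV[R]_4) : 'rV[R]_2 :=
  let q := fold h p in
  let d := 1 - e * (q 0 1 / b) in
  vec2 (q 0 0 / a / d) (q 0 2 / c / d).

Lemma chart_den_gt0 (u : 'rV[R]_2) : 0 < 1 + u 0 0 ^+ 2 + u 0 1 ^+ 2.
Proof. by rewrite -addrA ltr_pwDl// addr_ge0// sqr_ge0. Qed.

Lemma chart_weight_gt0 u : 0 < chart_weight u.
Proof. by rewrite invr_gt0 chart_den_gt0. Qed.

Lemma chart_weight_derive u v : is_derive u v chart_weight
  (- (chart_weight u * chart_weight u) * (2 * (u 0 0 * v 0 0 + u 0 1 * v 0 1))).
Proof.
have d i := is_derive_mul (is_derive_coord u v i) (is_derive_coord u v i).
have ds := is_deriveD (is_deriveD (is_derive_cst (1 : R) u v) (d 0)) (d 1).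
have n0 : 1 + u 0 0 * u 0 0 + u 0 1 * u 0 1 != 0 by rewrite gt_eqF// chart_den_gt0.
have := @is_derive_inv _ _
  (fun u : 'rV[R]_2 => 1 + u 0 0 * u 0 0 + u 0 1 * u 0 1) u v _ n0 ds.
apply: is_derive_ext => [//|].
rewrite /chart_weight -[u 0 0 ^+ 2]/(u 0 0 * u 0 0) -[u 0 1 ^+ 2]/(u 0 1 * u 0 1).
by move: n0; set r := 1 + _ + _ => n0; field.
Qed.

Lemma chart_weight_continuous u : {for u, continuous chart_weight}.
Proof.
apply: continuous_inv; first by rewrite gt_eqF// chart_den_gt0.
have sq (i : 'I_2) : {for u, continuous (fun q : 'rV[R]_2 => q 0 i ^+ 2)}.
  exact: (continuous_mul (@row_coord_continuous _ _ i u) (@row_coord_continuous _ _ i u)).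
have c1 : {for u, continuous (fun _ : 'rV[R]_2 => 1 : R)} by exact: cst_continuous.
exact: (continuous_addr (continuous_addr c1 (sq 0)) (sq 1)).
Qed.

Lemma chart_weight_generated i : exists2 d, generated chart_weight d &
  forall p, setT p -> is_derive p (delta_mx 0 i) chart_weight (d p).
Proof.
pose v : 'rV[R]_2 := delta_mx 0 i.
exists (fun u => - (chart_weight u * chart_weight u)
    * (2 * (u 0 0 * v 0 0 + u 0 1 * v 0 1))).
  apply: GenMul; first by apply: GenOpp; apply: GenMul; exact: GenExtra.
  apply: GenMul; first exact: GenCst.
  by apply: GenAdd; apply: GenMul; (exact: GenCoord || exact: GenCst).
by move=> p _; exact: chart_weight_derive.
Qed.

Lemma chart_smooth e h X : smooth X (fun u => embed h (chart_point e u)).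
Proof.
apply: (@generated_smooth _ _ setT openT chart_weight chart_weight_generated
  (fun p _ => @chart_weight_continuous p)) => //.
have G (k : R) (i : 'I_2) : generated chart_weight
    (fun u : 'rV[R]_2 => k * (2 * u 0 i * chart_weight u)).
  apply: GenMul; first exact: GenCst.
  apply: GenMul; last exact: GenExtra.
  by apply: GenMul; [exact: GenCst|exact: GenCoord].
move=> j; case: (ord4_cases j) => ->.
- by apply: generated_eq (G a 0) => u; rewrite vec4E vec3E.
- have : generated chart_weight (fun u => e * b * (1 + - (2 * chart_weight u))).
    apply: GenMul; first exact: GenCst.
    apply: GenAdd; first exact: GenCst.
    by apply: GenOpp; apply: GenMul; [exact: GenCst|exact: GenExtra].
  by apply: generated_eq => u; rewrite vec4E vec3E.
- have := GenMul (G c 1) (GenCst chart_weight h.1).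
  by apply: generated_eq => u; rewrite vec4E vec3E.
- have := GenMul (G c 1) (GenCst chart_weight h.2).
  by apply: generated_eq => u; rewrite vec4E vec3E.
Qed.

Lemma chart_ellipsoid e u : e ^+ 2 = 1 -> ellipsoid s3 (chart_point e u).
Proof.
move=> e1; apply/ellipsoid3E; rewrite !vec3E; set k := chart_weight u.
have kE : k * (1 + u 0 0 ^+ 2 + u 0 1 ^+ 2) = 1.
  by rewrite mulVf// gt_eqF// chart_den_gt0.
have -> : a * (2 * u 0 0 * k) / a = 2 * u 0 0 * k by field.
have -> : c * (2 * u 0 1 * k) / c = 2 * u 0 1 * k by field.
have -> : e * b * (1 - 2 * k) / b = e * (1 - 2 * k) by field.
have -> : (2 * u 0 0 * k) ^+ 2 + (e * (1 - 2 * k)) ^+ 2 + (2 * u 0 1 * k) ^+ 2 =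
  4 * k * (k * (1 + u 0 0 ^+ 2 + u 0 1 ^+ 2)) - 4 * k ^+ 2 + e ^+ 2 * (1 - 2 * k) ^+ 2.
  by ring.
by rewrite kE e1; ring.
Qed.

Lemma chartK e h u : e ^+ 2 = 1 -> unit_pair h ->
  chart_coord e h (embed h (chart_point e u)) = u.
Proof.
move=> e1 hu; rewrite /chart_coord embedK// !vec3E [RHS]vec2_eta.
have k0 : chart_weight u != 0 by rewrite gt_eqF// chart_weight_gt0.
move: k0; set k := chart_weight u => k0.
have -> : e * (e * b * (1 - 2 * k) / b) = e ^+ 2 * (1 - 2 * k) by field.
rewrite e1 mul1r subKr; apply/vec2_inj; split; field; by rewrite ?an0 ?cn0 k0.
Qed.

Lemma chart_coordK e q : ellipsoid s3 q -> e ^+ 2 = 1 -> q 0 1 != e * b ->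
  forall h, unit_pair h -> chart_point e (chart_coord e h (embed h q)) = q.
Proof.
move=> /ellipsoid3E qE e1 qe h hu; rewrite /chart_coord embedK//.
rewrite [RHS]vec3_eta /chart_point /chart_weight !vec2E.
pose X := q 0 0 / a; pose Y := e * (q 0 1 / b); pose Z := q 0 2 / c.
have Y2 : Y ^+ 2 = (q 0 1 / b) ^+ 2 by rewrite /Y exprMn e1 mul1r.
have XYZ : X ^+ 2 + Y ^+ 2 + Z ^+ 2 = 1 by rewrite Y2.
have Y1 : 1 - Y != 0.
  rewrite subr_eq0; apply: contra_neq qe => Y1.
  have : e * Y * b = q 0 1 by rewrite /Y mulrA -expr2 e1 mul1r divfK.
  by rewrite -Y1 mulr1.
rewrite -/X -/Y -/Z.
have -> : 1 + (X / (1 - Y)) ^+ 2 + (Z / (1 - Y)) ^+ 2 = 2 / (1 - Y).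
  have -> : 1 + (X / (1 - Y)) ^+ 2 + (Z / (1 - Y)) ^+ 2 =
    ((1 - Y) ^+ 2 + X ^+ 2 + Z ^+ 2) / (1 - Y) ^+ 2 by field.
  have -> : (1 - Y) ^+ 2 + X ^+ 2 + Z ^+ 2 = 2 * (1 - Y).
    rewrite (_ : (1 - Y) ^+ 2 + X ^+ 2 + Z ^+ 2 =
      1 - 2 * Y + (X ^+ 2 + Y ^+ 2 + Z ^+ 2)); last by ring.
    by rewrite XYZ; ring.
  by field.
have -> : q 0 0 = a * X by rewrite /X mulrC divfK.
have -> : q 0 2 = c * Z by rewrite /Z mulrC divfK.
have -> : q 0 1 = e * b * Y.
  by rewrite /Y mulrACA -expr2 e1 mul1r mulrC divfK.
by apply/vec3_inj; split; field; rewrite Y1.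
Qed.

(** The second coordinate of chart_point determines the derivative of
    chart_weight, which vanishes; the two other coordinates then give those of
    v. *)
Lemma chart_immersion e h u v : e ^+ 2 = 1 -> unit_pair h ->
  'D_v (fun u => embed h (chart_point e u)) u = 0 -> v = 0.
Proof.
move=> e1 hu.
pose k := chart_weight u.
pose dk := - (k * k) * (2 * (u 0 0 * v 0 0 + u 0 1 * v 0 1)).
have dK : is_derive u v chart_weight dk by exact: chart_weight_derive.
have dx i : is_derive u v (fun u : 'rV[R]_2 => 2 * u 0 i * chart_weight u)
    (2 * u 0 i * dk + 2 * v 0 i * k).
  have d2 := is_derive_mulr 2 (is_derive_coord u v i).
  have := is_derive_mul d2 dK; apply: is_derive_ext => [t|]; first by rewrite (mulrC 2).
  by rewrite (mulrC 2 (u 0 i)) (mulrC 2 (v 0 i)).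
have scale (l : R) (g : 'rV[R]_2 -> R) d : is_derive u v g d ->
    is_derive u v (fun u => l * g u) (l * d).
  by move=> dg; have := is_derive_mulr l dg; apply: is_derive_ext => [t|]; rewrite mulrC.
have dy : is_derive u v (fun u => 1 - 2 * chart_weight u) (- (2 * dk)).
  have := is_deriveB (is_derive_cst (1 : R) u v) (scale 2 _ _ dK).
  by apply: is_derive_ext => //; rewrite sub0r.
have [_ ->] := is_derive_embed h (is_derive_vec3 (scale a _ _ (dx 0))
  (scale (e * b) _ _ dy) (scale c _ _ (dx 1))).
move=> /eqP; rewrite embed_eq0// vec3_0 => /eqP/vec3_inj[Ex Ey Ez].
have k0 : k != 0 by rewrite gt_eqF// chart_weight_gt0.
have en0 : e != 0 by rewrite -sqrf_eq0 e1 oner_eq0.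
have two : 2 != 0 :> R by rewrite pnatr_eq0.
have dk0 : dk = 0.
  move/eqP: Ey; rewrite mulf_eq0 mulf_eq0 (negPf en0) (negPf bn0) oppr_eq0.
  by rewrite mulf_eq0 (negPf two) => /eqP.
have vi (l : R) i : l != 0 -> l * (2 * u 0 i * dk + 2 * v 0 i * k) = 0 -> v 0 i = 0.
  move=> l0; rewrite dk0 mulr0 add0r => /eqP.
  by rewrite mulf_eq0 (negPf l0) mulf_eq0 (negPf k0) orbF mulf_eq0 (negPf two) => /eqP.
rewrite (vec2_eta v) (vi a 0)// (vi c 1)//.
by apply/rowP; apply: ord2P; rewrite !vec2E mxE.
Qed.

(** The stereographic charts from the two poles (0,b,0) and (0,-b,0) cover the
    half ellipsoid; away from E0 they are charts at interior points. *)
Lemma half_sheet_regular h : unit_pair h -> regular_surface (half_sheet h) E0.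
Proof.
move=> hu; split; first exact: E0_half_sheet.
move=> _ [q [qE q2] <-].
have [e e1 qe] : exists2 e : R, e ^+ 2 = 1 & q 0 1 != e * b.
  have [qb|qb] := eqVneq (q 0 1) (1 * b); last by exists 1; rewrite ?expr1n.
  exists (-1); first by rewrite sqrrN expr1n.
  by rewrite qb mul1r mulN1r -subr_eq0 opprK -mulr2n mulrn_eq0.
pose V : set 'rV[R]_4 := [set p | p 0 1 != e * b].
have ord_max1 : ord_max = 1 :> 'I_2 by apply: val_inj.
have chart_r u : chart_point e u 0 2 = u 0 1 * (2 * c * chart_weight u).
  by rewrite vec3E; ring.
have w0 u : 0 < 2 * c * chart_weight u by rewrite !mulr_gt0// chart_weight_gt0.
have chartV u : V (embed h (chart_point e u)).
  rewrite /V/= vec4E vec3E -subr_eq0 mulrBr mulr1 addrAC subrr add0r oppr_eq0.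
  rewrite !mulf_neq0 ?pnatr_eq0//; last by rewrite gt_eqF// chart_weight_gt0.
  by rewrite -sqrf_eq0 e1 oner_eq0.
exists setT, V, (fun u => embed h (chart_point e u)), (chart_coord e h),
  [set u | 0 <= u 0 ord_max], [set u | u 0 ord_max = 0].
split.
- by right.
- split; [exact: openT| |by rewrite /V/= vec4E].
  rewrite openE => p /= pe.
  have cp : {for p, continuous (fun p : 'rV[R]_4 => (p 0 1 - e * b) ^+ 2)}.
    have d : {for p, continuous (fun p : 'rV[R]_4 => p 0 1 - e * b)}.
      have k : {for p, continuous (fun _ : 'rV[R]_4 => - (e * b))}.
        exact: cst_continuous.
      exact: (continuous_addr (@row_coord_continuous _ _ 1 p) k).
    exact: (continuous_mul d d).
  have p0 : 0 < (p 0 1 - e * b) ^+ 2 by rewrite lt0r sqr_ge0 sqrf_eq0 subr_eq0 pe.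
  have near0 : nbhs p [set p' : 'rV[R]_4 | 0 < (p' 0 1 - e * b) ^+ 2].
    exact: (cvgr_gt _ cp 0 p0).
  suff : nbhs p V by [].
  apply: filterS near0 => p' p'0; rewrite /V/=.
  by move: p'0; rewrite /= lt0r sqrf_eq0 subr_eq0 => /andP[].
- split; first exact: chart_smooth.
  by move=> u v _; exact: chart_immersion.
- split; apply/seteqP; split=> [_ [u [_ /= u1] <-]|p].
  + split => //; exists (chart_point e u) => //; split; first exact: chart_ellipsoid.
    by rewrite chart_r pmulr_lge0// -ord_max1.
  + move=> [[q' [q'E q'2] <-]]; rewrite /V/= vec4E => q'e.
    have qK := chart_coordK q'E e1 q'e hu.
    exists (chart_coord e h (embed h q')); last by rewrite qK.
    split => //=; rewrite ord_max1.
    by move: q'2; rewrite -{1}qK chart_r pmulr_lge0.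
  + split => //; apply/(E0_embed hu (chart_ellipsoid u e1)).
    by rewrite chart_r -ord_max1 u1 mul0r.
  + move=> [pE]; have [q' [q'E -> q'2]] := E0_ellipsoid c pE hu.
    rewrite /V/= vec4E => q'e; have qK := chart_coordK q'E e1 q'e hu.
    exists (chart_coord e h (embed h q')); last by rewrite qK.
    split => //=; rewrite ord_max1.
    move/eqP: q'2; rewrite -{1}qK chart_r mulf_eq0 => /orP[/eqP//|].
    by rewrite (gt_eqF (w0 _)).
- split; last by move=> u _ _; exact: chartK.
  apply: continuous_in_subspaceT => p /set_mem[_ pV].
  have d0 : 1 - e * (p 0 1 / b) != 0.
    rewrite subr_eq0; apply: contra_neq pV => d1.
    have : e * (e * (p 0 1 / b)) * b = p 0 1 by rewrite mulrA -expr2 e1 mul1r divfK.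
    by rewrite -d1 mulr1.
  have ce i : {for p, continuous (fun p => fold h p 0 i)}.
    apply: (@continuous_comp _ _ _ (fold h) (fun q : 'rV[R]_3 => q 0 i)).
      exact: fold_continuous.
    exact: row_coord_continuous.
  have cd : {for p, continuous (fun p => (1 - e * (fold h p 0 1 / b))^-1)}.
    apply: continuous_inv; first by rewrite vec3E.
    have k l : {for p, continuous (fun _ : 'rV[R]_4 => l : R)}.
      exact: cst_continuous.
    have ce1 := @continuous_mulr _ _ _ b^-1 _ (ce 1).
    exact: (@continuous_addr _ _ (fun=> 1) (fun p => - (e * (fold h p 0 1 / b))) _
      (k 1) (continuous_oppr (continuous_mul (k e) ce1))).
  apply: continuous_rowP => i; case: (ord2_cases i) => ->.
    rewrite (_ : (fun t => _) = (fun p => fold h p 0 0 / a / (1 - e * (fold h p 0 1 / b)))).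
      by apply: continuous_mul => //; exact: continuous_mulr.
    by apply/funext => t; rewrite vec2E.
  rewrite (_ : (fun t => _) = (fun p => fold h p 0 2 / c / (1 - e * (fold h p 0 1 / b)))).
    by apply: continuous_mul => //; exact: continuous_mulr.
  by apply/funext => t; rewrite vec2E.
Qed.

(** Two opposite pages meet in E0 only, where r = - r. *)
Lemma angle_book : book_structure E E0 (@angle R).
Proof.
split; first exact: angle_fibration.
- move=> th thu; rewrite page_angle//; have hu := (unit_pair_of th).1 thu.
  by split; [exact: E0_half_sheet|exact: half_sheet_regular].
- apply/seteqP; split=> [p pE th thu|p pP].
    rewrite page_angle//; apply: E0_half_sheet => //; exact/unit_pair_of.
  have u1 : unit_circle R (vec2 1 0) by apply/unit_pair_of; rewrite /unit_pair/= !vec2E; ring.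
  have u2 : unit_circle R (vec2 (-1) 0) by apply/unit_pair_of; rewrite /unit_pair/= !vec2E; ring.
  have := pP _ u1; have := pP _ u2; rewrite !page_angle//.
  move=> [q [qE q2] <-] [q' [q'E q'2] /vec4_inj[_ _ + _]].
  rewrite /= !vec2E mulr1 mulrN1 => q'q.
  apply/(E0_embed ((unit_pair_of _).1 u2) qE); apply/eqP.
  by rewrite eq_le q2 andbT -oppr_ge0 -q'q.
Qed.

Lemma sheet_pages h : unit_pair h -> exists th1 th2 : 'rV[R]_2,
  [/\ unit_circle R th1, unit_circle R th2, th1 <> th2 &
   sheet a b c h = page E E0 (@angle R) th1 `|` page E E0 (@angle R) th2].
Proof.
move=> hu; have hu' : unit_pair (- h.1, - h.2) by rewrite /unit_pair/= !sqrrN.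
have u1 : unit_circle R (vec2 h.1 h.2) by apply/unit_pair_of; rewrite pair_ofK.
have u2 : unit_circle R (vec2 (- h.1) (- h.2)).
  by apply/unit_pair_of; rewrite (pair_ofK (- h.1, - h.2)).
exists (vec2 h.1 h.2), (vec2 (- h.1) (- h.2)); split => //.
  move=> /vec2_inj[h1 h2]; have h10 : h.1 = 0 by lra.
  have h20 : h.2 = 0 by lra.
  by move: hu => /eqP; rewrite h10 h20 expr0n/= addr0 eq_sym oner_eq0.
by rewrite !page_angle// pair_ofK (pair_ofK (- h.1, - h.2)) sheet_halves.
Qed.

End Charts.

Unset Implicit Arguments.

Theorem theorem1 (R : realType) (a b c : R)
    (hb : 0 < b) (hbc : b < c) (hca : c < a) :
  let s := vec4 a b c c in
  let E := ellipsoid s in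
  let L1 := principal_line s ord0 in
  let L2 := principal_line s (inord 1) in
  let L3 := principal_line s ord_max in
  (* (i) *)
  [/\ umbilics s `<=` E0 a b,
      umbilics s =
        [set ellipse_point a b u | u in
           [set u | cos u ^+ 2 = (a ^+ 2 - c ^+ 2) / (a ^+ 2 - b ^+ 2)]],
      (umbilics s #= `I_4)%card,
      partial_umbilics s = E0 a b `\` umbilics s &
      exists t : nat -> R,
        [/\ forall j, (j < 4)%N -> t j < t j.+1,
            t 4%N = t 0%N + pi *+ 2,
            umbilics s = [set ellipse_point a b (t j) | j in `I_4] &
            partial_umbilics s =
              \bigcup_(j in `I_4)
                 [set ellipse_point a b u | u in `]t j, t j.+1[]]] /\
  exists P : set (set 'rV[R]_4),
    (* (ii) *)
    [/\ foliated_by_pencil E (E0 a b) P,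
        forall S, P S -> two_dim_ellipsoid S,
        forall S, P S -> integral_leaf S L1 L3 &
        forall S, P S ->
          exists s' : 'rV[R]_3,
            [/\ forall i, 0 < s' 0 i, injective (s' 0) &
                principally_equivalent (restricted_configuration s S)
                  (ellipsoid_configuration s')]] /\
    (* (iii) *)
    [/\ singular_points E L2 = E0 a b,
        forall p, E p -> ~ E0 a b p -> is_circle (leaf E L2 p),
        forall S p, P S -> S p -> forall v u,
          L2 p v -> tangent S p u -> dot v u = 0 &
        exists f : 'rV[R]_4 -> 'rV[R]_2,
          book_structure E (E0 a b) f /\
          forall S, P S -> exists th1 th2 : 'rV[R]_2,
            [/\ unit_circle R th1, unit_circle R th2, th1 <> th2 &
                S = page E (E0 a b) f th1 `|` page E (E0 a b) f th2]].
Proof.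
move=> s E L1 L2 L3; split; first exact: umbilics_part.
exists (pencil a b c); split; split.
- exact: pencil_foliated.
- by move=> _ [h hu ->]; exact: sheet_ellipsoid.
- by move=> _ [h hu ->]; exact: sheet_integral_leaf.
- move=> _ [h hu ->]; exists (vec3 a b c); split.
  + exact: axes3_gt0.
  + exact: axes3_injective.
  + exact: sheet_equivalent.
- exact: middle_line_singular.
- by move=> p; exact: middle_leaf_circle.
- by move=> S p PS Sp v u; exact: middle_line_orthogonal PS Sp.
- exists (@angle R); split; first exact: angle_book.
  by move=> _ [h hu ->]; exact: sheet_pages.
Qed.
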